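(* Assume that $\phi,\zeta\in C^1\big(X,\mathrm{SU}(2)\big)$, that $F_1$ is uniquely ergodic, and that $\rho_\phi>0$, where $\rho_\phi$, $\zeta$ and the diagonal cocycle $\delta=\zeta\,\phi\,(\zeta\circ F_1)^{-1}$ are associated to $\phi$ as in the context. Then, for each $\ell\in\mathbb N$ and $j\in\{0,\ldots,\ell\}$, $$\lim_{N\to\infty}\big\langle\varphi,\big(U_{\delta,\pi^{(\ell)},j}\big)^N\psi\big\rangle=0\quad\hbox{for each }\varphi\in\ker(D_{\delta,\ell})^\perp\hbox{ and }\psi\in\mathcal H^{(\pi^{(\ell)})}_j,$$ with $$\ker(D_{\delta,\ell})^\perp=\bigoplus_{k\in\{0,\ldots,\ell\},\,2k\ne\ell}L^2(X,\mu_X)\otimes\big\{\pi^{(\ell)}_{jk}\big\}$$ (which equals $\mathcal H^{(\pi^{(\ell)})}_j$ if $\ell$ is odd). In particular, $U_\delta$ is mixing in the subspace $$\mathcal H_{\rm mix}:=\left(\bigoplus_{\ell\in2\mathbb N}\ \bigoplus_{j\in\{0,\ldots,\ell\}}\ \bigoplus_{k\in\{0,\ldots,\ell\}\setminus\{\ell/2\}}L^2(X,\mu_X)\otimes\big\{\pi^{(\ell)}_{jk}\big\}\right)\oplus\left(\bigoplus_{\ell\in2\mathbb N+1}\ \bigoplus_{j\in\{0,\ldots,\ell\}}\mathcal H^{(\pi^{(\ell)})}_j\right)\subset\mathcal H.$$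
   Context: Setting. $X$ is a smooth compact second countable Hausdorff manifold with Borel probability measure $\mu_X$, $\{F_t\}_{t\in\mathbb R}$ a $C^1$ flow on $X$ preserving $\mu_X$ with continuous vector field $Y$, $\mathcal L_Yf(x)=\frac d{dt}|_{t=0}f(F_t(x))$. ''$F_1$ uniquely ergodic'' means that $\mu_X$ is the only $F_1$-invariant Borel probability measure. $\mathbb N=\{0,1,2,\dots\}$. $\mathcal H:=L^2(X\times\mathrm{SU}(2),\mu_X\otimes\mu)$, $\mu$ being normalised Haar measure. For a measurable $\delta:X\to\mathrm{SU}(2)$, $T_\delta(x,g)=(F_1(x),g\delta(x))$ and $U_\delta\psi=\psi\circ T_\delta$ is the (unitary) Koopman operator in $\mathcal H$. ''$U_\delta$ is mixing in a closed subspace $\mathcal K$'' means $\langle\varphi,U_\delta^N\psi\rangle\to0$ as $N\to\infty$ for all $\varphi\in\mathcal K$, $\psi\in\mathcal H$. Degree. $\mathfrak{su}(2)$ has the scalar product $\langle Z_1,Z_2\rangle=\frac12\mathrm{Tr}(Z_1Z_2^* )$. For $\phi\in C^1(X,\mathrm{SU}(2))$: $M_\phi:=(\mathcal L_Y\phi)\phi^{-1}:X\to\mathfrak{su}(2)$; $(W_\phi f)(x)=\phi(x)f(F_1(x))\phi(x)^{-1}$, unitary in $L^2(X,\mathfrak{su}(2))$; $P_\phi$ is the orthogonal projection onto $\ker(1-W_\phi)$. If $F_1$ is ergodic, $\|(P_\phi M_\phi)(x)\|$ is $\mu_X$-a.e. equal to a constant, denoted $\rho_\phi\ge0$. Transfer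 function. Write $(P_\phi M_\phi)(x)=\begin{pmatrix}ia(x)&b(x)+ic(x)\\-b(x)+ic(x)&-ia(x)\end{pmatrix}$ with $a,b,c$ real-valued. If $\rho_\phi>0$, $\zeta:X\to\mathrm{SU}(2)$ is the ($\mu_X$-a.e. defined) measurable function $$\zeta(x)=\begin{pmatrix}i\sqrt{\frac{\rho_\phi+a(x)}{2\rho_\phi}}\,\frac{b(x)-ic(x)}{|b(x)+ic(x)|}&\sqrt{\frac{\rho_\phi-a(x)}{2\rho_\phi}}\\-\sqrt{\frac{\rho_\phi-a(x)}{2\rho_\phi}}&-i\sqrt{\frac{\rho_\phi+a(x)}{2\rho_\phi}}\,\frac{b(x)+ic(x)}{|b(x)+ic(x)|}\end{pmatrix}\ \text{if }|a(x)|\ne\rho_\phi,$$ $\zeta(x)=\begin{pmatrix}0&-1\\1&0\end{pmatrix}$ if $a(x)=-\rho_\phi$, and $\zeta(x)=\begin{pmatrix}1&0\\0&1\end{pmatrix}$ if $a(x)=\rho_\phi$. Then $\delta(x):=\zeta(x)\phi(x)\zeta(F_1(x))^{-1}$ is a diagonal matrix for $\mu_X$-a.e. $x$. The hypothesis $\zeta\in C^1$ concerns this $\zeta$. Representations. For $\ell\in\mathbb N$, $V_\ell$ is the space of homogeneous polynomials of degree $\ell$ in $\omega_1,\omega_2\in\mathbb C$, with basis $p_j(\omega_1,\omega_2)=\omega_1^j\omega_2^{\ell-j}$, $j\in\{0,\ldots,\ell\}$, and scalar product $\langle\sum_j\alpha_jp_j,\sum_k\beta_kp_k\rangle_{V_\ell}=\sum_{j=0}^\ell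 j!(\ell-j)!\,\alpha_j\overline{\beta_j}$; $(\pi^{(\ell)}(g)p)(\omega_1,\omega_2)=p((\omega_1,\omega_2)g)$ defines an irreducible unitary representation of $\mathrm{SU}(2)$, and each finite-dimensional one is equivalent to some $\pi^{(\ell)}$. $\pi^{(\ell)}_{jk}(g):=\langle\pi^{(\ell)}(g)p_k,p_j\rangle_{V_\ell}$. $\mathcal H^{(\pi^{(\ell)})}_j:=\bigoplus_{k=0}^\ell L^2(X,\mu_X)\otimes\{\pi^{(\ell)}_{jk}\}$ reduces $U_\delta$, and $U_{\delta,\pi^{(\ell)},j}$ is the restriction of $U_\delta$ to it. Operator $D_{\delta,\ell}$. $H$ is the self-adjoint operator in $L^2(X,\mu_X)$ given by $H\varphi=\lim_{t\to0}it^{-1}(\varphi\circ F_t-\varphi)$; $A\sum_k\varphi_k\otimes\pi^{(\ell)}_{jk}:=\sum_kH\varphi_k\otimes\pi^{(\ell)}_{jk}$ on $\bigoplus_k\mathcal D(H)\otimes\{\pi^{(\ell)}_{jk}\}$, self-adjoint in $\mathcal H^{(\pi^{(\ell)})}_j$; $D_{\delta,\ell}:=\mathrm{s\text{-}lim}_{N\to\infty}\frac1N[A,(U_{\delta,\pi^{(\ell)},j})^N](U_{\delta,\pi^{(\ell)},j})^{-N}$ (this limit exists under the hypotheses), where for a bounded operator $S$, $[A,S]$ is the bounded operator associated with the continuous extension of the form $\varphi\mapsto\langle A\varphi,S\varphi\rangle-\langle\varphi,SA\varphi\rangle$ on $\mathcal D(A)$. *)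

(* Defs.v *)
From HB Require Import structures.
From mathcomp Require Import all_boot all_order all_algebra.
From mathcomp Require Import polyXY sesquilinear spectral complex.
From mathcomp Require Import all_classical all_reals all_analysis.

Set Implicit Arguments.
Unset Strict Implicit.
Unset Printing Implicit Defensive.

Import Order.TTheory GRing.Theory Num.Theory.
Import numFieldTopology.Exports numFieldNormedType.Exports.

Local Open Scope classical_set_scope.
Local Open Scope ring_scope.
Local Open Scope complex_scope.

(* The usual topology of the complex numbers, and hence of complex matrices. *)
HB.instance Definition _ (R : realType) :=
  PseudoPointedMetric.copy R[i] (R[i])^o.

Notation borel X := (g_sigma_algebraType (@open X)).

Definition mx22 (R : realType) (a b c d : R[i]) : 'M[R[i]]_2 :=
  \matrix_(i < 2, j < 2)
    if i == ord0 then (if j == ord0 then a else b)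
    else (if j == ord0 then c else d).

Definition adjmx (R : realType) (Z : 'M[R[i]]_2) : 'M[R[i]]_2 :=
  (Z ^t*)%sesqui.

Record SU2 (R : realType) := MkSU2 {
  su2val :> 'M[R[i]]_2 ;
  su2P : (su2val \is unitarymx) && (\det su2val == 1) }.

HB.instance Definition _ (R : realType) := [isSub for @su2val R].
HB.instance Definition _ (R : realType) := [Choice of SU2 R by <:].

Section SU2_group.
Variable R : realType.
Implicit Types g h : SU2 R.

Lemma su2_adjr g : su2val g *m adjmx g = 1%:M.
Proof. by case: g => g /= /andP[/unitarymxP]. Qed.

Lemma su2_adjl g : adjmx g *m su2val g = 1%:M.
Proof. exact: mulmx1C (su2_adjr g). Qed.

Lemma su2_det g : \det (su2val g) = 1.
Proof. by case: g => g /= /andP[_ /eqP]. Qed.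

Lemma su2_one_subproof :
  ((1%:M : 'M[R[i]]_2) \is unitarymx) && (\det (1%:M : 'M[R[i]]_2) == 1).
Proof.
rewrite det1 eqxx andbT; apply/unitarymxP.
by rewrite trmx1 map_mx1 mulmx1.
Qed.

Lemma su2_mul_subproof g h :
  (su2val g *m su2val h \is unitarymx) && (\det (su2val g *m su2val h) == 1).
Proof.
rewrite det_mulmx !su2_det mulr1 eqxx andbT; apply/unitarymxP.
rewrite trmx_mul map_mxM mulmxA -(mulmxA (su2val g)).
by have /= -> := su2_adjr h; rewrite mulmx1; exact: su2_adjr.
Qed.

Lemma su2_inv_subproof g :
  (adjmx g \is unitarymx) && (\det (adjmx g) == 1).
Proof.
apply/andP; split.
  apply/unitarymxP; rewrite (_ : map_mx _ _ = su2val g) ?su2_adjl//.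
  by apply/matrixP => i j; rewrite !mxE conjCK.
have := congr1 determinant (su2_adjr g).
by rewrite det_mulmx su2_det mul1r det1 => ->.
Qed.

Definition su2_one := MkSU2 su2_one_subproof.
Definition su2_mul g h := MkSU2 (su2_mul_subproof g h).
Definition su2_inv g := MkSU2 (su2_inv_subproof g).

Lemma su2_mulA : associative su2_mul.
Proof. by move=> g h k; apply: val_inj; rewrite /= mulmxA. Qed.

Lemma su2_mul1g : left_id su2_one su2_mul.
Proof. by move=> g; apply: val_inj; rewrite /= mul1mx. Qed.

Lemma su2_mulg1 : right_id su2_one su2_mul.
Proof. by move=> g; apply: val_inj; rewrite /= mulmx1. Qed.

Lemma su2_mulVg : left_inverse su2_one su2_inv su2_mul.
Proof. by move=> g; apply: val_inj; rewrite /= su2_adjl. Qed.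

Lemma su2_mulgV : right_inverse su2_one su2_inv su2_mul.
Proof. by move=> g; apply: val_inj; rewrite /= su2_adjr. Qed.

End SU2_group.

HB.instance Definition _ (R : realType) := @isGroup.Build (SU2 R)
  (su2_one R) (@su2_inv R) (@su2_mul R) (@su2_mulA R) (@su2_mul1g R)
  (@su2_mulg1 R) (@su2_mulVg R) (@su2_mulgV R).
HB.instance Definition _ (R : realType) := isPointed.Build (SU2 R) (su2_one R).
HB.instance Definition _ (R : realType) :=
  Topological.copy (SU2 R) (initial_topology (@su2val R)).

(* A left-invariant Borel probability measure on SU(2); such a measure exists
   and is unique, so this characterises the normalised Haar measure. *)
Definition haar_SU2 (R : realType) (m : probability (borel (SU2 R)) R) :=
  forall (g : SU2 R) (E : set (borel (SU2 R))),
    measurable E -> m ((fun h : SU2 R => (g * h)%g) @^-1` E) = m E.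

Section Manifold.
Variables (R : realType).

Definition partial n (i : 'I_n) (f : 'rV[R]_n -> R) (v : 'rV[R]_n) : R :=
  derive1 (fun t : R => f (v + t *: delta_mx ord0 i)) 0.

(* [Ck k f O] : f is of class C^k on the open set O *)
Fixpoint Ck n (k : nat) (f : 'rV[R]_n -> R) (O : set 'rV[R]_n) : Prop :=
  (forall v, O v -> {for v, continuous f}) /\
  match k with
  | 0 => True
  | k'.+1 => forall i : 'I_n,
      (forall v, O v ->
        derivable (fun t : R => f (v + t *: delta_mx ord0 i)) 0 1) /\
      Ck k' (partial i f) O
  end.

Record chart (X : Type) (n : nat) := Chart {
  cdom : set X ;
  cmap : X -> 'rV[R]_n ;
  cinv : 'rV[R]_n -> X }.

Variables (X : ptopologicalType) (n : nat).
Implicit Types (c : chart X n) (A : set (chart X n)).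

Definition cimg c : set 'rV[R]_n := cmap c @` cdom c.

(* cmap restricts to a homeomorphism of the open set cdom onto the open set
   cimg, with inverse cinv; the values outside these sets are irrelevant. *)
Definition is_chart c :=
  [/\ open (cdom c), open (cimg c),
      forall x, cdom c x -> cinv c (cmap c x) = x,
      forall x, cdom c x -> {for x, continuous (cmap c)} &
      forall v, cimg c v -> {for v, continuous (cinv c)}].

Definition smooth_atlas A :=
  [/\ forall c, A c -> is_chart c,
      forall x, exists2 c, A c & cdom c x &
      forall c d, A c -> A d -> forall (k : nat) (j : 'I_n),
        Ck k (fun v => cmap d (cinv c v) ord0 j)
          (cmap c @` (cdom c `&` cdom d))].

Definition C1_fun A (f : X -> R) :=
  forall c, A c -> Ck 1 (fun v => f (cinv c v)) (cimg c).

Definition C1_SU2 A (phi : X -> SU2 R) :=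
  forall i j : 'I_2,
    C1_fun A (fun x => complex.Re (phi x i j)) /\
    C1_fun A (fun x => complex.Im (phi x i j)).

(* The flow is of class C^1 as a map R * X -> X; in a chart, (t, x) is the row
   vector with first entry t. In particular the vector field generating it is
   continuous. *)
Definition C1_flow A (F : R -> X -> X) :=
  [/\ F 0 = id, forall s t, F (s + t) = F s \o F t,
      continuous (fun p : R * X => F p.1 p.2) &
      forall c d, A c -> A d -> forall j : 'I_n,
        let G := fun v : 'rV[R]_(1 + n) =>
          F (lsubmx v ord0 ord0) (cinv c (rsubmx v)) in
        Ck 1 (fun v => cmap d (G v) ord0 j)
          [set v | cimg c (rsubmx v) /\ cdom d (G v)]].

End Manifold.

Section Dynamics.
Variables (R : realType) (X : ptopologicalType).

Definition preserves (f : X -> X) (m : probability (borel X) R) :=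
  forall E : set (borel X), measurable E -> m (f @^-1` E) = m E.

Definition uniquely_ergodic (f : X -> X) (m : probability (borel X) R) :=
  preserves f m /\
  forall m' : probability (borel X) R, preserves f m' ->
    forall E : set (borel X), measurable E -> m' E = m E.

End Dynamics.

(* Vectors of L^2 are represented by square-integrable functions; equality of
   vectors is equality almost everywhere. A bounded operator is represented by
   a map on functions, an unbounded one by its graph. *)
Section L2.
Context {d : measure_display} {T : measurableType d} {R : realType}.
Variable mu : {measure set T -> \bar R}.
Implicit Types (f g h : T -> R[i]) (K : set (T -> R[i])).

Definition measurable_cfun f :=
  measurable_fun [set: T] (fun x => complex.Re (f x)) /\
  measurable_fun [set: T] (fun x => complex.Im (f x)).

Definition L2 : set (T -> R[i]) := [set f | measurable_cfun f /\
  mu.-integrable [set: T] (fun x => ((Normc.normc (f x)) ^+ 2)%:E)].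

Definition ae_same f g := {ae mu, forall x, f x = g x}.

Definition cintegral f : R[i] :=
  (\int[mu]_x complex.Re (f x)) +i* (\int[mu]_x complex.Im (f x)).

Definition ip f g : R[i] := cintegral (fun x => f x * (g x)^*).

Definition L2norm f : R := Num.sqrt (\int[mu]_x (Normc.normc (f x)) ^+ 2).

Definition L2cvg (u : nat -> T -> R[i]) f :=
  (fun N => L2norm (fun x => u N x - f x)) @ \oo --> (0 : R).

(* Finite and countable sums of mutually orthogonal closed subspaces. *)
Definition fin_sum (I : finType) (P : pred I) (K : I -> set (T -> R[i])) :
    set (T -> R[i]) :=
  [set f | L2 f /\ exists u : I -> T -> R[i],
    (forall i, P i -> K i (u i)) /\
    ae_same f (fun x => \sum_(i | P i) u i x)].

Definition hilbert_sum (P : pred nat) (K : nat -> set (T -> R[i])) :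
    set (T -> R[i]) :=
  [set f | L2 f /\ exists u : nat -> T -> R[i],
    (forall i, P i -> K i (u i)) /\
    L2cvg (fun N x => \sum_(i < N | P i) u i x) f].

Definition sum2 K1 K2 : set (T -> R[i]) :=
  [set f | L2 f /\ exists f1 f2 : T -> R[i],
    [/\ K1 f1, K2 f2 & ae_same f (fun x => f1 x + f2 x)]].

(* orthogonal complement in K *)
Definition orth K (S : set (T -> R[i])) : set (T -> R[i]) :=
  [set f | K f /\ forall g, S g -> ip f g = 0].

Definition ker_op K (S : (T -> R[i]) -> (T -> R[i])) : set (T -> R[i]) :=
  [set f | K f /\ ae_same (S f) (fun=> 0)].

Definition bounded_op K (S : (T -> R[i]) -> (T -> R[i])) :=
  [/\ forall f, K f -> K (S f),
      forall (a : R[i]) f g, K f -> K g ->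
        ae_same (S (fun x => a * f x + g x)) (fun x => a * S f x + S g x) &
      exists M : R, forall f, K f -> L2norm (S f) <= M * L2norm f].

(* B is the bounded operator [A, S] in K, A being the operator with graph GA:
   <f, B f> = <A f, S f> - <f, S (A f)> for f in D(A). *)
Definition is_commutator K (GA : (T -> R[i]) -> (T -> R[i]) -> Prop)
    (S B : (T -> R[i]) -> (T -> R[i])) :=
  bounded_op K B /\
  forall f h, GA f h -> ip f (B f) = ip h (S f) - ip f (S h).

Definition is_slim K (u : nat -> (T -> R[i]) -> (T -> R[i]))
    (D : (T -> R[i]) -> (T -> R[i])) :=
  forall f, K f -> K (D f) /\ L2cvg (fun N => u N f) (D f).

Definition koopman (S : T -> T) : (T -> R[i]) -> (T -> R[i]) :=
  fun f => f \o S.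

Definition mixing_in (U : (T -> R[i]) -> (T -> R[i])) K :=
  forall f g, K f -> L2 g ->
    (fun N => ip f (iter N U g)) @ \oo --> (0 : R[i]).

End L2.

Section Degree.
Context {R : realType} {X : ptopologicalType}.
Variables (F : R -> X -> X) (m : probability (borel X) R).
Implicit Types (f h : X -> 'M[R[i]]_2) (phi : X -> SU2 R).

Definition in_su2 (Z : 'M[R[i]]_2) := adjmx Z = - Z /\ \tr Z = 0.

(* real-valued on su(2) *)
Definition su2_ip (Z1 Z2 : 'M[R[i]]_2) : R :=
  complex.Re (2%:R^-1 * \tr (Z1 *m adjmx Z2)).

Definition su2_norm (Z : 'M[R[i]]_2) : R := Num.sqrt (su2_ip Z Z).

Definition L2_su2 : set (X -> 'M[R[i]]_2) :=
  [set f | [/\ forall x, in_su2 (f x),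
     forall i j, measurable_cfun (T := borel X) (fun x => f x i j) &
     m.-integrable [set: borel X] (fun x => ((su2_norm (f x)) ^+ 2)%:E)]].

Definition lieD (f : X -> 'M[R[i]]_2) (x : X) : 'M[R[i]]_2 :=
  \matrix_(i, j)
    (derive1 (fun t : R => complex.Re (f (F t x) i j)) 0 +i*
     derive1 (fun t : R => complex.Im (f (F t x) i j)) 0).

Definition Mcocycle phi (x : X) : 'M[R[i]]_2 :=
  lieD (fun y => su2val (phi y)) x *m su2val (phi x)^-1%g.

Definition Wop phi f (x : X) : 'M[R[i]]_2 :=
  su2val (phi x) *m f (F 1 x) *m su2val (phi x)^-1%g.

Definition ker_1W phi : set (X -> 'M[R[i]]_2) :=
  [set f | L2_su2 f /\ {ae m, forall x, Wop phi f x = f x}].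

(* PM represents the orthogonal projection of M_phi onto ker (1 - W_phi) *)
Definition is_PM phi (PM : X -> 'M[R[i]]_2) :=
  ker_1W phi PM /\
  forall h, ker_1W phi h ->
    \int[m]_x su2_ip (Mcocycle phi x - PM x) (h x) = 0.

(* Z is the matrix with rows (ia, b+ic), (-b+ic, -ia) *)
Definition transfer (rho : R) (Z : 'M[R[i]]_2) : 'M[R[i]]_2 :=
  let a := complex.Im (Z ord0 ord0) in
  let b := complex.Re (Z ord0 ord_max) in
  let c := complex.Im (Z ord0 ord_max) in
  let sp := (Num.sqrt ((rho + a) / (2%:R * rho)))%:C in
  let sm := (Num.sqrt ((rho - a) / (2%:R * rho)))%:C in
  let w := b +i* c in
  if a == - rho then mx22 0 (-1) 1 0
  else if a == rho then 1%:M
  else mx22 ('i * sp * (w^* / `|w|)) sm (- sm) (- ('i * sp * (w / `|w|))).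

Definition is_transfer (rho : R) (PM : X -> 'M[R[i]]_2) (zeta : X -> SU2 R) :=
  {ae m, forall x, su2val (zeta x) = transfer rho (PM x)}.

Definition conj_cocycle phi (zeta : X -> SU2 R) (x : X) : SU2 R :=
  (zeta x * phi x * (zeta (F 1 x))^-1)%g.

End Degree.

Section Representations.
Variable R : realType.
Local Notation poly2 := {poly {poly R[i]}}.
(* omega_1 and omega_2 *)
Local Notation w1 := ('X : poly2).
Local Notation w2 := ('Y : poly2).

Definition pbasis (l j : nat) : poly2 := w1 ^+ j * w2 ^+ (l - j).

(* p`_j`_(l - j) is the coefficient of pbasis l j in p *)
Definition V_ip (l : nat) (p q : poly2) : R[i] :=
  \sum_(j < l.+1) (j`! * (l - j)`!)%:R * (p`_j`_(l - j)) * (q`_j`_(l - j))^*.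

(* p(q1, q2) *)
Definition subst2 (q1 q2 : poly2) (p : poly2) : poly2 :=
  (map_poly (horner_eval q2 \o map_poly (polyC \o polyC)) p).[q1].

(* p((omega_1, omega_2) g) *)
Definition su2_rep (g : SU2 R) : poly2 -> poly2 :=
  let entry i j : poly2 := (su2val g i j)%:P%:P in
  subst2 (w1 * entry ord0 ord0 + w2 * entry ord_max ord0)
         (w1 * entry ord0 ord_max + w2 * entry ord_max ord_max).

Definition rep_coef (l j k : nat) (g : SU2 R) : R[i] :=
  V_ip l (su2_rep g (pbasis l k)) (pbasis l j).

End Representations.

Section SkewProduct.
Context {R : realType} {X : ptopologicalType}.
Variables (F : R -> X -> X) (m : probability (borel X) R)
  (haar : probability (borel (SU2 R)) R) (delta : X -> SU2 R).

Local Notation XG := (borel X * borel (SU2 R))%type.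

Definition muXG : {measure set XG -> \bar R} := (m \x haar)%E.

Definition skew (p : XG) : XG := (F 1 p.1, ((p.2 : SU2 R) * delta p.1)%g).

Definition skew_inv (p : XG) : XG :=
  (F (-1) p.1, ((p.2 : SU2 R) * (delta (F (-1) p.1))^-1)%g).

Lemma skewK : F 0 = id -> (forall s t, F (s + t) = F s \o F t) ->
  cancel skew skew_inv /\ cancel skew_inv skew.
Proof.
move=> F0 FD.
have F1K x : F (-1) (F 1 x) = x by rewrite -[LHS]/((F (-1) \o F 1) x) -FD addNr F0.
have FN1K x : F 1 (F (-1) x) = x by rewrite -[LHS]/((F 1 \o F (-1)) x) -FD addrN F0.
split=> -[x g]; rewrite /skew /skew_inv /= ?F1K ?FN1K.
  by rewrite mulgK.
by rewrite mulgVK.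
Qed.

Definition U_skew : (XG -> R[i]) -> (XG -> R[i]) := koopman skew.
Definition U_skew_inv : (XG -> R[i]) -> (XG -> R[i]) := koopman skew_inv.

(* L^2(X) (x) {pi^(l)_jk} *)
Definition tens (l j k : nat) : set (XG -> R[i]) :=
  [set f | L2 muXG f /\ exists2 u : borel X -> R[i], L2 m u &
    ae_same muXG f (fun p => u p.1 * rep_coef l j k p.2)].

Definition Hspace (l j : nat) : set (XG -> R[i]) :=
  fin_sum muXG (fun=> true) (fun k : 'I_l.+1 => tens l j k).

(* graph of H, H u = lim_(t -> 0) i t^-1 (u o F_t - u) in L^2(X) *)
Definition H_graph (u v : borel X -> R[i]) : Prop :=
  [/\ L2 m u, L2 m v &
    (fun t : R => L2norm m
       (fun x => 'i * (t^-1)%:C * (u (F t x) - u x) - v x)) @ 0^' --> (0 : R)].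

Definition A_graph (l j : nat) (f h : XG -> R[i]) : Prop :=
  [/\ L2 muXG f, L2 muXG h &
    exists u v : 'I_l.+1 -> borel X -> R[i],
      [/\ forall k, H_graph (u k) (v k),
          ae_same muXG f (fun p => \sum_k u k p.1 * rep_coef l j k p.2) &
          ae_same muXG h (fun p => \sum_k v k p.1 * rep_coef l j k p.2)]].

(* D is the strong limit of N^-1 [A, U^N] U^-N in Hspace l j *)
Definition is_D (l j : nat) (D : (XG -> R[i]) -> (XG -> R[i])) :=
  exists2 B : nat -> (XG -> R[i]) -> (XG -> R[i]),
    (forall N, is_commutator muXG (Hspace l j) (A_graph l j)
                 (iter N U_skew) (B N)) &
    is_slim muXG (Hspace l j)
      (fun N f p => N%:R^-1 * B N (iter N U_skew_inv f) p) D.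

Definition H_mix : set (XG -> R[i]) :=
  sum2 muXG
    (hilbert_sum muXG (fun l => ~~ odd l) (fun l =>
       fin_sum muXG (fun=> true) (fun j : 'I_l.+1 =>
         fin_sum muXG (fun k : 'I_l.+1 => k != l./2 :> nat) (fun k =>
           tens l j k))))
    (hilbert_sum muXG (fun l => odd l) (fun l =>
       fin_sum muXG (fun=> true) (fun j : 'I_l.+1 => Hspace l j))).

End SkewProduct.

(* Main.v *)
Require Import Defs.
From HB Require Import structures.
From mathcomp Require Import all_boot all_order all_algebra.
From mathcomp Require Import polyXY sesquilinear spectral complex.
From mathcomp Require Import all_classical all_reals all_analysis.
From mathcomp Require Import measurable_realfun ring lra zify.

Set Implicit Arguments.
Unset Strict Implicit.
Unset Printing Implicit Defensive.

Import Order.TTheory GRing.Theory Num.Theory.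
Import numFieldTopology.Exports numFieldNormedType.Exports.

Local Open Scope classical_set_scope.
Local Open Scope ring_scope.
Local Open Scope complex_scope.

(** Conjugation by [zeta] makes the cocycle [delta] diagonal, with a diagonal phase that rotates
    along the flow at a mean speed equal to the degree [rho]. A commutator with the generator of
    the flow turns this rotation into decay of correlations.

    Diagonalisation. The transfer matrix conjugates the projection of [M_phi] to the constant
    matrix with entries [i rho] and [- i rho] ([transfer_diag]). This projection is fixed by
    [W_phi], hence [delta] commutes with the constant matrix and is almost everywhere diagonal,
    with entries [c] and its conjugate ([delta_diag_ae]). As [phi] and [zeta] are of class C1, the
    phase [c] has a logarithmic derivative [i r] along the flow ([C1_fun_flow], [diag_log_deriv]).
    Up to a coboundary, [i r] is the first diagonal entry of [zeta M_phi zeta^-1]; testing the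
    projection of [M_phi] against itself shows that [r] has integral [rho] ([integral_diag_rate]).
    Unique ergodicity of [F_1] implies ergodicity, so that the Birkhoff averages of [r] converge to
    [rho] almost everywhere ([uniquely_ergodic_ergodic], [birkhoff_ergodic]).

    Reduction to weighted translations. Right translation by a diagonal matrix with phase [t]
    multiplies [pi_jk] by [t^k] and by the conjugate of [t^(l - k)] ([rep_coef_diag]). Distinct [k]
    thus give orthogonal subspaces ([tens_orth]), and on the subspace of [pi_jk] the Koopman
    operator is the translation by [F_1] followed by multiplication by a phase with mean rotation
    rate [(2 k - l) rho] ([skew_tens]).

    Mixing. Let [V] be a translation along the flow by time 1 followed by multiplication by a phase
    with rotation rate [s], and let [A] be the generator. By the Leibniz rule ([gen_weighted]) the
    commutator of [A] and [V^N] is minus [V^N] followed by multiplication by the Birkhoff sum [S_N]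
    of [s]. For [f] and [g] in the domain of [A], the number [<S_N f, V^N g>] is therefore
    [<f, V^N A g> - <A f, V^N g>], which is bounded in [N]. If [S_N / N] tends to a constant other
    than zero, then [<f, V^N g>] tends to zero, and this extends to all [f] and [g] because the
    domain is dense ([gen_dense], [mixing_weighted]). This applies to the subspace of [pi_jk] if
    [2 k] differs from [l] ([mixes_tens]), and mixing passes to orthogonal sums.

    The operator D. The same commutator formula shows that [N^-1 [A, U^N] U^-N] multiplies the
    component on [pi_jk] by minus the Birkhoff average of its rotation rate, so its strong limit is
    the scalar [- (2 k - l) rho] there ([commutator_opP], [limit_opP]). A bounded operator is
    determined by its quadratic form on the domain of [A] ([operator_eq0]), so this limit is the
    only operator with the defining property of [D] ([is_D_unique]). Its kernel is the subspace
    with [2 k = l], and the orthogonal complement of the kernel is the sum of the others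
    ([kernel_orth]). *)

(** * Complex numbers and square-integrable functions *)

Section ComplexArith.
Variable R : rcfType.
Implicit Types z w : R[i].
Local Notation Re := (@complex.Re R).
Local Notation Im := (@complex.Im R).
Local Notation normc := (@Normc.normc R).

Lemma ReD z w : Re (z + w) = Re z + Re w. Proof. by case: z; case: w. Qed.
Lemma ImD z w : Im (z + w) = Im z + Im w. Proof. by case: z; case: w. Qed.
Lemma ReN z : Re (- z) = - Re z. Proof. by case: z. Qed.
Lemma ImN z : Im (- z) = - Im z. Proof. by case: z. Qed.
Lemma ReM z w : Re (z * w) = Re z * Re w - Im z * Im w.
Proof. by case: z; case: w. Qed.
Lemma ImM z w : Im (z * w) = Re z * Im w + Im z * Re w.
Proof. by case: z; case: w. Qed.
Lemma Re_conj z : Re z^* = Re z. Proof. by case: z. Qed.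
Lemma Im_conj z : Im z^* = - Im z. Proof. by case: z. Qed.

Lemma complex_eqP z w : Re z = Re w -> Im z = Im w -> z = w.
Proof. by case: z; case: w => a b c d /= -> ->. Qed.

Lemma normc_ge0 z : 0 <= normc z.
Proof. by case: z => a b; exact: sqrtr_ge0. Qed.

Lemma normc2E z : normc z ^+ 2 = Re z ^+ 2 + Im z ^+ 2.
Proof. by case: z => a b /=; rewrite sqr_sqrtr// addr_ge0// sqr_ge0. Qed.

Lemma normc_real (a : R) : normc a%:C = `|a|.
Proof. by rewrite /Normc.normc/= expr0n/= addr0 sqrtr_sqr. Qed.

Lemma normc_conj z : normc z^* = normc z.
Proof. by case: z => a b /=; rewrite sqrrN. Qed.

Lemma Re_le_normc z : `|Re z| <= normc z.
Proof.
rewrite -[leRHS]ger0_norm ?normc_ge0// -ler_sqr ?nnegrE// !real_normK ?num_real//.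
by rewrite normc2E lerDl sqr_ge0.
Qed.

Lemma Im_le_normc z : `|Im z| <= normc z.
Proof.
rewrite -[leRHS]ger0_norm ?normc_ge0// -ler_sqr ?nnegrE// !real_normK ?num_real//.
by rewrite normc2E lerDr sqr_ge0.
Qed.

Lemma normc_le z : normc z <= `|Re z| + `|Im z|.
Proof.
rewrite -ler_sqr ?nnegrE ?normc_ge0 ?addr_ge0// normc2E sqrrD !real_normK ?num_real//.
by rewrite -addrA lerD2l lerDr mulrn_wge0// mulr_ge0.
Qed.

Lemma normcX z n : normc (z ^+ n) = normc z ^+ n.
Proof. by elim: n => [|n IH]; rewrite ?expr0 ?Normc.normc1// !exprS Normc.normcM IH. Qed.

Lemma mulcJ z : z * z^* = (normc z ^+ 2)%:C.
Proof. by rewrite normc2E; case: z => a b; apply: complex_eqP => /=; ring. Qed.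

Lemma conjcM z w : (z * w)^* = z^* * w^*. Proof. exact: rmorphM. Qed.
Lemma ReC (a : R) : Re a%:C = a. Proof. by []. Qed.
Lemma ImC (a : R) : Im a%:C = 0. Proof. by []. Qed.

(** Reduces estimates on complex integrals to estimates on the integrals of real parts. *)
Lemma phase_exists z : exists2 e : R[i], normc e = 1 & e * z = (normc z)%:C.
Proof.
have [->|z0] := eqVneq z 0.
  by exists 1; rewrite ?Normc.normc1// mulr0 Normc.normc0.
have nz0 : normc z != 0 by apply: contra z0 => /eqP/Normc.eq0_normc ->.
exists (z^* * ((normc z)^-1)%:C).
  by rewrite Normc.normcM normc_conj normc_real ger0_norm ?invr_ge0 ?normc_ge0// mulfV.
rewrite mulrAC (mulrC z^*) mulcJ -rmorphM/= expr2 mulfK//.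
Qed.

End ComplexArith.

Section Square_integrable.
Context {d : measure_display} {T : measurableType d} {R : realType}.
Variable mu : {measure set T -> \bar R}.
Implicit Types f g h : T -> R[i].
Local Notation Re := (@complex.Re R).
Local Notation Im := (@complex.Im R).
Local Notation normc := (@Normc.normc R).
Local Notation rint F := (mu.-integrable [set: T] (fun x => (F x)%:E)).

Lemma mcf_cst (a : R[i]) : measurable_cfun (fun _ : T => a).
Proof. by split; exact: measurable_cst. Qed.

Lemma mcfD f g : measurable_cfun f -> measurable_cfun g ->
  measurable_cfun (fun x => f x + g x).
Proof.
move=> [fr fi] [gr gi]; split.
  by under eq_fun do rewrite ReD; exact: measurable_funD.
by under eq_fun do rewrite ImD; exact: measurable_funD.
Qed.

Lemma mcfM f g : measurable_cfun f -> measurable_cfun g ->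
  measurable_cfun (fun x => f x * g x).
Proof.
move=> [fr fi] [gr gi]; split.
  under eq_fun do rewrite ReM.
  by apply: measurable_funB; exact: measurable_funM.
under eq_fun do rewrite ImM.
by apply: measurable_funD; exact: measurable_funM.
Qed.

Lemma mcf_conj f : measurable_cfun f -> measurable_cfun (fun x => (f x)^*).
Proof.
move=> [fr fi]; split; first by under eq_fun do rewrite Re_conj.
by under eq_fun do rewrite Im_conj; exact: measurable_funN.
Qed.

Lemma mcfZ (a : R[i]) f : measurable_cfun f -> measurable_cfun (fun x => a * f x).
Proof. by move=> mf; apply: mcfM => //; exact: mcf_cst. Qed.

Lemma mcfN f : measurable_cfun f -> measurable_cfun (fun x => - f x).
Proof. by move=> /(mcfZ (-1)); under eq_fun do rewrite mulN1r. Qed.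

Lemma mcfB f g : measurable_cfun f -> measurable_cfun g ->
  measurable_cfun (fun x => f x - g x).
Proof. by move=> mf /mcfN; exact: mcfD. Qed.

Lemma mcf_real (F : T -> R) : measurable_fun [set: T] F ->
  measurable_cfun (fun x => (F x)%:C).
Proof. by move=> mF; split => //=; exact: measurable_cst. Qed.

Lemma mcf_sum (I : Type) (s : seq I) (P : pred I) (u : I -> T -> R[i]) :
  (forall i, P i -> measurable_cfun (u i)) ->
  measurable_cfun (fun x => \sum_(i <- s | P i) u i x).
Proof.
move=> mu_; elim: s => [|i s IH].
  by under eq_fun do rewrite big_nil; exact: mcf_cst.
under eq_fun do rewrite big_cons; case Pi : (P i) => //.
by apply: mcfD => //; exact: mu_.
Qed.

Lemma mcf_normc2 f : measurable_cfun f ->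
  measurable_fun [set: T] (fun x => normc (f x) ^+ 2).
Proof.
move=> [fr fi]; under eq_fun do rewrite normc2E.
by apply: measurable_funD; exact: measurable_funX.
Qed.

Lemma rint_le (F G : T -> R) : measurable_fun [set: T] F ->
  (forall x, `|F x| <= G x) -> rint G -> rint F.
Proof.
move=> mF FG; apply: le_integrable => //; first exact/measurable_EFinP.
by move=> x _; rewrite /= lee_fin (le_trans (FG x))// ler_norm.
Qed.

Lemma rintD (F G : T -> R) : rint F -> rint G -> rint (fun x => F x + G x).
Proof. by move=> iF iG; under eq_fun do rewrite EFinD; exact: integrableD. Qed.

Lemma rintZ (a : R) (F : T -> R) : rint F -> rint (fun x => a * F x).
Proof. by move=> iF; under eq_fun do rewrite EFinM; exact: integrableZl. Qed.

Lemma rintB (F G : T -> R) : rint F -> rint G -> rint (fun x => F x - G x).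
Proof. by move=> iF iG; under eq_fun do rewrite EFinB; exact: integrableB. Qed.

Lemma L2_le f g (K : R) : measurable_cfun f ->
  (forall x, normc (f x) <= K * normc (g x)) -> L2 mu g -> L2 mu f.
Proof.
move=> mf fg [mg ig]; split => //.
apply: (rint_le _ _ (rintZ (K ^+ 2) ig)); first exact: mcf_normc2.
move=> x; rewrite ger0_norm ?sqr_ge0// -exprMn.
by rewrite ler_pXn2r// nnegrE ?normc_ge0//; exact: le_trans (normc_ge0 _) (fg x).
Qed.

Lemma L2D f g : L2 mu f -> L2 mu g -> L2 mu (fun x => f x + g x).
Proof.
move=> [mf if_] [mg ig]; split; first exact: mcfD.
have := rintD (rintZ 2 if_) (rintZ 2 ig).
apply: rint_le; first exact/mcf_normc2/mcfD.
move=> x; rewrite ger0_norm ?sqr_ge0// !normc2E ReD ImD.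
have := sqr_ge0 (Re (f x) - Re (g x)); have := sqr_ge0 (Im (f x) - Im (g x)).
rewrite !sqrrB !sqrrD; lra.
Qed.

Lemma L2M f g (K : R) : measurable_cfun f -> (forall x, normc (f x) <= K) ->
  L2 mu g -> L2 mu (fun x => f x * g x).
Proof.
move=> mf fK Lg; apply: (@L2_le _ g K) => //; first exact/mcfM/Lg.1.
by move=> x; rewrite Normc.normcM ler_wpM2r// normc_ge0.
Qed.

Lemma L2Z (a : R[i]) f : L2 mu f -> L2 mu (fun x => a * f x).
Proof. by apply: L2M => //; exact: mcf_cst. Qed.

Lemma L2N f : L2 mu f -> L2 mu (fun x => - f x).
Proof. by move=> /(L2Z (-1)); under eq_fun do rewrite mulN1r. Qed.

Lemma L2B f g : L2 mu f -> L2 mu g -> L2 mu (fun x => f x - g x).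
Proof. by move=> Lf /L2N; exact: L2D. Qed.

Lemma L2_0 : L2 mu (fun=> 0).
Proof.
split; first exact: mcf_cst.
by under eq_fun do rewrite Normc.normc0 expr0n/=; exact: integrable0.
Qed.

Lemma L2_sum (I : Type) (s : seq I) (P : pred I) (u : I -> T -> R[i]) :
  (forall i, P i -> L2 mu (u i)) -> L2 mu (fun x => \sum_(i <- s | P i) u i x).
Proof.
move=> Lu; elim: s => [|i s IH].
  by under eq_fun do rewrite big_nil; exact: L2_0.
under eq_fun do rewrite big_cons; case Pi : (P i) => //.
by apply: L2D => //; exact: Lu.
Qed.

Lemma ae_same_refl f : ae_same mu f f.
Proof. exact: aeW. Qed.

Lemma ae_same_sym f g : ae_same mu f g -> ae_same mu g f.
Proof. by apply: filterS => x ->. Qed.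

Lemma ae_same_trans f g h : ae_same mu f g -> ae_same mu g h -> ae_same mu f h.
Proof. by apply: filterS2 => x -> ->. Qed.

Lemma ae_same_lin (a : R[i]) f f' g g' : ae_same mu f f' -> ae_same mu g g' ->
  ae_same mu (fun x => a * f x + g x) (fun x => a * f' x + g' x).
Proof. by apply: filterS2 => x -> ->. Qed.

Lemma ae_same_mul g f f' : ae_same mu f f' ->
  ae_same mu (fun x => g x * f x) (fun x => g x * f' x).
Proof. by apply: filterS => x ->. Qed.

Lemma ae_same_sum (I : Type) (s : seq I) (P : pred I) (u v : I -> T -> R[i]) :
  (forall i, P i -> ae_same mu (u i) (v i)) ->
  ae_same mu (fun x => \sum_(i <- s | P i) u i x)
             (fun x => \sum_(i <- s | P i) v i x).
Proof.
move=> uv; elim: s => [|i s IH].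
  by apply: aeW => x; rewrite !big_nil.
case Pi : (P i); last by apply: filterS IH => x; rewrite !big_cons Pi.
by move: (uv _ Pi) IH; apply: filterS2 => x; rewrite !big_cons Pi => -> ->.
Qed.

Lemma ae2 (P Q S : T -> Prop) : {ae mu, forall x, P x} -> {ae mu, forall x, Q x} ->
  (forall x, P x -> Q x -> S x) -> {ae mu, forall x, S x}.
Proof. by move=> aP aQ PQS; apply: filterS2 aP aQ. Qed.

Lemma ae3 (P Q S V : T -> Prop) : {ae mu, forall x, P x} -> {ae mu, forall x, Q x} ->
  {ae mu, forall x, S x} -> (forall x, P x -> Q x -> S x -> V x) -> {ae mu, forall x, V x}.
Proof. by move=> aP aQ aS PQS; apply: filterS3 aP aQ aS. Qed.

Lemma Rintegral_ae (F G : T -> R) :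
  measurable_fun [set: T] F -> measurable_fun [set: T] G ->
  {ae mu, forall x, F x = G x} -> \int[mu]_x F x = \int[mu]_x G x.
Proof.
move=> mF mG FG; rewrite /Rintegral; congr fine; apply: ae_eq_integral => //.
- exact/measurable_EFinP.
- exact/measurable_EFinP.
- by apply: filterS FG => x /= -> _.
Qed.

Lemma L2_ip_int f g : L2 mu f -> L2 mu g ->
  rint (fun x => Re (f x * (g x)^*)) /\ rint (fun x => Im (f x * (g x)^*)).
Proof.
move=> [mf if_] [mg ig].
have m := mcfM mf (mcf_conj mg).
have bnd x : normc (f x * (g x)^*) <= normc (f x) ^+ 2 + normc (g x) ^+ 2.
  rewrite Normc.normcM normc_conj.
  have := normc_ge0 (f x); have := normc_ge0 (g x); nra.
split; apply: rint_le (rintD if_ ig); try (by case: m);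
  move=> x; apply: le_trans (bnd x).
  exact: Re_le_normc.
exact: Im_le_normc.
Qed.

Lemma Re_ip f g : Re (ip mu f g) = \int[mu]_x Re (f x * (g x)^*).
Proof. by []. Qed.
Lemma Im_ip f g : Im (ip mu f g) = \int[mu]_x Im (f x * (g x)^*).
Proof. by []. Qed.

Lemma ipDl f f' g : L2 mu f -> L2 mu f' -> L2 mu g ->
  ip mu (fun x => f x + f' x) g = ip mu f g + ip mu f' g.
Proof.
move=> Lf Lf' Lg; have [ir ii] := L2_ip_int Lf Lg; have [ir' ii'] := L2_ip_int Lf' Lg.
apply: complex_eqP; rewrite ?ReD ?ImD ?Re_ip ?Im_ip -RintegralD//;
  by apply: eq_Rintegral => x _; rewrite mulrDl ?ReD ?ImD.
Qed.

Lemma ipZl (a : R[i]) f g : L2 mu f -> L2 mu g ->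
  ip mu (fun x => a * f x) g = a * ip mu f g.
Proof.
move=> Lf Lg; have [ir ii] := L2_ip_int Lf Lg.
apply: complex_eqP; rewrite ?ReM ?ImM !(Re_ip, Im_ip) -!RintegralZl//.
  rewrite -RintegralB//; try exact: rintZ.
  by apply: eq_Rintegral => x _; rewrite -mulrA ReM.
rewrite -RintegralD//; try exact: rintZ.
by apply: eq_Rintegral => x _; rewrite -mulrA ImM.
Qed.

Lemma ipC f g : L2 mu f -> L2 mu g -> ip mu g f = (ip mu f g)^*.
Proof.
move=> Lf Lg; have [ir ii] := L2_ip_int Lf Lg.
apply: complex_eqP; rewrite ?Re_conj ?Im_conj !(Re_ip, Im_ip).
  by apply: eq_Rintegral => x _; rewrite !ReM !Re_conj !Im_conj; ring.
rewrite -mulN1r -RintegralZl//; apply: eq_Rintegral => x _.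
by rewrite !ImM !Re_conj !Im_conj; ring.
Qed.

Lemma ipDr f g g' : L2 mu f -> L2 mu g -> L2 mu g' ->
  ip mu f (fun x => g x + g' x) = ip mu f g + ip mu f g'.
Proof.
move=> Lf Lg Lg'; have Ls := L2D Lg Lg'.
by rewrite (ipC Ls Lf) (ipC Lg Lf) (ipC Lg' Lf) ipDl// rmorphD.
Qed.

Lemma ipZr (a : R[i]) f g : L2 mu f -> L2 mu g ->
  ip mu f (fun x => a * g x) = a^* * ip mu f g.
Proof. move=> Lf Lg; have Ls := L2Z a Lg.
by rewrite (ipC Ls Lf) (ipC Lg Lf) ipZl// rmorphM. Qed.

Lemma ipBl f f' g : L2 mu f -> L2 mu f' -> L2 mu g ->
  ip mu (fun x => f x - f' x) g = ip mu f g - ip mu f' g.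
Proof.
move=> *; under [X in ip mu X]eq_fun do rewrite -mulN1r.
by rewrite ipDl ?ipZl ?mulN1r//; exact: L2Z.
Qed.

Lemma ipBr f g g' : L2 mu f -> L2 mu g -> L2 mu g' ->
  ip mu f (fun x => g x - g' x) = ip mu f g - ip mu f g'.
Proof. move=> Lf Lg Lg'; have Ls := L2B Lg Lg'.
by rewrite (ipC Ls Lf) (ipC Lg Lf) (ipC Lg' Lf) ipBl// rmorphB. Qed.

Lemma ip0l g : ip mu (fun=> 0) g = 0.
Proof.
by apply: complex_eqP; rewrite ?Re_ip ?Im_ip;
  under eq_Rintegral do rewrite mul0r; rewrite Rintegral_cst ?mul0r.
Qed.

Lemma ip0r f : L2 mu f -> ip mu f (fun=> 0) = 0.
Proof. by move=> Lf; rewrite (ipC L2_0 Lf) ip0l conjc0. Qed.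

Lemma ip_suml (I : Type) (s : seq I) (P : pred I) (u : I -> T -> R[i]) g :
  L2 mu g -> (forall i, P i -> L2 mu (u i)) ->
  ip mu (fun x => \sum_(i <- s | P i) u i x) g = \sum_(i <- s | P i) ip mu (u i) g.
Proof.
move=> Lg Lu; elim: s => [|i s IH].
  by under [X in ip mu X]eq_fun do rewrite big_nil; rewrite big_nil ip0l.
under [X in ip mu X]eq_fun do rewrite big_cons; rewrite big_cons.
case Pi : (P i) => //; rewrite ipDl ?IH//; first exact: Lu.
exact: L2_sum.
Qed.

Lemma ip_sumr (I : Type) (s : seq I) (P : pred I) (u : I -> T -> R[i]) g :
  L2 mu g -> (forall i, P i -> L2 mu (u i)) ->
  ip mu g (fun x => \sum_(i <- s | P i) u i x) = \sum_(i <- s | P i) ip mu g (u i).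
Proof.
move=> Lg Lu; rewrite ipC ?ip_suml//; last exact: L2_sum.
by rewrite rmorph_sum; apply: eq_bigr => i Pi; rewrite [RHS]ipC//; exact: Lu.
Qed.

Lemma ip_ae f f' g g' : L2 mu f -> L2 mu f' -> L2 mu g -> L2 mu g' ->
  ae_same mu f f' -> ae_same mu g g' -> ip mu f g = ip mu f' g'.
Proof.
move=> [mf _] [mf' _] [mg _] [mg' _] ff' gg'.
have m := mcfM mf (mcf_conj mg); have m' := mcfM mf' (mcf_conj mg').
apply: complex_eqP; rewrite ?Re_ip ?Im_ip; apply: Rintegral_ae;
  (try by case: m); (try by case: m'); by move: ff' gg'; apply: filterS2 => x -> ->.
Qed.

Lemma L2norm_ge0 f : 0 <= L2norm mu f.
Proof. exact: sqrtr_ge0. Qed.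

Lemma L2norm2 f : L2norm mu f ^+ 2 = \int[mu]_x (normc (f x) ^+ 2).
Proof. by rewrite sqr_sqrtr// Rintegral_ge0// => x _; exact: sqr_ge0. Qed.

Lemma ip_self f : L2 mu f -> ip mu f f = (L2norm mu f ^+ 2)%:C.
Proof.
move=> Lf; rewrite L2norm2; apply: complex_eqP; rewrite ?ReC ?ImC ?Re_ip ?Im_ip.
  by apply: eq_Rintegral => x _; rewrite mulcJ.
by under eq_Rintegral do rewrite mulcJ ImC; rewrite Rintegral_cst// mul0r.
Qed.

(** For every [a > 0], |Re <f,g>| is at most the mean of [a |f|^2] and
    [|g|^2 / a]; optimising over [a] gives Cauchy-Schwarz. *)
Lemma cauchy_schwarz f g : L2 mu f -> L2 mu g ->
  normc (ip mu f g) <= L2norm mu f * L2norm mu g.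
Proof.
move=> Lf Lg; have [e e1 eE] := phase_exists (ip mu f g).
have young (a : R) : 0 < a ->
    normc (ip mu f g) <= (a * L2norm mu f ^+ 2 + a^-1 * L2norm mu g ^+ 2) / 2.
  (* the phase [e] makes the scalar product real, so its integrand may be bounded
     by Young's inequality for its real part *)
  move=> a0; rewrite -[leLHS]ReC -eE -ipZl// Re_ip !L2norm2 -!RintegralZl//;
    [|exact: Lg.2|exact: Lf.2].
  rewrite -RintegralD//; [|exact: rintZ Lf.2|exact: rintZ Lg.2].
  rewrite -RintegralZr//; last by apply: rintD; [exact: rintZ Lf.2|exact: rintZ Lg.2].
  apply: le_Rintegral => //.
  - exact: (L2_ip_int (L2Z e Lf) Lg).1.
  - under eq_fun do rewrite /= mulrC.
    by apply: rintZ; apply: rintD; [exact: rintZ Lf.2|exact: rintZ Lg.2].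
  move=> x _; apply: le_trans (ler_norm _) _; apply: le_trans (Re_le_normc _) _.
  rewrite !Normc.normcM e1 mul1r normc_conj.
  set p := normc _; set q := normc _.
  have : 0 <= a^-1 * (a * p - q) ^+ 2 by rewrite mulr_ge0 ?sqr_ge0// invr_ge0 ltW.
  have -> : a^-1 * (a * p - q) ^+ 2 = a * p ^+ 2 + a^-1 * q ^+ 2 - 2 * (p * q).
    by field; rewrite gt_eqF.
  lra.
apply/ler_addgt0Pr => eps eps0.
have := L2norm_ge0 f; have := L2norm_ge0 g.
move: (L2norm mu f) (L2norm mu g) (normc _) young => s t c young t0 s0.
(* the optimal [a] is [t / s]; adding [dl] to both norms keeps the quotient defined *)
pose dl := eps / (s + t + 1 + eps).
have den0 : 0 < s + t + 1 + eps by lra.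
have dl0 : 0 < dl by rewrite divr_gt0.
have dl1 : dl < 1 by rewrite ltr_pdivrMr// mul1r; lra.
have dlE : dl * (s + t + dl) <= eps.
  apply: (@le_trans _ _ (dl * (s + t + 1 + eps))); last by rewrite divfK ?gt_eqF.
  by rewrite ler_pM2l//; lra.
apply: le_trans (young ((t + dl) / (s + dl)) _) _.
  by rewrite divr_gt0// ltr_wpDl.
rewrite invf_div.
have key (p q : R) : 0 <= p -> 0 < q -> 
    (q / (p + dl)) * p ^+ 2 <= q * (p + dl).
  move=> p0 q0; rewrite -mulrA ler_pM2l// mulrC ler_pdivrMr ?ltr_wpDl//.
  by rewrite -expr2 ler_pXn2r ?nnegrE ?addr_ge0 ?(ltW dl0)// lerDl ltW.
have h1 := key s (t + dl) s0 (ltr_wpDl t0 dl0).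
have h2 := key t (s + dl) t0 (ltr_wpDl s0 dl0).
nra.
Qed.

Lemma L2normZ (a : R[i]) f : L2 mu f -> L2norm mu (fun x => a * f x) = normc a * L2norm mu f.
Proof.
move=> Lf; rewrite -[in RHS](ger0_norm (normc_ge0 a)) -sqrtr_sqr -sqrtrM ?sqr_ge0//.
congr Num.sqrt; rewrite -RintegralZl//; last exact: Lf.2.
by apply: eq_Rintegral => x _; rewrite Normc.normcM exprMn.
Qed.

Lemma L2normN f : L2norm mu (fun x => - f x) = L2norm mu f.
Proof. by congr Num.sqrt; apply: eq_Rintegral => x _; rewrite normcN. Qed.

Lemma L2normBC f g : L2norm mu (fun x => f x - g x) = L2norm mu (fun x => g x - f x).
Proof. by rewrite -L2normN; congr L2norm; apply/funext => x; rewrite opprB. Qed.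

Lemma L2norm_le f g : measurable_cfun f -> L2 mu g ->
  (forall x, normc (f x) <= normc (g x)) -> L2norm mu f <= L2norm mu g.
Proof.
move=> mf Lg fg; rewrite ler_wsqrtr// le_Rintegral//; last first.
- by move=> x _; rewrite ler_pXn2r// nnegrE normc_ge0.
- exact: Lg.2.
- apply: (@L2_le f g 1 mf _ Lg).2 => x; by rewrite mul1r.
Qed.

Lemma L2norm_ae f g : L2 mu f -> L2 mu g -> ae_same mu f g -> L2norm mu f = L2norm mu g.
Proof.
move=> [mf _] [mg _] fg; congr Num.sqrt; apply: Rintegral_ae; try exact: mcf_normc2.
by apply: filterS fg => x ->.
Qed.

Lemma L2norm0 : L2norm mu (fun=> 0) = 0.
Proof.
rewrite /L2norm; under eq_Rintegral do rewrite Normc.normc0 expr0n/=.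
by rewrite Rintegral_cst// mul0r sqrtr0.
Qed.

Lemma L2normD f g : L2 mu f -> L2 mu g ->
  L2norm mu (fun x => f x + g x) <= L2norm mu f + L2norm mu g.
Proof.
move=> Lf Lg; have Ls := L2D Lf Lg.
rewrite -ler_sqr ?nnegrE ?addr_ge0 ?L2norm_ge0//.
have self h : L2 mu h -> L2norm mu h ^+ 2 = Re (ip mu h h) by move=> Lh; rewrite ip_self.
rewrite (self _ Ls) ipDl// !ipDr// !ReD -(self f Lf) -(self g Lg).
have := cauchy_schwarz Lf Lg; have := cauchy_schwarz Lg Lf.
have := Re_le_normc (ip mu f g); have := Re_le_normc (ip mu g f).
have := ler_norm (Re (ip mu f g)); have := ler_norm (Re (ip mu g f)).
rewrite sqrrD mulr2n (mulrC (L2norm mu g)); lra.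
Qed.

Lemma L2norm_eq0 f : L2 mu f -> L2norm mu f = 0 -> ae_same mu f (fun=> 0).
Proof.
move=> [mf if_] /eqP; rewrite sqrtr_eq0 => f0.
have /integrableP[mF iF] := if_.
have /ae_eq_integral_abs : (\int[mu]_x `|(normc (f x) ^+ 2)%:E| = 0)%E.
  apply/eqP; rewrite eq_le integral_ge0// andbT.
  have fE : (\int[mu]_x `|(normc (f x) ^+ 2)%:E| =
             (\int[mu]_x (normc (f x) ^+ 2))%:E)%E.
    rewrite /Rintegral fineK; last exact: integrable_fin_num.
    by apply: eq_integral => x _; rewrite /= ger0_norm ?sqr_ge0.
  by rewrite fE lee_fin.
move=> /(_ measurableT mF); apply: filterS => x /(_ I) /= [] /eqP.
by rewrite expf_eq0 /= => /eqP/Normc.eq0_normc.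
Qed.

Lemma ip_self_eq0 f : L2 mu f -> ip mu f f = 0 -> ae_same mu f (fun=> 0).
Proof.
move=> Lf; rewrite ip_self// => /complexI/eqP; rewrite expf_eq0/= => /eqP.
exact: L2norm_eq0.
Qed.

(** Dominated convergence for [|u_n - f|^2], which is at most [4 |g|^2]. *)
Lemma L2cvg_dom (u : nat -> T -> R[i]) f g : (forall n, measurable_cfun (u n)) ->
  measurable_cfun f -> L2 mu g ->
  (forall n x, normc (u n x) <= normc (g x)) ->
  {ae mu, forall x, (fun n => normc (u n x - f x)) @ \oo --> (0 : R)} ->
  (forall x, normc (f x) <= normc (g x)) ->
  L2cvg mu u f.
Proof.
move=> mu_ mf Lg ug uf fg.
have mb n : measurable_cfun (fun x => u n x - f x) by exact: mcfB.
have bnd n x : normc (u n x - f x) ^+ 2 <= 4 * normc (g x) ^+ 2.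
  have h : normc (u n x - f x) <= 2 * normc (g x).
    apply: le_trans (le_normcD _ _) _; rewrite normcN mulr2n mulrDl mul1r.
    exact: lerD (ug n x) (fg x).
  have : normc (u n x - f x) ^+ 2 <= (2 * normc (g x)) ^+ 2.
    by rewrite ler_pXn2r ?nnegrE ?normc_ge0// mulr_ge0 ?normc_ge0.
  by rewrite exprMn -natrX.
have sq_cvg : {ae mu, forall x, [set: T] x ->
    (fun n => (normc (u n x - f x) ^+ 2)%:E) @ \oo --> (0%:E : \bar R)}.
  apply: filterS uf => x h _; apply/cvg_EFin; first by apply: nearW.
  rewrite [X in _ --> X](_ : _ = 0 ^+ 2 :> R); last by rewrite expr0n.
  exact: (cvgM h h).
have [||_ _ c] := @dominated_convergence _ _ _ mu setT measurableT
  (fun n x => (normc (u n x - f x) ^+ 2)%:E) (fun=> 0%:E)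
  (fun x => (4 * normc (g x) ^+ 2)%:E) _
  (@measurable_cst _ _ _ _ _ _) sq_cvg (rintZ 4 Lg.2).
- by move=> n; apply/measurable_EFinP/mcf_normc2/mb.
- by apply: aeW => x n _; rewrite /= lee_fin ger0_norm ?sqr_ge0// bnd.
rewrite /L2cvg /L2norm -[X in _ --> X]sqrtr0.
apply: (@cvg_comp _ _ _ _ (fun x : R => Num.sqrt x) _ (nbhs (0 : R))).
  by move: c; rewrite integral0 => /fine_cvgP[].
exact: sqrt_continuous.
Qed.

Lemma L2normB_le f g h : L2 mu f -> L2 mu g -> L2 mu h ->
  L2norm mu (fun x => f x - h x) <=
  L2norm mu (fun x => f x - g x) + L2norm mu (fun x => g x - h x).
Proof.
move=> Lf Lg Lh; apply: le_trans (L2normD (L2B Lf Lg) (L2B Lg Lh)).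
by rewrite le_eqVlt; apply/orP; left; apply/eqP; congr L2norm; apply/funext => x; rewrite addrA subrK.
Qed.

End Square_integrable.

Definition mpres d (T : measurableType d) (R : realType)
    (mu : {measure set T -> \bar R}) (tau : T -> T) :=
  measurable_fun [set: T] tau /\
  forall E, measurable E -> mu (tau @^-1` E) = mu E.

Section Measure_preserving.
Context {d : measure_display} {T : measurableType d} {R : realType}.
Variables (mu : {measure set T -> \bar R}) (tau : T -> T).
Hypothesis tauP : mpres mu tau.
Implicit Types f g : T -> R[i].

Lemma mcf_comp d' (T' : measurableType d') (s : T -> T') (f : T' -> R[i]) :
  measurable_fun [set: T] s ->
  measurable_cfun f -> measurable_cfun (fun x => f (s x)).
Proof. by move=> ms [fr fi]; split; [exact: measurableT_comp fr ms|exact: measurableT_comp fi ms]. Qed.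

Lemma mpres_ge0_integral (F : T -> \bar R) : measurable_fun [set: T] F ->
  (forall x, 0 <= F x)%E -> (\int[mu]_x F (tau x) = \int[mu]_x F x)%E.
Proof.
move=> mF F0; have [mt pt] := tauP.
have := @ge0_integral_pushforward _ _ _ _ _ _ mt mu setT F measurableT.
rewrite preimage_setT => <-//.
by apply: eq_measure_integral => A mA _; rewrite /= /pushforward pt.
Qed.

Lemma mpres_rint (F : T -> R) : mu.-integrable [set: T] (fun x => (F x)%:E) ->
  mu.-integrable [set: T] (fun x => (F (tau x))%:E).
Proof.
move=> /integrableP[mF iF]; apply/integrableP; split.
  by apply: measurableT_comp mF _; exact: tauP.1.
by rewrite (@mpres_ge0_integral (fun x => `|(F x)%:E|)%E)//; exact: measurableT_comp.
Qed.

Lemma mpres_Rintegral (F : T -> R) : mu.-integrable [set: T] (fun x => (F x)%:E) ->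
  \int[mu]_x F (tau x) = \int[mu]_x F x.
Proof.
move=> iF; have [mt pt] := tauP; congr fine.
have := @integral_pushforward _ _ _ _ _ _ mt mu setT (EFin \o F) _ (mpres_rint iF) measurableT.
rewrite preimage_setT => <-//; last by case/integrableP: iF.
by apply: eq_measure_integral => A mA _; rewrite /= /pushforward pt.
Qed.

Lemma mpres_ae (P : T -> Prop) : {ae mu, forall x, P x} -> {ae mu, forall x, P (tau x)}.
Proof.
move=> [N [mN N0 PN]]; exists (tau @^-1` N); split.
- by rewrite -[X in measurable X]setTI; exact: tauP.1.
- by rewrite tauP.2.
- by move=> x /= h; apply: PN.
Qed.

Lemma mpres_ae_same f g : ae_same mu f g ->
  ae_same mu (fun x => f (tau x)) (fun x => g (tau x)).
Proof. exact: mpres_ae. Qed.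

Lemma L2_comp f : L2 mu f -> L2 mu (fun x => f (tau x)).
Proof.
move=> [mf if_]; split; first by apply: mcf_comp => //; exact: tauP.1.
exact: (@mpres_rint (fun x => Normc.normc (f x) ^+ 2)).
Qed.

Lemma L2norm_comp f : L2 mu f -> L2norm mu (fun x => f (tau x)) = L2norm mu f.
Proof.
move=> [mf if_]; congr Num.sqrt.
exact: (@mpres_Rintegral (fun x => Normc.normc (f x) ^+ 2)).
Qed.

Lemma ip_comp f g : L2 mu f -> L2 mu g ->
  ip mu (fun x => f (tau x)) (fun x => g (tau x)) = ip mu f g.
Proof.
move=> Lf Lg; have [ir ii] := L2_ip_int Lf Lg.
apply: complex_eqP; rewrite !(Re_ip, Im_ip); [exact: mpres_Rintegral ir|exact: mpres_Rintegral ii].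
Qed.

End Measure_preserving.

(** * Density of indicators in mean square *)

#[global] Arguments Normc.normc : simpl never.

Section L2_density.
Import HBNNSimple.
Context {d : measure_display} {T : measurableType d} {R : realType}.
Variable mu : {measure set T -> \bar R}.
Hypothesis mu1 : mu [set: T] = 1%E.
Local Notation Re := (@complex.Re R).
Local Notation Im := (@complex.Im R).
Local Notation normc := (@Normc.normc R).
Implicit Types f g h : T -> R[i].

Lemma L2_bounded f (K : R) : measurable_cfun f -> (forall x, normc (f x) <= K) ->
  L2 mu f.
Proof.
move=> mf fK; split => //; apply: (rint_le (mcf_normc2 mf) (G := fun=> K ^+ 2)).
  move=> x; rewrite ger0_norm ?sqr_ge0// ler_pXn2r ?nnegrE ?normc_ge0//.
  exact: le_trans (normc_ge0 _) (fK x).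
apply/integrableP; split; first exact: measurable_cst.
by rewrite integral_cst//= mu1 mule1 ltry.
Qed.

Lemma normc_indic (E : set T) x : normc ((\1_E x : R)%:C) <= 1.
Proof. by rewrite normc_real indicE; case: (x \in E); rewrite ?normr1 ?normr0 ?ler01. Qed.

Lemma mcf_indic (E : set T) : measurable E -> measurable_cfun (fun x => (\1_E x : R)%:C).
Proof. by move=> mE; apply: mcf_real; exact: measurable_indic. Qed.

Lemma L2_indic (E : set T) : measurable E -> L2 mu (fun x => (\1_E x : R)%:C).
Proof. by move=> mE; apply: (@L2_bounded _ 1); [exact: mcf_indic|exact: normc_indic]. Qed.

(** Indicators of measurable sets span a dense subspace: they generate the simple
    functions, which approximate nonnegative functions from below. *)
Lemma L2_closed_ind (C : set (T -> R[i])) :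
  (forall (a : R[i]) f g, C f -> C g -> C (fun x => a * f x + g x)) ->
  (forall E, measurable E -> C (fun x => (\1_E x : R)%:C)) ->
  (forall u f, (forall n, C (u n)) -> (forall n, L2 mu (u n)) -> L2 mu f ->
    L2cvg mu u f -> C f) ->
  forall f, L2 mu f -> C f.
Proof.
move=> Clin Cind Ccl.
have C0 : C (fun=> 0).
  have := Clin (-1) _ _ (Cind _ measurableT) (Cind _ measurableT).
  by under eq_fun do rewrite mulN1r addNr.
have CZ (a : R[i]) f : C f -> C (fun x => a * f x).
  by move=> Cf; have := Clin a _ _ Cf C0; under eq_fun do rewrite addr0.
have Csum (I : Type) (s : seq I) (a : I -> R[i]) (u : I -> T -> R[i]) :
    (forall i, C (u i)) -> C (fun x => \sum_(i <- s) a i * u i x).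
  move=> Cu; elim: s => [|i s IH]; first by under eq_fun do rewrite big_nil.
  by under eq_fun do rewrite big_cons; exact: Clin.
have Cpos (F : T -> R) : (forall x, 0 <= F x) -> L2 mu (fun x => (F x)%:C) ->
    C (fun x => (F x)%:C).
  move=> F0 LF; have mF : measurable_fun [set: T] F := LF.1.1.
  have mEF : measurable_fun [set: T] (EFin \o F) by exact/measurable_EFinP.
  pose u n : T -> R := nnsfun_approx measurableT mEF n.
  have uF n x : 0 <= u n x <= F x.
    apply/andP; split; first exact: fun_ge0.
    rewrite /u nnsfun_approxE -lee_fin.
    by apply: (@le_approx _ _ _ setT (EFin \o F)) => // y _; rewrite lee_fin.
  have mu_ n : measurable_cfun (fun x => (u n x)%:C).
    by apply: mcf_real; exact: measurable_funP.
  have bnd n x : normc (u n x)%:C <= normc (F x)%:C.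
    by rewrite !normc_real; have /andP[u0 uF'] := uF n x; rewrite !ger0_norm.
  have Lu n : L2 mu (fun x => (u n x)%:C).
    by apply: (@L2_le _ _ _ mu _ _ 1 _ _ LF) => // x; rewrite mul1r.
  apply: (Ccl (fun n x => (u n x)%:C)) => // [n|].
    rewrite (_ : (fun x => _) = (fun x => \sum_(y <- finmap.enum_fset (fset_set (range (u n))))
        y%:C * (\1_(u n @^-1` [set y]) x : R)%:C)).
      apply: Csum => y; apply: Cind.
      exact: measurable_sfunP.
    apply/funext => x; rewrite [u n x]fimfunE fsbig_finite//= rmorph_sum.
    by apply: eq_bigr => y _; rewrite rmorphM.
  have mFc : measurable_cfun (fun x => (F x)%:C) := LF.1.
  apply: (@L2cvg_dom _ _ _ mu _ _ (fun x => (F x)%:C)) => //.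
  apply: aeW => x.
  have /fine_cvgP[_ h0] := @cvg_nnsfun_approx _ _ _ _ measurableT _ mEF
    (fun x _ => F0 x : (0 <= (EFin \o F) x)%E) x I.
  have /subr_cvg0 h : (fun n => u n x) @ \oo --> F x by exact: h0.
  under eq_fun do rewrite -rmorphB normc_real.
  by have h2 := cvg_norm h; rewrite normr0 in h2; exact: h2.
have Creal (F : T -> R) : L2 mu (fun x => (F x)%:C) -> C (fun x => (F x)%:C).
  move=> LF; have mF : measurable_fun [set: T] F := LF.1.1.
  have Fpm x : F x = (`|F x| + F x) / 2 - (`|F x| - F x) / 2 by lra.
  under eq_fun do rewrite Fpm rmorphB /= addrC -mulN1r.
  have part (s : R) : (s == 1) || (s == -1) -> C (fun x => ((`|F x| + s * F x) / 2)%:C).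
    move=> s1; have mp : measurable_fun [set: T] (fun x => (`|F x| + s * F x) / 2).
      apply: measurable_funM => //; apply: measurable_funD; last exact: measurable_funM.
      exact: measurableT_comp.
    have sF x : `|s * F x| = `|F x|.
      by case/orP: s1 => /eqP ->; rewrite ?mul1r ?mulN1r ?normrN.
    apply: Cpos => [x|].
      by have := ler_norm (- (s * F x)); rewrite normrN sF; lra.
    apply: (@L2_le _ _ _ mu _ _ 1 _ _ LF); first exact: mcf_real.
    move=> x; rewrite mul1r !normc_real.
    have := sF x; have := ler_norm (s * F x); have := ler_norm (- (s * F x)).
    rewrite normrN => h1 h2 h3; rewrite ger0_norm; lra.
  apply: Clin.
    by have := part (-1); under eq_fun do rewrite mulN1r; apply; rewrite eqxx orbT.
  by have := part 1; under eq_fun do rewrite mul1r; apply; rewrite eqxx.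
move=> f Lf.
have fE x : f x = 'i * (Im (f x))%:C + (Re (f x))%:C by rewrite addrC -complexE.
rewrite (funext fE); apply: Clin; apply: Creal.
  apply: (@L2_le _ _ _ mu _ _ 1 _ _ Lf); first exact/mcf_real/Lf.1.2.
  by move=> x; rewrite mul1r normc_real Im_le_normc.
apply: (@L2_le _ _ _ mu _ _ 1 _ _ Lf); first exact/mcf_real/Lf.1.1.
by move=> x; rewrite mul1r normc_real Re_le_normc.
Qed.

End L2_density.

(** * The generator of a measure preserving flow *)

Section Cvg_at_zero.
Variable R : realType.

Lemma cvg0_dnbhsP (F : R -> R) : F @ 0^' --> (0 : R) <->
  forall e : R, 0 < e -> exists2 d : R, 0 < d &
    forall t : R, t != 0 -> `|t| < d -> `|F t| < e.
Proof.
split=> [/cvgrPdist_lt h e e0|h].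
  have [d /= d0 hd] := h e e0; exists d => // t t0 td.
  by have := hd t; rewrite /ball/= !sub0r !normrN; apply.
apply/cvgrPdist_lt => e e0; have [d d0 hd] := h e e0.
exists d => //= t; rewrite /ball/= !sub0r !normrN => td t0; exact: hd.
Qed.

End Cvg_at_zero.

(** A jointly measurable, measure preserving flow. The last clause is continuity
    of [t |-> 1_E o Phi_t] at 0 in measure. *)
Record mflow d (T : measurableType d) (R : realType)
    (mu : {measure set T -> \bar R}) (Phi : R -> T -> T) := MFlow {
  mflow0 : forall x, Phi 0 x = x ;
  mflowD : forall s t x, Phi (s + t) x = Phi s (Phi t x) ;
  mflow_mpres : forall t, mpres mu (Phi t) ;
  mflow_meas : measurable_fun [set: measurableTypeR R * T]
    (fun p : measurableTypeR R * T => Phi p.1 p.2) ;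
  mflow_cont : forall E, measurable E -> forall e : R, 0 < e ->
    exists2 d : R, 0 < d & forall t : R, `|t| < d ->
      (mu [set x | E x <> E (Phi t x)] <= e%:E)%E }.

Section Generator.
Context {d : measure_display} {T : measurableType d} {R : realType}.
Variables (mu : {measure set T -> \bar R}) (Phi : R -> T -> T).
Hypothesis mu1 : mu [set: T] = 1%E.
Hypothesis PhiP : mflow mu Phi.
Local Notation Re := (@complex.Re R).
Local Notation Im := (@complex.Im R).
Local Notation normc := (@Normc.normc R).
Implicit Types f g h : T -> R[i].

Lemma normci : normc ('i : R[i]) = 1.
Proof. by rewrite /Normc.normc expr0n expr1n add0r sqrtr1. Qed.

Definition diffq (t : R) f : T -> R[i] :=
  fun x => 'i * (t^-1)%:C * (f (Phi t x) - f x).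

(** Graph of the self-adjoint generator of the flow. *)
Definition gen f h : Prop :=
  [/\ L2 mu f, L2 mu h &
    (fun t : R => L2norm mu (fun x => diffq t f x - h x)) @ 0^' --> (0 : R)].

Lemma L2_flow t f : L2 mu f -> L2 mu (fun x => f (Phi t x)).
Proof. exact/L2_comp/mflow_mpres. Qed.

Lemma L2_diffq t f : L2 mu f -> L2 mu (diffq t f).
Proof. by move=> Lf; apply: L2Z; apply: L2B => //; exact: L2_flow. Qed.

Lemma flow_commute s t x : Phi s (Phi t x) = Phi t (Phi s x).
Proof. by rewrite -!(mflowD PhiP) addrC. Qed.

Lemma flowNK t x : Phi (- t) (Phi t x) = x.
Proof. by rewrite -(mflowD PhiP) addNr (mflow0 PhiP). Qed.

Lemma genP f h : gen f h <-> [/\ L2 mu f, L2 mu h &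
  forall e : R, 0 < e -> exists2 d : R, 0 < d & forall t : R, t != 0 -> `|t| < d ->
    L2norm mu (fun x => diffq t f x - h x) < e].
Proof.
split=> -[Lf Lh H]; split=> //.
  move=> e e0; have [dl d0 hd] := (cvg0_dnbhsP _).1 H e e0; exists dl => // t t0 td.
  exact: le_lt_trans (ler_norm _) (hd t t0 td).
apply/cvg0_dnbhsP => e e0; have [dl d0 hd] := H e e0; exists dl => // t t0 td.
by rewrite ger0_norm ?L2norm_ge0// hd.
Qed.

Lemma gen_lin (a : R[i]) f h f' h' : gen f h -> gen f' h' ->
  gen (fun x => a * f x + f' x) (fun x => a * h x + h' x).
Proof.
move=> /genP[Lf Lh H] /genP[Lf' Lh' H']; apply/genP; split.
- by apply: L2D => //; exact: L2Z.
- by apply: L2D => //; exact: L2Z.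
move=> e e0; have a1 : 0 < normc a + 1 by rewrite ltr_wpDl ?normc_ge0.
have e2 : 0 < e / 2 by rewrite divr_gt0.
have [d1 d10 hd1] := H (e / 2 / (normc a + 1)) (divr_gt0 e2 a1).
have [d2 d20 hd2] := H' (e / 2) e2.
exists (Num.min d1 d2); first by rewrite lt_min d10.
move=> t t0; rewrite lt_min => /andP[td1 td2].
rewrite (_ : (fun x => _) = (fun x =>
    a * (diffq t f x - h x) + (diffq t f' x - h' x))); last first.
  by apply/funext => x; rewrite /diffq; ring.
have L1 := L2B (L2_diffq t Lf) Lh; have L1' := L2B (L2_diffq t Lf') Lh'.
apply: le_lt_trans (L2normD (L2Z a L1) L1') _; rewrite L2normZ//.
have : normc a * L2norm mu (fun x => diffq t f x - h x) <= e / 2.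
  rewrite -[leRHS](divfK (lt0r_neq0 a1)) mulrC.
  apply: ler_pM; rewrite ?L2norm_ge0 ?normc_ge0 ?lerDl ?ler01//.
  exact/ltW/hd1.
have := hd2 t t0 td2; lra.
Qed.

Lemma gen_comp s f h : gen f h ->
  gen (fun x => f (Phi s x)) (fun x => h (Phi s x)).
Proof.
move=> /genP[Lf Lh H]; apply/genP; split; try exact: L2_flow.
move=> e e0; have [dl d0 hd] := H e e0; exists dl => // t t0 td.
have := hd t t0 td.
rewrite -(L2norm_comp (mflow_mpres PhiP s) (L2B (L2_diffq t Lf) Lh)).
by congr (L2norm _ _ < _); apply/funext => x; rewrite /diffq flow_commute.
Qed.

(** On the domain, strong continuity of the flow follows from the boundedness of the
    difference quotients. *)
Lemma gen_cont f h : gen f h -> forall e : R, 0 < e -> exists2 d : R, 0 < d &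
  forall t : R, `|t| < d -> L2norm mu (fun x => f (Phi t x) - f x) < e.
Proof.
move=> /genP[Lf Lh H] e e0; have [dl d0 hd] := H 1 ltr01.
pose K := 1 + L2norm mu h.
have K0 : 0 < K by rewrite ltr_pwDl ?L2norm_ge0.
exists (Num.min dl (e / K)); first by rewrite lt_min d0 divr_gt0.
move=> t; rewrite lt_min => /andP[td te].
have [->|t0] := eqVneq t 0.
  rewrite (_ : (fun x => _) = (fun=> 0)) ?L2norm0//.
  by apply/funext => x; rewrite (mflow0 PhiP) subrr.
have Lq := L2_diffq t Lf.
have -> : (fun x => f (Phi t x) - f x) = (fun x => (- 'i * t%:C) * diffq t f x).
  apply/funext => x; rewrite /diffq !mulrA.
  rewrite (_ : - 'i * t%:C * 'i * (t^-1)%:C = 1) ?mul1r//.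
  rewrite (_ : _ * _ = - ('i ^+ 2) * (t * t^-1)%:C); last by rewrite rmorphM/=; ring.
  by rewrite sqr_i opprK mul1r divff.
rewrite L2normZ// Normc.normcM normc_real.
have -> : normc (- 'i) = 1 by rewrite normcN normci.
rewrite mul1r; have : L2norm mu (diffq t f) <= K.
  rewrite (_ : diffq t f = fun x => (diffq t f x - h x) + h x); last first.
    by apply/funext => x; rewrite subrK.
  apply: le_trans (L2normD (L2B Lq Lh) Lh) _; rewrite lerD2r.
  exact/ltW/hd.
move=> /(ler_wpM2l (normr_ge0 t))/le_lt_trans; apply.
by rewrite -ltr_pdivlMr.
Qed.

(** The generator is symmetric because the flow is unitary: the adjoint of the
    difference quotient at [t] is the difference quotient at [-t]. *)
Lemma gen_sym f h f' h' : gen f h -> gen f' h' -> ip mu h f' = ip mu f h'.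
Proof.
move=> /genP[Lf Lh H] /genP[Lf' Lh' H'].
apply/eqP; rewrite -subr_eq0; apply/eqP/Normc.eq0_normc/eqP.
rewrite eq_le normc_ge0 andbT; apply/ler_addgt0Pr => e e0; rewrite add0r.
pose K := L2norm mu f + L2norm mu f' + 1.
have K0 : 0 < K by rewrite ltr_wpDl// addr_ge0// L2norm_ge0.
have e2 : 0 < e / 2 by rewrite divr_gt0.
have [d1 d10 hd1] := H (e / 2 / K) (divr_gt0 e2 K0).
have [d2 d20 hd2] := H' (e / 2 / K) (divr_gt0 e2 K0).
(* any small time will do: the quotients at [t] and [-t] are both close to their limits *)
pose t := Num.min d1 d2 / 2.
have m0 : 0 < Num.min d1 d2 by rewrite lt_min d10.
have t0 : 0 < t by rewrite divr_gt0.
have tm : `|t| < Num.min d1 d2 by rewrite gtr0_norm// /t; lra.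
move: (tm); rewrite lt_min => /andP[td1 td2].
have a1 := hd1 t (lt0r_neq0 t0) td1.
have a2 : L2norm mu (fun x => diffq (- t) f' x - h' x) < e / 2 / K.
  by apply: hd2; rewrite ?normrN// oppr_eq0 gt_eqF.
have adj : ip mu (diffq t f) f' = ip mu f (diffq (- t) f').
  have Lft := L2_flow t Lf; have Lft' := L2_flow (- t) Lf'.
  rewrite /diffq ipZl ?ipZr ?ipBl ?ipBr//; try exact: L2B.
  have -> : ip mu (fun x => f (Phi t x)) f' = ip mu f (fun x => f' (Phi (- t) x)).
    rewrite -(ip_comp (mflow_mpres PhiP t) Lf Lft').
    by congr ip; apply/funext => x; rewrite flowNK.
  congr (_ * _); apply: complex_eqP; rewrite /= ?mulr0 ?mul0r ?oppr0 ?subr0 ?addr0//.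
  by rewrite invrN; ring.
have -> : ip mu h f' - ip mu f h' =
    ip mu (fun x => h x - diffq t f x) f' + ip mu f (fun x => diffq (- t) f' x - h' x).
  by rewrite ipBl ?ipBr ?adj//; try exact: L2_diffq; ring.
apply: le_trans (le_normcD _ _) _.
have c1 := cauchy_schwarz (L2B Lh (L2_diffq t Lf)) Lf'.
have c2 := cauchy_schwarz Lf (L2B (L2_diffq (- t) Lf') Lh').
rewrite L2normBC in c1.
have k1 (A B : R) : 0 <= B -> B <= K -> A < e / 2 / K -> A * B <= e / 2.
  move=> B0 BK AK; have [A0|/ltW A0] := leP 0 A; last first.
    by apply: (@le_trans _ _ 0); [rewrite mulr_le0_ge0|lra].
  rewrite -[leRHS](divfK (lt0r_neq0 K0)).
  by apply: ler_pM => //; exact: ltW.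
have n1 := L2norm_ge0 mu f; have n2 := L2norm_ge0 mu f'.
have b1 := k1 _ _ n2 (_ : L2norm mu f' <= K) a1.
have b2 := k1 _ _ n1 (_ : L2norm mu f <= K) a2.
have := b1 (ltac:(rewrite /K; lra)); have := b2 (ltac:(rewrite /K; lra)).
rewrite (mulrC _ (L2norm mu f)) => b1' b2'.
by have := lerD (le_trans c1 b2') (le_trans c2 b1'); lra.
Qed.

(** A phase [C] that rotates at speed [rho] along the flow. The Lipschitz bound makes the
    difference quotients of [C] uniformly bounded, so that dominated convergence applies
    to their products with square-integrable functions. *)
Record log_deriv (C : T -> R[i]) (rho : T -> R) : Prop := LogDeriv {
  ld_mC : measurable_cfun C ;
  ld_mrho : measurable_fun [set: T] rho ;
  ld_normC : forall x, normc (C x) = 1 ;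
  ld_bound : exists2 K : R, 0 <= K & (forall x, `|rho x| <= K) /\
    (forall x t, normc (C (Phi t x) - C x) <= K * `|t|) ;
  ld_deriv : forall x, (fun t : R =>
     normc ((t^-1)%:C * (C (Phi t x) - C x) - 'i * (rho x)%:C * C x)) @ 0^' --> (0 : R) }.

(** Leibniz rule. With the factor [i] in the generator, the derivative [i rho C] of the
    phase contributes [- rho C f], so the commutator of the generator with a weighted
    translation [V] is multiplication by [- rho] after [V]. *)
Lemma gen_weighted C rho s f h : log_deriv C rho -> gen f h ->
  gen (fun x => C x * f (Phi s x))
      (fun x => C x * h (Phi s x) - (rho x)%:C * (C x * f (Phi s x))).
Proof.
move=> CP /(gen_comp s).
suff gen0 f' h' : gen f' h' -> gen (fun x => C x * f' x)
    (fun x => C x * h' x - (rho x)%:C * (C x * f' x)); first exact: gen0.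
move: f' h' => {s f h}f h Gfh.
have [Lf Lh H] := (genP f h).1 Gfh.
have [mC mr C1 [K K0 [rK CK]] Cd] := CP.
have C1' x : normc (C x) <= 1 by rewrite C1.
have mrC : measurable_cfun (fun x => (rho x)%:C) by exact: mcf_real.
have LCf := L2M mC C1' Lf; have LCh := L2M mC C1' Lh.
have rK' x : normc (rho x)%:C <= K by rewrite normc_real.
have LrCf := L2M mrC rK' LCf.
have mCt t : measurable_cfun (fun x => C (Phi t x)).
  by apply: mcf_comp => //; exact: (mflow_mpres PhiP t).1.
pose Q t x : R[i] := (t^-1)%:C * (C (Phi t x) - C x).
have mQ t : measurable_cfun (Q t) by apply: mcfZ; exact: mcfB.
have QK t x : normc (Q t x) <= K.
  rewrite Normc.normcM normc_real normfV.
  have [->|t0] := eqVneq t 0; first by rewrite normr0 invr0 mul0r.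
  by rewrite mulrC ler_pdivrMr ?normr_gt0.
pose E t x : R[i] := Q t x - 'i * (rho x)%:C * C x.
have mE t : measurable_cfun (E t).
  by apply: mcfB => //; apply: mcfM => //; exact: mcfZ.
have EK t x : normc (E t x) <= 2 * K.
  apply: le_trans (le_normcD _ _) _; rewrite normcN.
  have : normc ('i * (rho x)%:C * C x) <= K.
    by rewrite !Normc.normcM normci C1 mulr1 mul1r.
  by have := QK t x; lra.
have LEf t : L2 mu (fun x => E t x * f x) by exact: L2M (mE t) (EK t) Lf.
have Ecvg : (fun t => L2norm mu (fun x => E t x * f x)) @ 0^' --> (0 : R).
  apply/cvgr_dnbhsP => u [u0 ucvg].
  have : L2cvg mu (fun n x => E (u n) x * f x) (fun=> 0).
    apply: (@L2cvg_dom _ _ _ mu _ _ (fun x => (2 * K)%:C * f x)) => //.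
    - by move=> n; case: (LEf (u n)).
    - exact: L2Z.
    - move=> n x; rewrite !Normc.normcM ler_wpM2r ?normc_ge0// normc_real.
      by apply: le_trans (EK _ _) _; exact: ler_norm.
    - apply: aeW => x.
      have /cvgr_dnbhsP/(_ u (conj u0 ucvg)) c := Cd x.
      under eq_fun do rewrite subr0 Normc.normcM.
      have h2 := cvgM c (@cvg_cst _ (normc (f x)) _ \oo _).
      by rewrite mul0r in h2; exact: h2.
    - by move=> x; rewrite Normc.normc0 normc_ge0.
  rewrite /L2cvg; apply: cvg_trans; apply: near_eq_cvg; apply: nearW => n.
  by congr L2norm; apply/funext => x; rewrite subr0.
apply/genP; split=> //; first exact: L2B.
move=> e e0.
have e3 : 0 < e / 3 by rewrite divr_gt0.
have [d1 d10 hd1] := H (e / 3) e3.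
have K1 : 0 < K + 1 by rewrite ltr_wpDl.
have [d2 d20 hd2] := gen_cont Gfh (divr_gt0 e3 K1).
have [d3 d30 hd3] := (cvg0_dnbhsP _).1 Ecvg (e / 3) e3.
exists (Num.min d1 (Num.min d2 d3)); first by rewrite !lt_min d10 d20.
move=> t t0; rewrite !lt_min => /and3P[/hd1-/(_ t0) {}hd1 /hd2 {}hd2 /hd3-/(_ t0) {}hd3].
have Lft := L2_flow t Lf.
(* split the error into that of [f], the increment of [C] times that of [f], and the
   error of [C] *)
rewrite (_ : (fun x => _) = (fun x => C x * (diffq t f x - h x) +
    ('i * Q t x * (f (Phi t x) - f x) + 'i * (E t x * f x)))); last first.
  apply/funext => x; rewrite /E /Q /diffq.
  have -> : - ('i * (rho x)%:C * C x) = - 'i * ((rho x)%:C * C x) by ring.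
  have -> (a b c : R[i]) : 'i * ((a + - 'i * b) * c) = 'i * a * c + b * c.
    rewrite (_ : 'i * _ = 'i * a * c - 'i ^+ 2 * b * c); last by ring.
    by rewrite sqr_i mulN1r mulNr opprK.
  ring.
have L1 : L2 mu (fun x => C x * (diffq t f x - h x)).
  by apply: L2M mC C1' _; exact: L2B (L2_diffq t Lf) Lh.
have mi : measurable_cfun (fun x => 'i * Q t x) by exact: mcfZ.
have iK x : normc ('i * Q t x) <= K by rewrite Normc.normcM normci mul1r.
have L2' : L2 mu (fun x => 'i * Q t x * (f (Phi t x) - f x)).
  by apply: L2M mi iK _; exact: L2B.
have L3 := L2Z 'i (LEf t).
apply: le_lt_trans (L2normD L1 (L2D L2' L3)) _.
have n1 : L2norm mu (fun x => C x * (diffq t f x - h x)) <= e / 3.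
  apply: le_trans (ltW hd1); apply: L2norm_le => //; first exact: L1.1.
    exact: L2B (L2_diffq t Lf) Lh.
  by move=> x; rewrite Normc.normcM C1 mul1r.
have n2 : L2norm mu (fun x => 'i * Q t x * (f (Phi t x) - f x)) < e / 3.
  apply: (@le_lt_trans _ _ (L2norm mu (fun x => K%:C * (f (Phi t x) - f x)))).
    apply: L2norm_le; [exact: L2'.1|exact/L2Z/L2B|].
    by move=> x; rewrite Normc.normcM [leRHS]Normc.normcM normc_real (ger0_norm K0) ler_wpM2r ?normc_ge0.
  rewrite L2normZ; last exact: L2B.
  rewrite normc_real ger0_norm//.
  apply: (@le_lt_trans _ _ ((K + 1) * L2norm mu (fun x => f (Phi t x) - f x))).
    by rewrite ler_wpM2r ?L2norm_ge0// lerDl.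
  by rewrite mulrC -ltr_pdivlMr.
have n3 : L2norm mu (fun x => 'i * (E t x * f x)) < e / 3.
  by rewrite L2normZ// normci mul1r (le_lt_trans (ler_norm _)).
by have := L2normD L2' L3; lra.
Qed.

End Generator.

(** * Density of the domain of the generator *)

Lemma lebesgue_measure_shift (R : realType) (t : R) (S : set (measurableTypeR R)) :
  measurable S ->
  lebesgue_measure ((fun s : measurableTypeR R => s + t) @^-1` S) = lebesgue_measure S.
Proof.
move=> mS.
have mt : measurable_fun setT (fun s : measurableTypeR R => (s + t : measurableTypeR R)).
  exact: measurable_funD.
have -> : lebesgue_measure ((fun s : measurableTypeR R => s + t) @^-1` S) =
  pushforward (@lebesgue_measure R) (fun s : measurableTypeR R => (s + t : measurableTypeR R)) S by [].
apply/esym/lebesgue_measure_unique => //= _ [[a b]] _ <-.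
rewrite /pushforward.
have -> : (fun s : measurableTypeR R => s + t) @^-1` `](a, b).1, (a, b).2] =
    `]a - t, b - t]%classic.
  by apply/seteqP; split => s /=; rewrite !in_itv/= ltrBlDr lerBrDr.
by rewrite !lebesgue_measure_itv/= !lte_fin ltrD2r -!EFinB; case: ifP => // _; congr EFin; ring.
Qed.

Lemma neq_propP (P Q : Prop) : (P <> Q) <-> (P /\ ~ Q) \/ (Q /\ ~ P).
Proof.
split=> [PQ|]; last by move=> [] [p nq] e; apply: nq; rewrite ?e// -e.
have [p|np] := pselect P; [left|right]; split=> //.
  by move=> q; apply: PQ; rewrite propeqE.
by apply: contrapT => nq; apply: PQ; rewrite propeqE.
Qed.

Section Generator_density.
Context {d : measure_display} {T : measurableType d} {R : realType}.
Variables (mu : probability T R) (Phi : R -> T -> T).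
Hypothesis PhiP : mflow mu Phi.
Local Notation normc := (@Normc.normc R).
Local Notation leb := (@lebesgue_measure R).
Local Notation Rm := (measurableTypeR R).

Section Occupation.
Variable E : set T.
Hypothesis mE : measurable E.

(** Occupation of [E] by the orbit of [x] and its duration. Averages over short windows
    approximate the indicator of [E] and lie in the domain of the generator. *)
Definition occ_set (a b : R) (x : T) : set Rm := `]a, b]%classic `&` [set s | E (Phi s x)].
Definition occ (a b : R) (x : T) : R := fine (leb (occ_set a b x)).

Let A : set (Rm * T) := [set p | E (Phi p.1 p.2)].

Let mA : measurable A.
Proof. by rewrite -[A]setTI; exact: (mflow_meas PhiP). Qed.

Let ysectionA x : [set s | E (Phi s x)] = ysection A x.
Proof. by apply/seteqP; split => s; rewrite /ysection/= inE. Qed.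

Lemma measurable_occ_set a b x : measurable (occ_set a b x).
Proof.
by apply: measurableI => //; rewrite ysectionA; exact: measurable_ysection.
Qed.

Lemma leb_itv (a b : R) : a <= b -> leb (`]a, b]%classic : set Rm) = (b - a)%:E.
Proof.
move=> ab; rewrite lebesgue_measure_itv/= lte_fin; case: ltP => // ba.
by rewrite (_ : b = a) ?subrr//; apply/eqP; rewrite eq_le ab ba.
Qed.

Lemma leb_occ_le a b x : a <= b -> (leb (occ_set a b x) <= (b - a)%:E)%E.
Proof.
move=> ab; rewrite -leb_itv//; apply: le_measure; rewrite ?inE//.
  exact: measurable_occ_set.
exact: subIsetl.
Qed.

Lemma occE a b x : a <= b -> leb (occ_set a b x) = (occ a b x)%:E.
Proof.
move=> ab; rewrite fineK// ge0_fin_numE//; apply: le_lt_trans (leb_occ_le x ab) _.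
by rewrite ltry.
Qed.

Lemma occ_ge0 a b x : 0 <= occ a b x. Proof. exact: fine_ge0. Qed.

Lemma occ_le a b x : a <= b -> occ a b x <= b - a.
Proof. by move=> ab; rewrite -lee_fin -occE// leb_occ_le. Qed.

Lemma occ_cat a b c x : a <= b -> b <= c -> occ a c x = occ a b x + occ b c x.
Proof.
move=> ab bc; have ac := le_trans ab bc; apply: EFin_inj.
rewrite EFinD -!occE// -measureU; try exact: measurable_occ_set.
  congr (leb _); rewrite /occ_set -setIUl; congr (_ `&` _).
  apply/seteqP; split => s /=; rewrite !in_itv/=.
    by move=> /andP[as_ sc]; case: (leP s b) => sb; [left|right]; rewrite ?as_ ?sc.
  by move=> [/andP[-> h]|/andP[h ->]]; rewrite ?andbT; [exact: le_trans h bc|exact: le_lt_trans ab h].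
apply/seteqP; split => // s [[/= + _] [+ _]]; rewrite !in_itv/= => /andP[_ sb] /andP[bs _].
by have := le_lt_trans sb bs; rewrite ltxx.
Qed.

Lemma occ_shift a b t x : occ a b (Phi t x) = occ (a + t) (b + t) x.
Proof.
have := lebesgue_measure_shift t (measurable_occ_set (a + t) (b + t) x).
rewrite /occ => <-; congr (fine (leb _)).
apply/seteqP; split => s /= [h1 h2]; split; move: h1 h2;
  by rewrite /= ?in_itv/= ?ltrD2r ?lerD2r ?(mflowD PhiP).
Qed.

Lemma measurable_occ a b : measurable_fun [set: T] (occ a b).
Proof.
apply: measurableT_comp => //.
pose B : set (Rm * T) := (`]a, b]%classic `*` setT) `&` A.
have mB : measurable B by apply: measurableI => //; exact: measurableX.
rewrite (_ : (fun x => _) = leb \o ysection B); first exact: measurable_fun_ysection.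
apply/funext => x /=; congr (leb _).
by apply/seteqP; split => s; rewrite /ysection/= inE/=; [move=> [? ?]|move=> [[? _] ?]].
Qed.

(** By Tonelli, the mean time that an orbit spends on the wrong side of [E]
    is the mean over time of the measure of [E] minus its translate. *)
Lemma occ_average (a b eta : R) : a < b -> 0 <= eta ->
  (forall s, a < s -> s <= b -> (mu [set x | E x <> E (Phi s x)] <= eta%:E)%E) ->
  L2norm mu (fun x => (occ a b x / (b - a) - \1_E x)%:C) ^+ 2 <= eta.
Proof.
move=> ab eta0 Hs.
have ab0 : 0 < b - a by rewrite subr_gt0.
pose D : set (Rm * T) := (`]a, b]%classic `*` setT) `&`
  ((A `\` (setT `*` E)) `|` ((setT `*` E) `\` A)).
have mD : measurable D.
  apply: measurableI; first exact: measurableX.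
  have mSE : measurable (setT `*` E : set (Rm * T)) by exact: measurableX.
  by apply: measurableU; exact: measurableD.
have yD x : leb (ysection D x) = ((b - a) * `|occ a b x / (b - a) - \1_E x|)%:E.
  have [Ex|nEx] := pselect (E x).
    have -> : ysection D x = `]a, b]%classic `\` occ_set a b x.
      apply/seteqP; split => s; rewrite /ysection/= inE/=.
        by move=> [[h _] [[_ []]|[_ ns]]] //; split => // -[].
      by move=> [h ns]; split => //; right; split=> // ?; apply: ns.
    have fin : (leb (`]a, b]%classic : set Rm) < +oo)%E by rewrite leb_itv ?ltry// ltW.
    have -> : (leb (`]a, b]%classic `\` occ_set a b x) =
        leb `]a, b]%classic - leb (`]a, b]%classic `&` occ_set a b x))%E.
      by apply: measureD => //; exact: measurable_occ_set.
    rewrite setIidr; last exact: subIsetl.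
    have -> : \1_E x = 1 :> R by rewrite indicE mem_set.
    rewrite leb_itv ?occE ?(ltW ab)// -EFinB; congr EFin.
    have o := @occ_le a b x (ltW ab).
    rewrite ler0_norm; first by field; rewrite gt_eqF.
    by rewrite subr_le0 ler_pdivrMr ?mul1r.
  have -> : ysection D x = occ_set a b x.
    apply/seteqP; split => s; rewrite /ysection/= inE/=.
      by move=> [[h _] [[? _]|[[_ ?] _]]] //; split.
    by move=> [h ?]; split => //; left; split=> // -[].
  rewrite occE ?(ltW ab)// indicE memNset// subr0 ger0_norm.
    by congr EFin; field; rewrite gt_eqF.
  by rewrite divr_ge0 ?occ_ge0// ltW.
have xD s : (mu (xsection D s) <= (eta * \1_(`]a, b]%classic : set Rm) s)%:E)%E.
  rewrite indicE; have [sab|sab] := pselect (`]a, b]%classic s).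
    rewrite mem_set// mulr1.
    apply: (@le_trans _ _ (mu [set x | E x <> E (Phi s x)])); last first.
      by move: sab; rewrite /= in_itv/= => /andP[? ?]; exact: Hs.
    rewrite le_eqVlt; apply/orP; left; apply/eqP; congr (mu _).
    apply/seteqP; split => x; rewrite /xsection/= inE/=.
      by move=> [_ [[h1 h2]|[[_ h1] h2]]]; apply/neq_propP; [right|left]; split=> // ?; apply: h2.
    by move/neq_propP => [[h1 h2]|[h1 h2]]; split=> //; [right|left]; split=> // -[].
  rewrite memNset// mulr0 (_ : xsection D s = set0) ?measure0//.
  by apply/seteqP; split => // x; rewrite /xsection/= inE/= => -[[]].
have occ1 x : 0 <= occ a b x / (b - a) <= 1.
  by rewrite divr_ge0 ?occ_ge0 ?(ltW ab0)//= ler_pdivrMr// mul1r occ_le// ltW.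
have mF : measurable_fun setT (fun x => occ a b x / (b - a) - \1_E x : R).
  apply: measurable_funB; last exact: measurable_indic.
  by apply: measurable_funM => //; exact: measurable_occ.
have F1 x : `|occ a b x / (b - a) - \1_E x| <= 1.
  have /andP[h1 h2] := occ1 x; rewrite ler_norml indicE.
  by case: (x \in E) => /=; apply/andP; split; lra.
have LF : L2 mu (fun x => (occ a b x / (b - a) - \1_E x)%:C).
  apply: (@L2_bounded _ _ _ mu (@probability_setT _ _ _ mu) _ 1); first exact: mcf_real.
  by move=> x; rewrite normc_real.
rewrite L2norm2 -lee_fin /Rintegral fineK; last first.
  by apply: (@integrable_fin_num _ _ _ mu setT) => //; exact: LF.2.
apply: (@le_trans _ _ (\int[mu]_x (((b - a)^-1)%:E * leb (ysection D x)))%E).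
  apply: ge0_le_integral => //.
  - by move=> x _; rewrite lee_fin sqr_ge0.
  - by apply/measurable_EFinP/mcf_normc2; exact: LF.1.
  - by apply: measurable_funeM; exact: measurable_fun_ysection.
  move=> x _; rewrite yD -EFinM lee_fin normc_real mulrA mulVf ?gt_eqF// mul1r.
  by rewrite expr2 ler_piMr.
rewrite ge0_integralZl//; last 2 first.
- exact: measurable_fun_ysection.
- by rewrite lee_fin invr_ge0 ltW.
have fub := @indic_fubini_tonelli _ _ Rm T R leb mu D mD.
rewrite (indic_fubini_tonelli_FE _ mD) (indic_fubini_tonelli_GE _ mD) in fub.
have -> : (\int[mu]_x leb (ysection D x) = \int[leb]_s mu (xsection D s))%E.
  exact: esym fub.
have le1 : (\int[leb]_s mu (xsection D s) <= (eta * (b - a))%:E)%E.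
  apply: (@le_trans _ _ (\int[leb]_s (eta * \1_(`]a, b]%classic : set Rm) s)%:E)%E).
    apply: ge0_le_integral => //.
    - exact: measurable_fun_xsection.
    - by apply/measurable_EFinP; apply: measurable_funM => //; exact: measurable_indic.
  under eq_integral do rewrite EFinM.
  rewrite ge0_integralZl//; last by apply/measurable_EFinP; exact: measurable_indic.
  have -> : (\int[leb]_s (\1_(`]a, b]%classic : set Rm) s)%:E = leb `]a, b]%classic)%E.
    by rewrite integral_indic// setIT.
  by rewrite leb_itv ?(ltW ab)// EFinM.
apply: (@le_trans _ _ (((b - a)^-1)%:E * (eta * (b - a))%:E)%E).
  by apply: lee_wpmul2l => //; rewrite lee_fin invr_ge0 ltW.
by rewrite -EFinM lee_fin mulrCA mulVf ?gt_eqF// mulr1.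
Qed.

Lemma L2_occ a b (c : R) : a <= b -> L2 mu (fun x => (occ a b x / c)%:C).
Proof.
move=> ab; apply: (@L2_bounded _ _ _ mu (@probability_setT _ _ _ mu) _ ((b - a) / `|c|)).
  by apply: mcf_real; apply: measurable_funM => //; exact: measurable_occ.
move=> x; rewrite normc_real normrM normfV ler_wpM2r ?invr_ge0//.
by rewrite ger0_norm ?occ_ge0// occ_le.
Qed.

Lemma occ_dev eta : 0 < eta -> exists2 d : R, 0 < d & forall a b : R, a <= 0 -> 0 <= b ->
  a < b -> b - a < d ->
  L2norm mu (fun x => (occ a b x / (b - a) - \1_E x)%:C) < eta.
Proof.
move=> eta0.
have [dl d0 hd] := mflow_cont PhiP mE (divr_gt0 (exprn_gt0 2 eta0) (ltr0Sn R 1)).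
exists dl => // a b a0 b0 ab abd.
have h : L2norm mu (fun x => (occ a b x / (b - a) - \1_E x)%:C) ^+ 2 <= eta ^+ 2 / 2.
  apply: occ_average => //; first by rewrite divr_ge0 ?sqr_ge0.
  move=> s as_ sb; apply: hd; rewrite ltr_norml; apply/andP; split; lra.
have e2 : 0 < eta ^+ 2 by exact: exprn_gt0.
have : L2norm mu (fun x => (occ a b x / (b - a) - \1_E x)%:C) ^+ 2 < eta ^+ 2 by lra.
by rewrite ltr_pXn2r// ?nnegrE ?L2norm_ge0// ltW.
Qed.

Lemma L2_occ_dev a b : a <= b -> L2 mu (fun x => (occ a b x / (b - a) - \1_E x)%:C).
Proof.
move=> ab; under eq_fun do rewrite rmorphB; apply: L2B; first exact: L2_occ.
exact: (L2_indic (@probability_setT _ _ _ mu)).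
Qed.

(** Averaging the indicator of [E] along the flow puts it in the domain of the
    generator, since the two ends of the time window are all that moves. *)
Lemma gen_occ (e : R) : 0 < e -> gen mu Phi (fun x => (occ 0 e x / (e - 0))%:C)
  (fun x => 'i * (e^-1)%:C * ((\1_E (Phi e x) : R)%:C - (\1_E x : R)%:C)).
Proof.
move=> e0; have Lind := L2_indic (@probability_setT _ _ _ mu) mE.
have LV : L2 mu (fun x => 'i * (e^-1)%:C * ((\1_E (Phi e x) : R)%:C - (\1_E x : R)%:C)).
  by apply: L2Z; apply: L2B => //; exact: (L2_flow PhiP e Lind).
apply/genP; split=> //; first by apply: L2_occ; exact: ltW.
move=> eta eta0.
have e2 : 0 < eta * e / 2 by rewrite divr_gt0// mulr_gt0.
have [dl d0 hd] := occ_dev e2.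
exists (Num.min dl e); first by rewrite lt_min d0.
move=> t t0; rewrite lt_min => /andP[td te].
pose a := Num.min 0 t; pose b := Num.max 0 t.
have [a0 b0 ab abt] : [/\ a <= 0, 0 <= b, a < b & b - a = `|t|].
  rewrite /a /b; have [tp|tn] := leP 0 t.
    by rewrite ?ger0_norm// subr0 lexx; split=> //; rewrite lt_neqAle eq_sym t0.
  by rewrite ltr0_norm// sub0r lexx; split=> //; exact: ltW.
have hD := hd a b a0 b0 ab (ltac:(by rewrite abt)).
pose Dv x := ((occ a b x / (b - a) - \1_E x)%:C : R[i]).
have LD : L2 mu Dv by apply: L2_occ_dev; exact: ltW.
rewrite (_ : (fun x => _) = (fun x => 'i * (e^-1)%:C * (Dv (Phi e x) - Dv x))); last first.
  apply/funext => x; rewrite /diffq /Dv -!rmorphB.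
  (* the windows at [Phi t x] and at [x] overlap: both sides compare what is gained
     at one end with what is lost at the other *)
  have key : t^-1 * (occ 0 e (Phi t x) / (e - 0) - occ 0 e x / (e - 0)) =
      e^-1 * (occ a b (Phi e x) / (b - a) - occ a b x / (b - a)).
    rewrite subr0 !occ_shift !add0r /a /b; have [tp|tn] := leP 0 t.
      rewrite subr0 (addrC e t) add0r.
      have tp' : 0 < t by rewrite lt_neqAle eq_sym t0.
      have h1 : occ 0 (t + e) x = occ 0 t x + occ t (t + e) x.
        by apply: occ_cat => //; rewrite lerDl ltW.
      have h2 : occ 0 (t + e) x = occ 0 e x + occ e (t + e) x.
        by apply: occ_cat; rewrite ?lerDr// ltW.
      have h : occ t (t + e) x - occ 0 e x = occ e (t + e) x - occ 0 t x.
        by have := etrans (esym h1) h2; lra.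
      by rewrite -!mulrBl h; field; rewrite ?t0 ?lt0r_neq0.
    rewrite !sub0r !add0r (addrC e t).
    have te' : - e < t by move: te; rewrite ltr0_norm//; lra.
    have h1 : occ t e x = occ t 0 x + occ 0 e x.
      by apply: occ_cat; exact: ltW.
    have h2 : occ t e x = occ t (t + e) x + occ (t + e) e x.
      by apply: occ_cat; lra.
    have h : occ t (t + e) x - occ 0 e x = - (occ (t + e) e x - occ t 0 x).
      by have := etrans (esym h1) h2; lra.
    by rewrite -!mulrBl h; field; rewrite ?oppr_eq0 ?t0 ?lt0r_neq0.
  rewrite -2!mulrA -rmorphM key -mulrBr -rmorphM -rmorphB /= -mulrA; congr ('i * _).
  by rewrite -rmorphM; congr (_%:C); ring.
have LDe := L2_flow PhiP e LD.
rewrite L2normZ; last exact: L2B.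
rewrite Normc.normcM normci mul1r normc_real gtr0_norm ?invr_gt0//.
apply: (@le_lt_trans _ _ (e^-1 * (L2norm mu Dv + L2norm mu Dv))).
  rewrite ler_pM2l ?invr_gt0//; apply: le_trans (L2normD LDe (L2N LD)) _.
  by rewrite L2normN (L2norm_comp (mflow_mpres PhiP e) LD).
by rewrite mulrC ltr_pdivrMr//; lra.
Qed.

End Occupation.

(** The functions that can be approximated from the domain form a closed subspace, which
    contains the indicators because their averages along the flow are in the domain. *)
Lemma gen_dense f : L2 mu f -> forall e : R, 0 < e ->
  exists g h, gen mu Phi g h /\ L2norm mu (fun x => f x - g x) < e.
Proof.
have P1 := @probability_setT _ _ _ mu.
pose C := [set f | L2 mu f /\ forall e : R, 0 < e ->
  exists g h, gen mu Phi g h /\ L2norm mu (fun x => f x - g x) < e].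
move=> Lf; suff : C f by case.
apply: (@L2_closed_ind _ _ _ mu C _ _ _ f Lf).
- move=> a {Lf}{}f f' [Lf Cf] [Lf' Cf']; split; first by apply: L2D => //; exact: L2Z.
  move=> e e0; have a1 : 0 < normc a + 1 by rewrite ltr_wpDl ?normc_ge0.
  have e2 : 0 < e / 2 by rewrite divr_gt0.
  have [g [h [G1 N1]]] := Cf _ (divr_gt0 e2 a1).
  have [g' [h' [G2 N2]]] := Cf' _ e2.
  exists (fun x => a * g x + g' x), (fun x => a * h x + h' x); split.
    exact: gen_lin.
  have [Lg _ _] := G1; have [Lg' _ _] := G2.
  rewrite (_ : (fun x => _) = (fun x => a * (f x - g x) + (f' x - g' x))); last first.
    by apply/funext => x; ring.
  apply: le_lt_trans (L2normD (L2Z a (L2B Lf Lg)) (L2B Lf' Lg')) _.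
  rewrite L2normZ; last exact: L2B.
  have : normc a * L2norm mu (fun x => f x - g x) <= e / 2.
    rewrite -[leRHS](divfK (lt0r_neq0 a1)) mulrC.
    by apply: ler_pM; rewrite ?L2norm_ge0 ?normc_ge0 ?lerDl ?ler01// ltW.
  lra.
- move=> E mE; have LE := L2_indic P1 mE; split => // e e0.
  have [dl d0 hd] := occ_dev mE e0.
  have h : 0 < dl / 2 by rewrite divr_gt0.
  exists (fun x => (occ E 0 (dl / 2) x / (dl / 2 - 0))%:C).
  eexists; split; first exact: (gen_occ mE h).
  rewrite L2normBC; under [X in L2norm _ X]eq_fun do rewrite -rmorphB.
  by apply: hd; rewrite ?(ltW h)// subr0; lra.
- move=> u {Lf}{}f Cu Lu Lf uf; split=> // e e0.
  have e2 : 0 < e / 2 by rewrite divr_gt0.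
  have /cvgrPdist_lt/(_ _ e2)[N _ hN] := uf.
  have := hN N (leqnn N); rewrite /= sub0r normrN ger0_norm ?L2norm_ge0// => uN.
  have [g [h [G1 N1]]] := (Cu N).2 _ e2.
  exists g, h; split=> //; have [Lg _ _] := G1.
  apply: le_lt_trans (L2normB_le Lf (Lu N) Lg) _.
  rewrite L2normBC; lra.
Qed.

End Generator_density.

(** * Mixing of weighted translations *)

Lemma cvg_normc0 (R : realType) (u : nat -> R[i]) :
  (fun n => Normc.normc (u n)) @ \oo --> (0 : R) -> u @ \oo --> (0 : R[i]).
Proof.
move=> /cvgrPdist_lt h.
apply: (@cvgr0Pnorm_lt _ (R[i])^o _ _ _ u).2 => e e0.
have eE : e = (complex.Re e)%:C by apply/esym/RRe_real; exact: gtr0_real.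
have re0 : 0 < complex.Re e by move: e0; rewrite eE ltcR.
have := h _ re0; apply: filterS => n.
rewrite sub0r normrN ger0_norm ?normc_ge0// => hn.
have hh : (Normc.normc (u n))%:C < e by rewrite eE ltcR.
exact: hh.
Qed.

Lemma cvg_ext (R : realType) (u v : nat -> R) (l : R) : (forall n, u n = v n) ->
  v @ \oo --> l -> u @ \oo --> l.
Proof. by move=> /funext ->. Qed.

Lemma conj_realR (R : realType) (a : R) : ((a%:C : R[i])^*)%R = a%:C.
Proof. exact: conjc_real. Qed.

Section Log_derivative.
Context {d : measure_display} {T : measurableType d} {R : realType}.
Variables (mu : {measure set T -> \bar R}) (Phi : R -> T -> T).
Hypothesis PhiP : mflow mu Phi.
Local Notation normc := (@Normc.normc R).
Local Notation ld := (log_deriv Phi).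
Implicit Types (C : T -> R[i]) (r : T -> R).

Lemma ld_one : ld (fun=> 1) (fun=> 0).
Proof.
split.
- exact: mcf_cst.
- exact: measurable_cst.
- by move=> x; rewrite Normc.normc1.
- exists 0 => //; split=> [x|x t]; first by rewrite normr0.
  by rewrite subrr Normc.normc0 mul0r.
- move=> x; rewrite (_ : (fun t => _) = fun=> 0); first exact: cvg_cst.
  by apply/funext => t; rewrite subrr !mulr0 mul0r subr0 Normc.normc0.
Qed.

Lemma ld_conj C r : ld C r -> ld (fun x => (C x)^*) (fun x => - r x).
Proof.
move=> [mC mr C1 [K K0 [rK CK]] dC]; split.
- exact: mcf_conj.
- exact: measurable_funN.
- by move=> x; rewrite normc_conj.
- exists K => //; split=> [x|x t]; first by rewrite normrN.
  by rewrite -rmorphB normc_conj.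
- move=> x; have := dC x; apply: cvg_trans; apply: near_eq_cvg; apply: nearW => t.
  rewrite -normc_conj; case: (C _) (C _) => [p q] [p' q']; congr normc.
  by apply: complex_eqP => /=; ring.
Qed.

Lemma ld_comp s C r : ld C r -> ld (fun x => C (Phi s x)) (fun x => r (Phi s x)).
Proof.
have ms := (mflow_mpres PhiP s).1.
move=> [mC mr C1 [K K0 [rK CK]] dC]; split.
- exact: mcf_comp.
- exact: measurableT_comp ms.
- by move=> x.
- by exists K => //; split=> // x t; rewrite (flow_commute PhiP).
- move=> x; have := dC (Phi s x); apply: cvg_trans; apply: near_eq_cvg; apply: nearW => t.
  by rewrite (flow_commute PhiP s t).
Qed.

(** Logarithmic derivatives add; the cross term of the two increments is of second order
    because both factors are Lipschitz along the flow. *)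
Lemma ld_mul C r C' r' : ld C r -> ld C' r' ->
  ld (fun x => C x * C' x) (fun x => r x + r' x).
Proof.
move=> [mC mr C1 [K K0 [rK CK]] dC] [mC' mr' C1' [K' K0' [rK' CK']] dC']; split.
- exact: mcfM.
- exact: measurable_funD.
- by move=> x; rewrite Normc.normcM C1 C1' mulr1.
- exists (K + K'); first exact: addr_ge0.
  split=> [x|x t]; first by apply: le_trans (ler_normD _ _) _; exact: lerD.
  rewrite (_ : _ - _ = (C (Phi t x) - C x) * C' (Phi t x) + C x * (C' (Phi t x) - C' x)); last by ring.
  apply: le_trans (le_normcD _ _) _; rewrite !Normc.normcM C1 C1' mulr1 mul1r mulrDl.
  exact: lerD.
- move=> x; set A := fun t => normc ((t^-1)%:C * (C (Phi t x) - C x) - 'i * (r x)%:C * C x).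
  pose B t := normc ((t^-1)%:C * (C' (Phi t x) - C' x) - 'i * (r' x)%:C * C' x).
  apply/cvg0_dnbhsP => e e0.
  have e3 : 0 < e / 3 by rewrite divr_gt0.
  have KK : 0 < K * K' + 1 by rewrite ltr_wpDl// mulr_ge0.
  have [d1 d10 h1] := (cvg0_dnbhsP _).1 (dC x) _ e3.
  have [d2 d20 h2] := (cvg0_dnbhsP _).1 (dC' x) _ e3.
  exists (Num.min (Num.min d1 d2) (e / 3 / (K * K' + 1))).
    by rewrite !lt_min d10 d20 divr_gt0.
  move=> t t0; rewrite !lt_min => /andP[/andP[/h1-/(_ t0) {}h1 /h2-/(_ t0) {}h2] h3].
  rewrite ger0_norm ?normc_ge0// in h1; rewrite ger0_norm ?normc_ge0// in h2.
  rewrite ger0_norm ?normc_ge0//.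
  rewrite (_ : _ - _ =
    ((t^-1)%:C * (C (Phi t x) - C x) - 'i * (r x)%:C * C x) * C' (Phi t x) +
    ('i * (r x)%:C * C x * (C' (Phi t x) - C' x) +
     C x * ((t^-1)%:C * (C' (Phi t x) - C' x) - 'i * (r' x)%:C * C' x))); last first.
    by rewrite rmorphD /=; ring.
  apply: le_lt_trans (le_normcD _ _) _.
  have k1 : normc ('i * (r x)%:C * C x * (C' (Phi t x) - C' x)) < e / 3.
    apply: (@le_lt_trans _ _ ((K * K' + 1) * `|t|)).
      rewrite !Normc.normcM C1 normci normc_real mul1r mulr1.
      apply: (@le_trans _ _ (K * (K' * `|t|))); first by apply: ler_pM; rewrite ?normc_ge0.
      by rewrite mulrA ler_wpM2r// lerDl.
    by rewrite mulrC -ltr_pdivlMr.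
  have k2 : normc (((t^-1)%:C * (C (Phi t x) - C x) - 'i * (r x)%:C * C x) * C' (Phi t x)) < e / 3.
    by rewrite Normc.normcM C1' mulr1.
  have k3 : normc (C x * ((t^-1)%:C * (C' (Phi t x) - C' x) - 'i * (r' x)%:C * C' x)) < e / 3.
    by rewrite Normc.normcM C1 mul1r.
  have := le_normcD ('i * (r x)%:C * C x * (C' (Phi t x) - C' x))
     (C x * ((t^-1)%:C * (C' (Phi t x) - C' x) - 'i * (r' x)%:C * C' x)).
  lra.
Qed.

Lemma ld_exp C r n : ld C r -> ld (fun x => C x ^+ n) (fun x => n%:R * r x).
Proof.
move=> CP; elim: n => [|n IH].
  have -> : (fun x => C x ^+ 0) = (fun=> 1) by apply/funext => x; rewrite expr0.
  have -> : (fun x => 0%:R * r x) = (fun=> 0) by apply/funext => x; rewrite mul0r.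
  exact: ld_one.
have -> : (fun x => C x ^+ n.+1) = (fun x => C x * C x ^+ n).
  by apply/funext => x; rewrite exprS.
have -> : (fun x => n.+1%:R * r x) = (fun x => r x + n%:R * r x).
  by apply/funext => x; rewrite -natr1; ring.
exact: ld_mul.
Qed.

Definition cocycle C (N : nat) (x : T) : R[i] := \prod_(m < N) C (Phi m%:R x).
Definition birkhoff r (N : nat) (x : T) : R := \sum_(m < N) r (Phi m%:R x).

Lemma ld_cocycle C r N : ld C r -> ld (cocycle C N) (birkhoff r N).
Proof.
move=> CP; elim: N => [|N IH].
  have -> : cocycle C 0 = (fun=> 1) by apply/funext => x; rewrite /cocycle big_ord0.
  have -> : birkhoff r 0 = (fun=> 0) by apply/funext => x; rewrite /birkhoff big_ord0.
  exact: ld_one.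
have -> : cocycle C N.+1 = (fun x => cocycle C N x * C (Phi N%:R x)).
  by apply/funext => x; rewrite /cocycle big_ord_recr.
have -> : birkhoff r N.+1 = (fun x => birkhoff r N x + r (Phi N%:R x)).
  by apply/funext => x; rewrite /birkhoff big_ord_recr.
by apply: ld_mul => //; exact: ld_comp.
Qed.

Lemma cocycle_iter C f N :
  iter N (fun h x => C x * h (Phi 1 x)) f = (fun x => cocycle C N x * f (Phi N%:R x)).
Proof.
elim: N => [|N IH]; first by apply/funext => x; rewrite /cocycle big_ord0 mul1r /= (mflow0 PhiP).
apply/funext => x; rewrite iterS IH /cocycle big_ord_recl mulrA; congr (_ * _ * _).
- by rewrite (mflow0 PhiP).
- by apply: eq_bigr => i _; rewrite -(mflowD PhiP) natr1.
- by rewrite -(mflowD PhiP) natr1.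
Qed.

Lemma normc_cocycle C r N x : ld C r -> normc (cocycle C N x) = 1.
Proof. by move=> /(ld_cocycle N)/ld_normC. Qed.

End Log_derivative.

Section Mixing.
Context {d : measure_display} {T : measurableType d} {R : realType}.
Variables (mu : probability T R) (Phi : R -> T -> T).
Hypothesis PhiP : mflow mu Phi.
Local Notation normc := (@Normc.normc R).
Variables (C : T -> R[i]) (r : T -> R) (kappa : R).
Hypothesis CP : log_deriv Phi C r.
Hypothesis kappa0 : kappa != 0.
Hypothesis r_avg : {ae mu, forall x,
  (fun N => birkhoff Phi r N x / N%:R) @ \oo --> kappa}.

Local Notation V := (fun N g x => cocycle Phi C N x * g (Phi N%:R x)).

Lemma L2_weighted N g : L2 mu g -> L2 mu (V N g).
Proof.
move=> Lg; have CN := ld_cocycle PhiP N CP.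
apply: (@L2M _ _ _ mu _ _ 1); first exact: ld_mC CN.
  by move=> x; rewrite (ld_normC CN).
exact: (L2_flow PhiP).
Qed.

Lemma L2norm_weighted N g : L2 mu g -> L2norm mu (V N g) = L2norm mu g.
Proof.
move=> Lg; rewrite -[RHS](L2norm_comp (mflow_mpres PhiP N%:R) Lg).
congr Num.sqrt; apply: eq_Rintegral => x _.
by rewrite Normc.normcM (normc_cocycle PhiP _ _ CP) mul1r.
Qed.

Lemma birkhoff_bound K N x : (forall y, `|r y| <= K) -> `|birkhoff Phi r N x| <= N%:R * K.
Proof.
move=> rK; apply: le_trans (ler_norm_sum _ _ _) _.
apply: le_trans (ler_sum _ (fun i _ => rK _)) _.
by rewrite sumr_const card_ord mulr_natl.
Qed.

Lemma mcf_birkhoff N : measurable_fun [set: T] (birkhoff Phi r N).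
Proof. exact: ld_mrho (ld_cocycle PhiP N CP). Qed.

(** Birkhoff averages converge only almost everywhere, but they are uniformly bounded, so
    that multiplication by them converges strongly. *)
Lemma birkhoff_L2cvg f : L2 mu f ->
  L2cvg mu (fun N x => (birkhoff Phi r N x / N%:R)%:C * f x) (fun x => kappa%:C * f x).
Proof.
move=> Lf; have [K K0 [rK _]] := ld_bound CP.
have mB N : measurable_cfun (fun x => (birkhoff Phi r N x / N%:R)%:C : R[i]).
  by apply: mcf_real; apply: measurable_funM => //; exact: mcf_birkhoff.
apply: (@L2cvg_dom _ _ _ mu _ _ (fun x => (K + `|kappa|)%:C * f x)).
- by move=> N; apply: mcfM => //; exact: Lf.1.
- by apply: mcfZ; exact: Lf.1.
- exact: L2Z.
- move=> N x; rewrite !Normc.normcM ler_wpM2r ?normc_ge0// !normc_real.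
  rewrite [leRHS]ger0_norm ?addr_ge0//; apply: (@le_trans _ _ K); last by rewrite lerDl.
  case: N => [|N]; first by rewrite invr0 mulr0 normr0.
  rewrite normrM normfV [`|N.+1%:R|]ger0_norm// ler_pdivrMr// mulrC.
  exact: birkhoff_bound.
- apply: filterS r_avg => x h; apply: (@cvg_ext _ _
      (fun N => `|birkhoff Phi r N x / N%:R - kappa| * normc (f x))).
    by move=> N; rewrite -mulrBl Normc.normcM -rmorphB normc_real.
  move/subr_cvg0: h => /cvg_norm; rewrite normr0 => h.
  by have h2 := cvgM h (@cvg_cst _ (normc (f x)) _ \oo _); rewrite mul0r in h2; exact: h2.
- move=> x; rewrite !Normc.normcM ler_wpM2r ?normc_ge0// !normc_real.
  by rewrite [leRHS]ger0_norm ?addr_ge0// lerDr.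
Qed.

(** On the domain of the generator [A], symmetry of [A] shows that the matrix coefficients
    of the commutator of [A] with [V^N] stay bounded in [N]. By the Leibniz rule this
    commutator is, up to sign, the Birkhoff sum of [r] after [V^N]; as this sum grows like
    [N kappa], the coefficients of [V^N] are bounded by a constant over [N], plus the mean
    square error of the Birkhoff averages. *)
Lemma mixing_gen f h g g' : gen mu Phi f h -> gen mu Phi g g' ->
  (fun N => normc (ip mu f (V N g))) @ \oo --> (0 : R).
Proof.
move=> Gf Gg; have [Lf Lh _] := Gf; have [Lg Lg' _] := Gg.
pose b := L2norm mu h * L2norm mu g + L2norm mu f * L2norm mu g'.
have b0 : 0 <= b by rewrite addr_ge0// mulr_ge0 ?L2norm_ge0.
pose err N := L2norm mu (fun x => (birkhoff Phi r N x / N%:R)%:C * f x - kappa%:C * f x).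
have bound N : normc (ip mu f (V N.+1 g)) <=
    `|kappa|^-1 * (N.+1%:R^-1 * b + err N.+1 * L2norm mu g).
  set M := N.+1; have CM := ld_cocycle PhiP M CP.
  have LV := L2_weighted M Lg; have LV' := L2_weighted M Lg'.
  pose RV x := (birkhoff Phi r M x)%:C * V M g x.
  have [K K0 [rK _]] := ld_bound CP.
  have bK x : normc (birkhoff Phi r M x)%:C <= M%:R * K.
    by rewrite normc_real birkhoff_bound.
  have mB : measurable_cfun (fun x => (birkhoff Phi r M x)%:C : R[i]).
    by apply: mcf_real; exact: mcf_birkhoff.
  have LRV : L2 mu RV by exact: L2M mB bK LV.
  have comm : ip mu f RV = ip mu f (V M g') - ip mu h (V M g).
    have := gen_sym PhiP Gf (gen_weighted PhiP M%:R CM Gg).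
    by rewrite ipBr// => ->; rewrite subKr.
  have LBf : L2 mu (fun x => (birkhoff Phi r M x)%:C * f x) by exact: L2M mB bK Lf.
  have mv : ip mu f RV = ip mu (fun x => (birkhoff Phi r M x)%:C * f x) (V M g).
    by congr cintegral; apply/funext => x; rewrite /RV rmorphM /= conj_realR mulrCA mulrA.
  have M0 : (M%:R : R) != 0 by rewrite pnatr_eq0.
  pose Bf x := (birkhoff Phi r M x / M%:R)%:C * f x.
  have BfE : Bf = (fun x => (M%:R^-1)%:C * ((birkhoff Phi r M x)%:C * f x)).
    by apply/funext => x; rewrite /Bf rmorphM /= mulrAC mulrC.
  have LBf' : L2 mu Bf by rewrite BfE; exact: L2Z.
  have e1 : kappa%:C * ip mu f (V M g) =
      (M%:R^-1)%:C * ip mu f RV - ip mu (fun x => Bf x - kappa%:C * f x) (V M g).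
    rewrite ipBl//; last exact: L2Z.
    have e0 : ip mu Bf (V M g) = (M%:R^-1)%:C * ip mu f RV by rewrite BfE ipZl// mv.
    by rewrite ipZl// e0; ring.
  have k0 : 0 < `|kappa| by rewrite normr_gt0.
  rewrite -(ler_pM2l k0) mulrA divff ?gt_eqF// mul1r.
  rewrite -[`|kappa|]normc_real -Normc.normcM e1.
  apply: le_trans (le_normcD _ _) _; rewrite normcN; apply: lerD.
    rewrite Normc.normcM normc_real ger0_norm// ler_pM2l ?invr_gt0// comm.
    apply: le_trans (le_normcD _ _) _; rewrite normcN addrC; apply: lerD.
      by apply: le_trans (cauchy_schwarz Lh LV) _; rewrite L2norm_weighted.
    by apply: le_trans (cauchy_schwarz Lf LV') _; rewrite L2norm_weighted.
  apply: le_trans (cauchy_schwarz (L2B LBf' (L2Z _ Lf)) LV) _.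
  by rewrite L2norm_weighted.
have errc := birkhoff_L2cvg Lf.
rewrite -cvg_shiftS /=.
apply: (@squeeze_cvgr _ _ _ _ (fun=> 0)
  (fun N => `|kappa|^-1 * (N.+1%:R^-1 * b + err N.+1 * L2norm mu g))).
- by apply: nearW => N; rewrite normc_ge0 bound.
- exact: cvg_cst.
rewrite -[X in _ --> X](mulr0 `|kappa|^-1); apply: cvgM; first exact: cvg_cst.
rewrite -[X in _ --> X](addr0 0); apply: cvgD.
  by rewrite -[X in _ --> X](mul0r b); apply: cvgM; [exact: cvg_harmonic|exact: cvg_cst].
rewrite -[X in _ --> X](mul0r (L2norm mu g)); apply: cvgM; last exact: cvg_cst.
by rewrite (cvg_shiftS err).
Qed.

(** The powers of [V] are isometries, so the decay on the dense domain of the generator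
    extends to all square-integrable functions. *)
Theorem mixing_weighted f g : L2 mu f -> L2 mu g ->
  (fun N => normc (ip mu f (V N g))) @ \oo --> (0 : R).
Proof.
move=> Lf Lg; apply/cvgrPdist_lt => e e0.
pose M := L2norm mu f + L2norm mu g + 1.
have nf := L2norm_ge0 mu f; have ng := L2norm_ge0 mu g.
have M0 : 0 < M by rewrite /M; lra.
pose dl := Num.min 1 (e / 3 / M).
have dl0 : 0 < dl by rewrite lt_min ltr01 divr_gt0// divr_gt0.
have [f' [h [Gf Nf]]] := gen_dense PhiP Lf dl0.
have [g' [h' [Gg Ng]]] := gen_dense PhiP Lg dl0.
have [Lf' _ _] := Gf; have [Lg' _ _] := Gg.
have e3 : 0 < e / 3 by rewrite divr_gt0.
have /cvgrPdist_lt/(_ _ e3) := mixing_gen Gf Gg.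
apply: filterS => N; rewrite !sub0r !normrN !(ger0_norm (normc_ge0 _)) => hN.
have LV := L2_weighted N Lg; have LV' := L2_weighted N Lg'.
have dlM : dl * M <= e / 3.
  have : dl <= e / 3 / M by rewrite ge_min lexx orbT.
  by rewrite ler_pdivlMr.
have dl1 : dl <= 1 by rewrite ge_min lexx.
have Ng'M : L2norm mu f' <= L2norm mu f + 1.
  have -> : f' = (fun x => f x - (f x - f' x)) by apply/funext => x; rewrite subKr.
  apply: le_trans (L2normD Lf (L2N (L2B Lf Lf'))) _; rewrite L2normN; lra.
have [gg ggE] : exists gg : T -> R[i], gg = (fun x => g x - g' x) by eexists.
rewrite -ggE in Ng *; have Lgg : L2 mu gg by rewrite ggE; exact: L2B.
have -> : ip mu f (V N g) = ip mu (fun x => f x - f' x) (V N g) +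
    (ip mu f' (V N gg) + ip mu f' (V N g')).
  rewrite ipBl//.
  have -> : V N gg = (fun x => V N g x - V N g' x).
    by apply/funext => x; rewrite ggE mulrBr.
  by rewrite ipBr//; ring.
have c1 := cauchy_schwarz (L2B Lf Lf') LV.
have LVgg := L2_weighted N Lgg.
have c2 := cauchy_schwarz Lf' LVgg.
rewrite L2norm_weighted// in c1; rewrite L2norm_weighted// in c2.
have b1 : L2norm mu (fun x => f x - f' x) * L2norm mu g <= dl * L2norm mu g.
  by rewrite ler_wpM2r// ltW.
have b2 : L2norm mu f' * L2norm mu gg <= (L2norm mu f + 1) * dl.
  by apply: ler_pM; rewrite ?L2norm_ge0// ltW.
apply: le_lt_trans (le_normcD _ _) _; apply: le_lt_trans (lerD c1 (le_normcD _ _)) _.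
have : dl * L2norm mu g + (L2norm mu f + 1) * dl <= e / 3.
  by apply: le_trans dlM; rewrite /M; lra.
lra.
Qed.

End Mixing.

(** * Birkhoff averages and unique ergodicity *)

Section Ergodic_theorem.
Context {d : measure_display} {T : measurableType d} {R : realType}.
Variables (mu : probability T R) (tau : T -> T).
Hypothesis tauP : mpres mu tau.
Implicit Types f : T -> R.

Definition esum f (N : nat) (x : T) : R := \sum_(m < N) f (iter m tau x).

Lemma esumS f N x : esum f N.+1 x = f x + esum f N (tau x).
Proof.
rewrite /esum big_ord_recl; congr (_ + _); apply: eq_bigr => i _.
by rewrite -iterSr.
Qed.

Lemma measurable_iter n : measurable_fun [set: T] (iter n tau).
Proof.
elim: n => [|n IH]; first exact: measurable_id.
exact: (measurableT_comp tauP.1 IH).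
Qed.

Lemma measurable_esum f N : measurable_fun [set: T] f -> measurable_fun [set: T] (esum f N).
Proof.
move=> mf; rewrite /esum; apply: measurable_sum => i.
by apply: measurableT_comp => //; exact: measurable_iter.
Qed.

Lemma bounded_rint f (K : R) : measurable_fun [set: T] f -> (forall x, `|f x| <= K) ->
  mu.-integrable [set: T] (fun x => (f x)%:E).
Proof.
move=> mf fK; apply: (rint_le mf (G := fun=> K)) => //.
exact: finite_measure_integrable_cst.
Qed.

(** The maximum of 0 and of the first [N] partial sums, by the recursion on which Garsia's
    argument rests. *)
Fixpoint emax f (N : nat) (x : T) : R :=
  if N is N'.+1 then Num.max 0 (f x + emax f N' (tau x)) else 0.

Lemma emax_ge0 f N x : 0 <= emax f N x.
Proof. by case: N => //= N; rewrite le_max lexx. Qed.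

Lemma emax_mono f N x : emax f N x <= emax f N.+1 x.
Proof.
elim: N x => [|N IH] x; first exact: emax_ge0.
rewrite /= ge_max; apply/andP; split; first by rewrite le_max lexx.
by rewrite le_max; apply/orP; right; rewrite lerD2l; exact: IH.
Qed.

Lemma esum_le_emax f N n x : (n <= N)%N -> esum f n x <= emax f N x.
Proof.
elim: N n x => [|N IH] [|n] x //; rewrite ?leqn0 //.
- by move=> _; rewrite /esum big_ord0.
- by move=> _; rewrite /esum big_ord0 emax_ge0.
- rewrite ltnS => nN; rewrite esumS /= le_max; apply/orP; right.
  by rewrite lerD2l; exact: IH.
Qed.

Lemma measurable_emax f N : measurable_fun [set: T] f -> measurable_fun [set: T] (emax f N).
Proof.
move=> mf; elim: N => [|N IH]; first exact: measurable_cst.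
apply: measurable_maxr; first exact: measurable_cst.
by apply: measurable_funD => //; exact: (measurableT_comp IH tauP.1).
Qed.

Lemma emax_bound f (K : R) N x : (forall x, `|f x| <= K) -> `|emax f N x| <= N%:R * K.
Proof.
move=> fK; have K0 : 0 <= K by exact: le_trans (normr_ge0 _) (fK point).
rewrite ger0_norm ?emax_ge0//; elim: N x => [|N IH] x; first by rewrite mul0r.
rewrite /= ge_max mulr_ge0//= -natr1 mulrDl mul1r addrC lerD//.
exact: le_trans (ler_norm _) (fK x).
Qed.

(** Garsia's argument: where [emax f N] is positive, [f] is at least
    [emax f N - emax f N o tau], and this difference has integral 0. *)
Lemma maximal_ergodic f (K : R) N : measurable_fun [set: T] f -> (forall x, `|f x| <= K) ->
  0 <= \int[mu]_x (f x * \1_[set x | 0 < emax f N x] x).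
Proof.
move=> mf fK.
have mM := measurable_emax N mf.
have mP : measurable [set x | 0 < emax f N x].
  by have := mM measurableT _ (measurable_itv `]0, +oo[%R); rewrite setTI;
    congr measurable; apply/seteqP; split => x /=; rewrite in_itv/= andbT.
have iM : mu.-integrable [set: T] (fun x => (emax f N x)%:E).
  by apply: (@bounded_rint _ (N%:R * K)) => // x; exact: emax_bound.
have iMt := mpres_rint tauP iM.
have iG : mu.-integrable [set: T] (fun x => (f x * \1_[set x | 0 < emax f N x] x)%:E).
  apply: (@bounded_rint _ K).
    by apply: measurable_funM => //; exact: measurable_indic.
  move=> x; rewrite normrM indicE; apply: le_trans (fK x).
  by rewrite ler_piMr//; case: (_ \in _); rewrite ?normr1 ?normr0.
have e0 : \int[mu]_x (emax f N x - emax f N (tau x)) = 0.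
  by rewrite RintegralB// (mpres_Rintegral tauP iM) subrr.
rewrite -[leLHS]e0; apply: le_Rintegral => //.
  exact: rintB iM iMt.
move=> x _; rewrite indicE; have [M0|M0] := ltP 0 (emax f N x); last first.
  have -> : emax f N x = 0 by apply/eqP; rewrite eq_le M0 emax_ge0.
  rewrite memNset ?mulr0 ?sub0r ?oppr_le0 ?emax_ge0//=.
  by apply/negP; rewrite -leNgt.
rewrite mem_set// mulr1 lerBlDr; case: N M0 {mM mP iM iMt iG e0} => [|N]; first by rewrite /= ltxx.
rewrite /= lt_max ltxx /= => y0.
by rewrite [leLHS]max_r ?(ltW y0)// lerD2l; exact: (emax_mono f N (tau x)).
Qed.

(** The sets where [emax f N] is positive increase to a set of full measure, so dominated
    convergence applies to the maximal inequality. *)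
Lemma positive_sums_integral f (K : R) : measurable_fun [set: T] f -> (forall x, `|f x| <= K) ->
  {ae mu, forall x, exists n, 0 < esum f n x} -> 0 <= \int[mu]_x f x.
Proof.
move=> mf fK pos.
pose u N x : \bar R := (f x * \1_[set x | 0 < emax f N x] x)%:E.
have mP N : measurable [set x | 0 < emax f N x].
  by have := measurable_emax N mf measurableT (measurable_itv `]0, +oo[%R); rewrite setTI;
    congr measurable; apply/seteqP; split => x /=; rewrite in_itv/= andbT.
have [|||||_ _ c] := @dominated_convergence _ _ _ mu setT measurableT u (fun x => (f x)%:E) (fun=> K%:E).
- move=> N; apply/measurable_EFinP; apply: measurable_funM => //; exact: measurable_indic.
- exact/measurable_EFinP.
- apply: filterS pos => x [n hn] _.
  apply: cvg_near_cst; exists n => // N /= nN.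
  by rewrite /u indicE mem_set ?mulr1//=; apply: lt_le_trans hn (esum_le_emax _ _ nN).
- exact: finite_measure_integrable_cst.
- apply: aeW => x N _; rewrite /u /= lee_fin normrM indicE; apply: le_trans (fK x).
  by rewrite ler_piMr//; case: (_ \in _); rewrite ?normr1 ?normr0.
have iF := bounded_rint mf fK.
have c' : (fun N => \int[mu]_x (f x * \1_[set x | 0 < emax f N x] x)) @ \oo --> \int[mu]_x f x.
  apply: fine_cvg; rewrite fineK//; first exact: integrable_fin_num.
rewrite -(cvg_lim _ c')//; apply: limr_ge; first by apply/cvg_ex; eexists; exact: c'.
by apply: nearW => N; exact: maximal_ergodic mf fK.
Qed.

Hypothesis ergodic : forall E, measurable E -> tau @^-1` E = E -> mu E = 0%E \/ mu E = 1%E.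

(** The set of points with unbounded sums is invariant, hence null or full. It cannot be
    full: every point in it has a positive partial sum, so that [f] would have nonnegative
    integral. *)
Lemma bounded_above_sums f (K : R) : measurable_fun [set: T] f -> (forall x, `|f x| <= K) ->
  \int[mu]_x f x < 0 -> {ae mu, forall x, exists B, forall N, esum f N x <= B}.
Proof.
move=> mf fK f0.
pose E := [set x | forall k : nat, exists N, k%:R < esum f N x].
have EE : E = \bigcap_(k in [set: nat]) \bigcup_(N in [set: nat]) [set x | k%:R < esum f N x].
  apply/seteqP; split => x /=.
    by move=> h k _; have [N hN] := h k; exists N.
  by move=> h k; have [N _ hN] := h k I; exists N.
have mE : measurable E.
  rewrite EE; apply: bigcapT_measurable => k; apply: bigcupT_measurable => N.
  have := measurable_esum N mf measurableT (measurable_itv `]k%:R, +oo[%R); rewrite setTI.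
  by congr measurable; apply/seteqP; split => x /=; rewrite in_itv/= andbT.
have K0 : 0 <= K by exact: le_trans (normr_ge0 _) (fK point).
have big k : exists k' : nat, k%:R + K <= k'%:R :> R.
  exists (k + Num.truncn K).+1; rewrite -addnS natrD lerD2l.
  exact/ltW/truncnS_gt.
have inv : tau @^-1` E = E.
  apply/seteqP; split => x /= h k.
    have [k' hk'] := big k; have [N hN] := h k'; exists N.+1.
    by rewrite esumS; have := fK x; rewrite ler_norml => /andP[h1 _]; lra.
  have [k' hk'] := big k; have [[|N] hN] := h k'.
    by move: hN; rewrite /esum big_ord0; have : 0 <= k'%:R :> R by []; lra.
  exists N; move: hN; rewrite esumS.
  by have := fK x; rewrite ler_norml => /andP[_ h1]; lra.
have [E0|E1] := ergodic mE inv.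
  exists E; split => // x /= h k; apply: contrapT => nk; apply: h; exists k%:R => N.
  by rewrite leNgt; apply/negP => hN; apply: nk; exists N.
exfalso; suff : 0 <= \int[mu]_x f x by lra.
apply: (positive_sums_integral mf fK); exists (~` E); split.
- exact: measurableC.
- by have := probability_setC mu mE; rewrite E1 subee.
- by move=> x /= h hE; apply: h; have [N hN] := hE 0%N; exists N.
Qed.

(** [S] stands for a Birkhoff sum over [M] steps, [h] for the shift by [M / j.+1] below. *)
Lemma average_close (S c e M b1 b2 h : R) : 0 < M ->
  -1 * (S - M * c) - h <= b2 -> S - M * c - h <= b1 ->
  h <= M * (e / 2) -> b1 <= M * (e / 2) -> b2 <= M * (e / 2) -> `|c - S / M| <= e.
Proof.
move=> M0 k2 k1 hM b1M b2M; rewrite distrC ler_distl; apply/andP; split.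
  by rewrite ler_pdivlMr//; lra.
by rewrite ler_pdivrMr//; lra.
Qed.

(** With [c] the integral of [f], the functions [f - c - 1/j] and [c - f - 1/j] have negative
    integral, so their sums are bounded above: after division by [N], the Birkhoff averages
    of [f] are eventually within [2/j] of [c]. *)
Theorem birkhoff_ergodic f (K : R) : measurable_fun [set: T] f -> (forall x, `|f x| <= K) ->
  {ae mu, forall x, (fun N => esum f N x / N%:R) @ \oo --> \int[mu]_x f x}.
Proof.
move=> mf fK; set c := \int[mu]_x f x.
have iF := bounded_rint mf fK.
pose g (s : bool) (j : nat) x := (-1) ^+ s * (f x - c) - j.+1%:R^-1.
have gE s j N x : esum (g s j) N x = (-1) ^+ s * (esum f N x - N%:R * c) - N%:R * j.+1%:R^-1.
  elim: N x => [|N IH] x; first by rewrite /esum !big_ord0; ring.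
  by rewrite !esumS IH /g -natr1; ring.
have bnd s j : {ae mu, forall x, exists B, forall N, esum (g s j) N x <= B}.
  have mg : measurable_fun [set: T] (g s j).
    by apply: measurable_funB => //; apply: measurable_funM => //; exact: measurable_funB.
  apply: (@bounded_above_sums _ (K + `|c| + 1)) => // [x|].
    rewrite /g; apply: le_trans (ler_normB _ _) _; rewrite normrM normrX normrN1 expr1n mul1r.
    apply: lerD; first by apply: le_trans (ler_normB _ _) _; rewrite lerD2r.
    by rewrite ger0_norm ?invr_ge0// invf_le1// ler1n.
  have icst (a : R) : mu.-integrable [set: T] (fun=> a%:E) by exact: finite_measure_integrable_cst.
  have iFc : mu.-integrable [set: T] (fun x => (f x - c)%:E).
    exact: rintB.
  have i1 := rintZ ((-1) ^+ s) iFc.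
  rewrite /g RintegralB//; last exact: icst.
  have cstE (a : R) : \int[mu]_x a = a.
    rewrite Rintegral_cst// -[RHS]mulr1; congr (_ * _).
    by rewrite -[RHS]/(fine 1%E); congr fine; exact: probability_setT.
  have e1 : \int[mu]_x (f x - c) = 0.
    by rewrite RintegralB//; [rewrite cstE subrr|exact: icst].
  rewrite RintegralZl// e1 cstE.
  by rewrite mulr0 sub0r oppr_lt0 invr_gt0.
have := ae_foralln (bnd true); have := ae_foralln (bnd false).
apply: filterS2 => x hf ht.
suff lim (e : R) : 0 < e -> \forall N \near \oo, `|c - esum f N x / N%:R| <= e.
  by apply/cvgrPdist_le.
move=> e0.
have [j hj] : exists j : nat, j.+1%:R^-1 <= e / 2.
  exists (Num.truncn (2 / e)); rewrite -[leRHS]invrK lef_pV2 ?posrE// ?invr_gt0 ?divr_gt0//.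
  by rewrite invf_div; exact/ltW/truncnS_gt.
have [B1 h1] := hf j; have [B2 h2] := ht j.
pose B := `|B1| + `|B2|.
near=> N.
have N0 : 0 < N%:R :> R by rewrite ltr0n; near: N; exact: nbhs_infty_gt.
have NB : B * 2 / e <= N%:R by near: N; exact: nbhs_infty_ger.
have BN : B <= N%:R * (e / 2) by rewrite -ler_pdivrMr ?divr_gt0// invf_div mulrA.
have := h1 N; have := h2 N; rewrite /= !gE expr0 expr1 mul1r.
have jN : N%:R * j.+1%:R^-1 <= N%:R * (e / 2) by rewrite ler_pM2l.
have B1' : B1 <= B by rewrite /B; have := ler_norm B1; have := normr_ge0 B2; lra.
have B2' : B2 <= B by rewrite /B; have := ler_norm B2; have := normr_ge0 B1; lra.
move=> k2 k1; apply: (average_close N0 k2 k1 jN); first exact: le_trans B1' BN.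
exact: le_trans B2' BN.
Unshelve. all: by end_near.
Qed.

End Ergodic_theorem.

(** Conditioning on an invariant set of positive measure produces another
    invariant probability, so unique ergodicity implies ergodicity. *)
Lemma uniquely_ergodic_ergodic (R : realType) (X : ptopologicalType) (f : X -> X)
    (m : probability (borel X) R) :
  measurable_fun [set: borel X] (f : borel X -> borel X) -> uniquely_ergodic f m ->
  forall E : set (borel X), measurable E -> f @^-1` E = E -> m E = 0%E \/ m E = 1%E.
Proof.
move=> mf [pm um] E mE fE.
have [->|mE0] := eqVneq (m E) 0%E; [by left|right].
pose mE' := mrestr m mE.
pose m' : probability (borel X) R := mnormalize mE' m.
have mEfin : m E != +oo%E by rewrite lt_eqF// (le_lt_trans (probability_le1 _ _))// ltry.
have m'E A : m' A = (m (A `&` E) * (fine (m E))^-1%:E)%E.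
  rewrite (_ : m' A = (let evidence := m ([set: borel X] `&` E) in
    if (evidence == 0) || (evidence == +oo) then fun U => m U
    else fun U => m (U `&` E) * (fine evidence)^-1%:E) A)%E//.
  by rewrite setTI /= (negbTE mE0) (negbTE mEfin).
have pm' : preserves f m'.
  move=> A mA; rewrite !m'E -(pm (A `&` E)); last exact: measurableI.
  by rewrite preimage_setI fE.
have := um m' pm' E mE; rewrite m'E setIid => <-.
have fin : m E \is a fin_num by rewrite fin_num_measure.
by rewrite -{1}(fineK fin) -EFinM divff// fine_eq0.
Qed.

(** * Measurability and continuity in measure of flows *)

Lemma bigcup_countable_measurable d (T : measurableType d) (I : Type) (B : set I)
    (F : I -> set T) : countable B -> (forall i, B i -> measurable (F i)) ->
  measurable (\bigcup_(i in B) F i).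
Proof.
move=> /countable_injP[f finj] mF.
have -> : \bigcup_(i in B) F i =
    \bigcup_(k in [set: nat]) \bigcup_(i in [set i | B i /\ f i = k]) F i.
  apply/seteqP; split => x /=.
    by move=> [i Bi Fi]; exists (f i) => //; exists i.
  by move=> [k _ [i [Bi _] Fi]]; exists i.
apply: bigcupT_measurable => k.
have [[i [Bi fi]]|nk] := pselect (exists i, B i /\ f i = k).
  rewrite (_ : \bigcup_(_ in _) _ = F i); first exact: mF.
  apply/seteqP; split => x /=; last by move=> Fi; exists i.
  by move=> [j [Bj fj] Fj]; rewrite (finj i j) ?inE// fi fj.
rewrite (_ : \bigcup_(_ in _) _ = set0) //.
by apply/seteqP; split => x //= [i [Bi fi] _]; apply: nk; exists i.
Qed.

Section Borel_maps.
Variable R : realType.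

Lemma continuous_borel (X Y : ptopologicalType) (f : X -> Y) : continuous f ->
  measurable_fun [set: borel X] (f : borel X -> borel Y).
Proof.
move=> cf; refine (@measurability _ _ (borel X) (borel Y) setT f (@open Y) erefl _).
move=> _ [V oV <-]; rewrite setTI; apply: sub_sigma_algebra.
by move/continuousP : cf; exact.
Qed.

Lemma continuous_borel_real (X : ptopologicalType) (f : X -> R) : continuous f ->
  measurable_fun [set: borel X] (f : borel X -> R).
Proof.
move=> cf; refine (@measurability _ _ (borel X) (measurableTypeR R) setT f _ (RGenOpens.measurableE R) _).
move=> _ [_ [a [b ->]] <-]; rewrite setTI; apply: sub_sigma_algebra.
by move/continuousP : cf; apply; exact: interval_open.
Qed.

(** Open sets of the product are countable unions of rectangles, with rational time
    intervals and sets of a countable base as sides. *)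
Lemma continuous_joint_measurable (X : ptopologicalType) (F : R -> X -> X) :
  @second_countable X -> continuous (fun p : R * X => F p.1 p.2) ->
  measurable_fun [set: measurableTypeR R * borel X]
    (fun p : measurableTypeR R * borel X => F p.1 p.2 : borel X).
Proof.
move=> [B cB [oB bB]] cF; refine (@measurability _ _ (measurableTypeR R * borel X)%type (borel X) setT
  (fun p => F p.1 p.2) (@open X) erefl _).
move=> _ [V oV <-]; rewrite setTI.
set W : set (measurableTypeR R * borel X) := _ @^-1` V.
pose rect (q : rat * rat) (U : set X) : set (measurableTypeR R * borel X) :=
  `]ratr q.1, ratr q.2[%classic `*` U.
have mrect q U : B U -> measurable (rect q U).
  by move=> BU; apply: measurableX => //; apply: sub_sigma_algebra; exact: oB.
have -> : W = \bigcup_(q in [set: rat * rat])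
    \bigcup_(U in [set U | B U /\ rect q U `<=` W]) rect q U.
  apply/seteqP; split => [[t x] Wtx|p]; last by move=> [q _ [U [_ UW] /UW]].
  have : nbhs ((t, x) : R * X) W.
    by apply: open_nbhs_nbhs; split=> //; move/continuousP : cF; exact.
  move=> [[A1 A2] /= [n1 n2] sub].
  have /nbhs_ballP[e /= e0 be] := n1.
  have [U [BU Ux] UA2] := bB x A2 n2.
  have [q1 hq1] := @rat_in_itvoo R (t - e) t (ltac:(by rewrite ltrBlDr ltrDl)).
  have [q2 hq2] := @rat_in_itvoo R t (t + e) (ltac:(by rewrite ltrDl)).
  exists (q1, q2) => //; exists U.
    split=> // -[s y] /= [hs Uy]; apply: (sub (s, y)); split=> /=; last exact: UA2.
    apply: be; rewrite /ball /=; move: hq1 hq2 hs; rewrite !in_itv/=.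
    move=> /andP[a1 a2] /andP[a3 a4] /andP[]; rewrite !bnd_simp => a5 a6.
    have close (t' s' p1 p2 : R) : t' - e < p1 -> p2 < t' + e -> p1 < s' -> s' < p2 ->
      `|t' - s'| < e by move=> *; rewrite ltr_norml; apply/andP; split; lra.
    exact: (close t s _ _ a1 a4 a5 a6).
  split => //=; rewrite in_itv/=; move: hq1 hq2; rewrite !in_itv/=.
  by move=> /andP[_ ->] /andP[->].
apply: countable_bigcupT_measurable => // q.
apply: bigcup_countable_measurable; last by move=> U [BU _]; exact: mrect.
by apply: sub_countable cB; apply: subset_card_le => U [].
Qed.

Lemma continuous_time_map (X : ptopologicalType) (F : R -> X -> X) :
  continuous (fun p : R * X => F p.1 p.2) -> forall t, continuous (F t).
Proof.
move=> cF t x V /(cF (t, x))[[A1 A2] /= [n1 n2] sub]; apply: filterS n2 => y A2y.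
exact: (sub (t, y) (conj (nbhs_singleton n1) A2y)).
Qed.

Lemma continuous_orbit_map (X : ptopologicalType) (F : R -> X -> X) :
  continuous (fun p : R * X => F p.1 p.2) -> forall x, continuous (F ^~ x).
Proof.
move=> cF x t V /(cF (t, x))[[A1 A2] /= [n1 n2] sub]; apply: filterS n1 => s A1s.
exact: (sub (s, x) (conj A1s (nbhs_singleton n2))).
Qed.

End Borel_maps.

Section Good_flow_sets.
Context {d : measure_display} {T : measurableType d} {R : realType}.
Variables (mu : probability T R) (Phi : R -> T -> T).
Hypothesis Phi_mpres : forall t, mpres mu (Phi t).

Definition flow_diff (E : set T) (t : R) : set T := [set x | E x <> E (Phi t x)].

(** Sets whose indicator is continuous in measure along the flow, the last clause of
    [mflow]. *)
Definition flow_good (E : set T) : Prop := measurable E /\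
  forall e : R, 0 < e -> exists2 d : R, 0 < d & forall t : R, `|t| < d ->
    (mu (flow_diff E t) <= e%:E)%E.

Lemma measurable_flow_preimage t (E : set T) : measurable E -> measurable (Phi t @^-1` E).
Proof. by move=> mE; rewrite -[X in measurable X]setTI; exact: (Phi_mpres t).1. Qed.

Lemma flow_diffE E t : flow_diff E t =
  (E `\` Phi t @^-1` E) `|` (Phi t @^-1` E `\` E).
Proof.
apply/seteqP; split => x /=.
  by move/neq_propP => [[h1 h2]|[h1 h2]]; [left|right].
by move=> [[h1 h2]|[h1 h2]]; apply/neq_propP; [left|right].
Qed.

Lemma measurable_flow_diff E t : measurable E -> measurable (flow_diff E t).
Proof.
move=> mE; rewrite flow_diffE; have mEt := measurable_flow_preimage t mE.
by apply: measurableU; exact: measurableD.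
Qed.

Lemma mu_le (A B : set T) (e : R) : measurable A -> measurable B -> A `<=` B ->
  (mu B <= e%:E)%E -> (mu A <= e%:E)%E.
Proof. by move=> mA mB AB; apply: le_trans; apply: le_measure; rewrite ?inE. Qed.

Lemma muU_le (A B : set T) (a b : R) : measurable A -> measurable B ->
  (mu A <= a%:E)%E -> (mu B <= b%:E)%E -> (mu (A `|` B) <= (a + b)%:E)%E.
Proof.
move=> mA mB Aa Bb; apply: le_trans (measureU2 _ _ _) _ => //.
by rewrite EFinD; exact: leeD.
Qed.

(** For an increasing union, the part missed by a term of the sequence is small, and so
    is its translate, because the flow preserves the measure. *)
Lemma flow_good_lambda : lambda_system [set: T] flow_good.
Proof.
split=> //.
- split => // e e0; exists 1 => // t _.
  rewrite (_ : flow_diff _ _ = set0) ?measure0 ?lee_fin ?(ltW e0)//.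
  by apply/seteqP; split.
- move=> A B AB [mB gB] [mA gA]; split; first exact: measurableD.
  move=> e e0; have e2 : 0 < e / 2 by rewrite divr_gt0.
  have [d1 d10 h1] := gA _ e2; have [d2 d20 h2] := gB _ e2.
  exists (Num.min d1 d2) => [|t]; first by rewrite lt_min d10.
  rewrite lt_min => /andP[/h1 {}h1 /h2 {}h2].
  have mDA := measurable_flow_diff t mA; have mDB := measurable_flow_diff t mB.
  apply: (@mu_le _ (flow_diff A t `|` flow_diff B t)).
  + by apply: measurable_flow_diff; exact: measurableD.
  + exact: measurableU.
  + move=> x; rewrite /flow_diff /= => h; apply: contrapT => /not_orP[].
    by move=> /contrapT eA /contrapT eB; apply: h; rewrite eA eB.
  + by rewrite (splitr e); exact: muU_le.
- move=> F ndF gF; have mF n : measurable (F n) := (gF n).1.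
  have mU : measurable (\bigcup_n F n) by exact: bigcupT_measurable.
  split => // e e0; have e3 : 0 < e / 3 by rewrite divr_gt0.
  have cF := nondecreasing_cvg_mu (mu := mu) mF mU ndF.
  have [n hn] : exists n, (mu (\bigcup_n F n `\` F n) <= (e / 3)%:E)%E.
    have fU : mu (\bigcup_n F n) \is a fin_num by exact: fin_num_measure.
    have cF' : (fun n => mu (F n)) @ \oo --> (fine (mu (\bigcup_n F n)))%:E.
      by rewrite fineK//; exact: cF.
    have /fine_cvgP[_ /cvgrPdist_le/(_ _ e3)[n _ hn]] := cF'.
    exists n; rewrite measureD//; last by rewrite -ge0_fin_numE.
    rewrite setIidr; last exact: bigcup_sup.
    have fn : mu (F n) \is a fin_num by exact: fin_num_measure.
    rewrite (_ : (_ - _)%E = (fine (mu (\bigcup_n F n)) - fine (mu (F n)))%:E); last first.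
      by rewrite EFinB (fineK fU) (fineK fn).
    rewrite lee_fin.
    by apply: le_trans (ler_norm _) (hn n (leqnn n)).
  have [d1 d10 h1] := (gF n).2 _ e3; exists d1 => // t /h1 {}h1.
  have mDn := measurable_flow_diff t (mF n).
  have mr : measurable (\bigcup_n F n `\` F n) by exact: measurableD.
  have mrt := measurable_flow_preimage t mr.
  apply: (@mu_le _ ((\bigcup_n F n `\` F n) `|`
    (Phi t @^-1` (\bigcup_n F n `\` F n) `|` flow_diff (F n) t))).
  + exact: measurable_flow_diff.
  + by apply: measurableU => //; exact: measurableU.
  + move=> x /= h; apply: contrapT => /not_orP[h2 /not_orP[h3 /contrapT h4]].
    have U1 : (\bigcup_n F n) x = F n x.
      rewrite propeqE; split=> [Ux|Fx]; last by exists n.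
      by apply: contrapT => nF; apply: h2.
    have U2 : (\bigcup_n F n) (Phi t x) = F n (Phi t x).
      rewrite propeqE; split=> [Ux|Fx]; last by exists n.
      by apply: contrapT => nF; apply: h3.
    by apply: h; rewrite U1 U2.
  + rewrite (_ : e = e / 3 + (e / 3 + e / 3)); last by field.
    apply: muU_le => //; first exact: measurableU.
    by apply: muU_le => //; rewrite (Phi_mpres t).2.
Qed.

End Good_flow_sets.

(** The indicator of an open set is lower semicontinuous along orbits, so the part
    of [O] that leaves [O] within time [t] has measure tending to 0. *)
Lemma open_flow_good (R : realType) (X : ptopologicalType) (m : probability (borel X) R)
    (F : R -> X -> X) :
  (forall x, F 0 x = x) -> (forall s t x, F (s + t) x = F s (F t x)) ->
  (forall t, mpres m (F t : borel X -> borel X)) ->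
  (forall x, continuous (F ^~ x)) ->
  forall O : set X, open O -> flow_good m F O.
Proof.
move=> F0 FD Fm Fc O oO.
have mO : measurable (O : set (borel X)) by exact: sub_sigma_algebra.
have mFO t : measurable (F t @^-1` O : set (borel X)).
  exact: (measurable_flow_preimage Fm t mO).
split=> // e e0.
pose leave t : set (borel X) := O `\` F t @^-1` O.
have mleave t : measurable (leave t) by exact: measurableD.
have small : exists2 d : R, 0 < d & forall t, `|t| < d -> (m (leave t) <= (e / 2)%:E)%E.
  apply: contrapT => /forall2NP nd.
  have ex n : exists t : R, `|t| < n.+1%:R^-1 /\ ((e / 2)%:E < m (leave t))%E.
    have [/negP|] := nd (n.+1%:R^-1); first by rewrite invr_gt0 ltr0n.
    by move=> /existsNP[t /not_implyP[h1 /negP]]; rewrite -ltNge => h2; exists t.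
  have [u hu] := choice ex.
  have u0 : u @ \oo --> (0 : R).
    apply/cvgrPdist_lt => eta eta0; near=> n.
    rewrite sub0r normrN; apply: lt_trans (hu n).1 _.
    by near: n; exact: near_infty_natSinv_lt (PosNum eta0).
  pose f n (x : borel X) : \bar R := (\1_(leave (u n)) x)%:E.
  have [|||||_ _ c] := @dominated_convergence _ _ _ m setT measurableT f (fun=> 0%E) (fun=> 1%E).
  - by move=> n; apply/measurable_EFinP; exact: measurable_indic.
  - exact: measurable_cst.
  - apply: aeW => x _; apply: cvg_near_cst.
    have [Ox|nOx] := pselect (O x); last first.
      by apply: nearW => n; rewrite /f indicE memNset// => -[].
    have : nbhs (0 : R) (F ^~ x @^-1` O).
      by apply: Fc; rewrite F0; apply: open_nbhs_nbhs.
    move=> /u0 [N _ hN]; exists N => // n /hN /= On.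
    by rewrite /f indicE memNset// => -[].
  - exact: finite_measure_integrable_cst.
  - apply: aeW => x n _; rewrite /f /= lee_fin indicE.
    by case: (_ \in _); rewrite ?normr1 ?normr0.
  have := c; rewrite integral0 => /fine_cvgP[_ /cvgrPdist_lt].
  have e2 : 0 < e / 2 by rewrite divr_gt0.
  move=> /(_ _ e2)[n _ /(_ n (leqnn n))].
  rewrite /= /f integral_indic// setIT sub0r normrN.
  rewrite ger0_norm ?fine_ge0// => h.
  have := (hu n).2; rewrite -[m (leave _)]fineK ?fin_num_measure// lte_fin => h2.
  by have := lt_trans h h2; rewrite ltxx.
have [d d0 hd] := small; exists d => // t td.
have back : (m (F t @^-1` O `\` O) <= (e / 2)%:E)%E.
  have -> : F t @^-1` O `\` O = F t @^-1` (leave (- t)).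
    apply/seteqP; split => x /= [h1 h2]; split => //.
      by rewrite /= -FD addNr F0.
    by move: h2; rewrite /= -FD addNr F0.
  by rewrite (Fm t).2//; apply: hd; rewrite normrN.
have mb : measurable (F t @^-1` O `\` O : set (borel X)) by exact: measurableD.
by rewrite flow_diffE (splitr e); exact: (muU_le (mleave t) mb (hd t td) back).
Unshelve. all: by end_near.
Qed.

(** Second countability gives joint measurability. The Borel sets are generated by the
    open sets, for which continuity in measure follows from lower semicontinuity. *)
Lemma continuous_mflow (R : realType) (X : ptopologicalType) (m : probability (borel X) R)
    (F : R -> X -> X) : @second_countable X ->
  F 0 = id -> (forall s t, F (s + t) = F s \o F t) ->
  continuous (fun p : R * X => F p.1 p.2) -> (forall t, preserves (F t) m) ->
  mflow (T := borel X) m F.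
Proof.
move=> X2 F0 FD cF Fp.
have cFt := continuous_time_map cF; have cFx := continuous_orbit_map cF.
have Fm t : mpres m (F t : borel X -> borel X).
  by split; [exact: continuous_borel|exact: Fp].
have F0' x : F 0 x = x by rewrite F0.
have FD' s t x : F (s + t) x = F s (F t x) by rewrite FD.
split=> //; first exact: continuous_joint_measurable.
move=> E mE.
have : flow_good (T := borel X) m F E.
  have := @lambda_system_subset (borel X) (@open X) _ setT _ (flow_good_lambda Fm) _ _ E mE.
  apply=> //; first exact: openI.
  by move=> O oO; exact: open_flow_good.
by case.
Qed.

(** Measurable rectangles are moved only in their first side, so they satisfy the
    continuity clause; they generate the measurable sets of the product. *)
Lemma prod_mflow (R : realType) d1 d2 (T1 : measurableType d1) (T2 : measurableType d2)
    (m1 : probability T1 R) (m2 : probability T2 R) (F : R -> T1 -> T1) :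
  mflow m1 F ->
  mflow (m1 \x m2)%E (fun t (p : T1 * T2) => (F t p.1, p.2)).
Proof.
move=> FP; pose mu : probability (T1 * T2)%type R := (m1 \x m2)%E.
pose Phi t (p : T1 * T2) := (F t p.1, p.2).
have Phi_m t : measurable_fun setT (Phi t).
  apply: measurable_fun_pair; last exact: measurable_snd.
  by apply: measurableT_comp; [exact: (mflow_mpres FP t).1|exact: measurable_fst].
have Phi_mpres t : mpres mu (Phi t).
  split=> // E mE; rewrite /mu /= /product_measure1.
  have mPE : measurable (Phi t @^-1` E).
    by rewrite -[X in measurable X]setTI; exact: Phi_m.
  rewrite -(@mpres_ge0_integral _ _ _ m1 _ (mflow_mpres FP t) (fun x => m2 (xsection E x)))//.
  by exact: measurable_fun_xsection.
split.
- by move=> [x y]; rewrite (mflow0 FP).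
- by move=> s t [x y]; rewrite (mflowD FP).
- exact: Phi_mpres.
- apply: measurable_fun_pair.
    apply: (measurableT_comp (mflow_meas FP) (g := fun q : measurableTypeR R * (T1 * T2) => (q.1, q.2.1))).
    by apply: measurable_fun_pair => //; apply: measurableT_comp.
  by apply: measurableT_comp.
move=> E mE.
have : flow_good mu Phi E.
  move: E mE; rewrite measurable_prod_measurableType => E mE.
  apply: (@lambda_system_subset (T1 * T2)%type _ _ setT _ (flow_good_lambda Phi_mpres) _ _ E mE) => //.
    move=> _ _ [A1 mA1 [B1 mB1 <-]] [A2 mA2 [B2 mB2 <-]].
    exists (A1 `&` A2); first exact: measurableI.
    by exists (B1 `&` B2); [exact: measurableI|rewrite setXI].
  move=> _ [A mA [B mB <-]]; split; first exact: measurableX.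
  move=> e e0; have [d d0 hd] := mflow_cont FP mA e0; exists d => // t /hd.
  have mDA := measurable_flow_diff (mflow_mpres FP) t mA.
  have e1 : mu (flow_diff F A t `*` setT) = m1 (flow_diff F A t).
    rewrite /mu /= product_measure1E// -[RHS]mule1; congr (_ * _)%E.
    exact: probability_setT.
  move=> h; have {}h : (mu (flow_diff F A t `*` setT) <= e%:E)%E by rewrite e1.
  apply: mu_le h.
  - by apply: measurable_flow_diff => //; exact: measurableX.
  - exact: measurableX.
  - move=> [x y] /=; rewrite /flow_diff /= => h; split=> // eA; apply: h.
    by rewrite propeqE; split => -[/= h1 h2]; split=> //; [rewrite -eA|rewrite eA].
by case.
Qed.

(** * Haar measure and matrix coefficients of SU(2) *)

Section SU2_borel.
Variable R : realType.
Local Notation Re := (@complex.Re R).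
Local Notation Im := (@complex.Im R).
Local Notation normc := (@Normc.normc R).
Local Notation SU2b := (borel (SU2 R)).
Implicit Types g h : SU2 R.

Lemma su2_mulE g h : su2val (g * h)%g = su2val g *m su2val h.
Proof. by []. Qed.

Lemma su2_invE g i j : su2val g^-1%g i j = (g j i)^*.
Proof. by rewrite [LHS]mxE mxE. Qed.

Lemma su2_mul_entry g h i j : su2val (g * h)%g i j = \sum_k g i k * h k j.
Proof. by rewrite su2_mulE mxE. Qed.

Lemma su2_entry_bound g i j : normc (g i j) <= 1.
Proof.
have := congr1 (fun M : 'M[R[i]]_2 => Re (M i i)) (su2_adjr g).
rewrite !mxE eqxx /= => h.
have e : Re (\sum_k g i k * adjmx g k i) = \sum_k normc (g i k) ^+ 2.
  rewrite (big_morph Re (@ReD R) (erefl _)); apply: eq_bigr => k _.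
  by rewrite !mxE mulcJ.
have : normc (g i j) ^+ 2 <= 1.
  rewrite -[leRHS]h e (bigD1 j)//= lerDl sumr_ge0// => k _; exact: sqr_ge0.
by rewrite -[leRHS](expr1n _ 2) ler_pXn2r// nnegrE ?normc_ge0.
Qed.

(** The topology of SU(2) is induced by its matrices, whose balls are entrywise. *)
Lemma nbhs_SU2P (U : set (SU2 R)) g : nbhs g U <->
  exists2 e : R, 0 < e & forall h, (forall i j, normc (h i j - g i j) < e) -> U h.
Proof.
split.
  rewrite nbhsE => -[W [[V oV VW] Wg] WU].
  have : nbhs (su2val g) V by apply: open_nbhs_nbhs; split=> //; rewrite -VW in Wg.
  move=> /nbhs_ballP[e /= e0 be].
  have eE : e = (Re e)%:C by apply/esym/RRe_real; exact: gtr0_real.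
  have re0 : 0 < Re e by move: e0; rewrite eE ltcR.
  exists (Re e) => // h hg; apply: WU; rewrite -VW; apply: be.
  split=> // i j; rewrite /ball /= eE.
  have : normc (g i j - h i j) < Re e by rewrite -normcN opprB.
  by rewrite -ltcR.
move=> [e e0 he].
have : nbhs (su2val g) [set M : 'M[R[i]]_2 | forall i j, normc (M i j - g i j) < e].
  apply/nbhs_ballP; exists (e%:C); first by rewrite /= ltcR.
  move=> M [_ bM] i j; have := bM i j; rewrite /ball /= => h.
  have : (normc (g i j - M i j))%:C < e%:C by exact: h.
  by rewrite ltcR -normcN opprB.
move=> nU; apply: (@filterS _ _ (nbhs_filter g) _ _ _ (@initial_continuous _ _ (@su2val R) g _ nU)).
by move=> h /= hg; exact: he.
Qed.

Lemma continuous_SU2_entry i j :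
  continuous (fun g => Re (g i j)) /\ continuous (fun g => Im (g i j)).
Proof.
split=> g V /nbhs_ballP[e /= e0 be]; apply/nbhs_SU2P; exists e => // h hg;
  apply: be; have := hg i j; apply: le_lt_trans; rewrite distrC -?ReN -?ReD -?ImN -?ImD.
  exact: Re_le_normc.
exact: Im_le_normc.
Qed.

Lemma mcf_SU2_entry i j : measurable_cfun (fun g : SU2b => su2val g i j).
Proof.
have [cr ci] := continuous_SU2_entry i j.
by split; exact: continuous_borel_real.
Qed.

Lemma mcf_norm1 d (T : measurableType d) (f : T -> R[i]) : measurable_cfun f ->
  measurable_fun [set: T] (fun x => `|Re (f x)| + `|Im (f x)|).
Proof. by move=> [fr fi]; apply: measurable_funD; exact: measurableT_comp. Qed.

(** Every open set is a countable union of balls with rational centre and radius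
    [1 / n.+1], whose preimages are described by the entries. *)
Lemma measurable_SU2 d (T : measurableType d) (f : T -> SU2b) :
  (forall i j, measurable_cfun (fun x => su2val (f x) i j)) -> measurable_fun [set: T] f.
Proof.
move=> mf; refine (@measurability _ _ T SU2b setT f (@open (SU2 R)) erefl _).
move=> _ [V oV <-]; rewrite setTI.
pose centre := {ffun 'I_2 * 'I_2 -> rat * rat}.
pose z (q : centre) i j : R[i] := ratr (q (i, j)).1 +i* ratr (q (i, j)).2.
pose dist (q : centre) g : R :=
  \sum_(p : 'I_2 * 'I_2) (`|Re (g p.1 p.2 - z q p.1 p.2)| + `|Im (g p.1 p.2 - z q p.1 p.2)|).
pose box (qn : centre * nat) : set (SU2 R) := [set g | dist qn.1 g < qn.2.+1%:R^-1].
have mdist q : measurable_fun [set: T] (fun x => dist q (f x)).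
  apply: measurable_sum => p; apply: mcf_norm1.
  by apply: mcfB; [exact: mf|exact: mcf_cst].
have mbox qn : measurable (f @^-1` box qn).
  have := mdist qn.1 measurableT _ (measurable_itv `]-oo, qn.2.+1%:R^-1[%R); rewrite setTI.
  by congr measurable; apply/seteqP; split => x /=; rewrite in_itv.
have dist_tri q g h i j : normc (h i j - g i j) <= dist q h + dist q g.
  apply: le_trans (normc_le _) _; rewrite /dist.
  rewrite [X in _ <= X + _](bigD1 (i, j))//= [X in _ <= _ + X](bigD1 (i, j))//=.
  set A := \sum_(_ | _) _; set B := \sum_(_ | _) _.
  have A0 : 0 <= A by apply: sumr_ge0 => p _; exact: addr_ge0.
  have B0 : 0 <= B by apply: sumr_ge0 => p _; exact: addr_ge0.
  have -> : h i j - g i j = (h i j - z q i j) - (g i j - z q i j) by ring.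
  rewrite (ReD (h i j - z q i j)) (ImD (h i j - z q i j)).
  rewrite (ReN (g i j - z q i j)) (ImN (g i j - z q i j)).
  have := ler_normB (Re (h i j - z q i j)) (Re (g i j - z q i j)).
  have := ler_normB (Im (h i j - z q i j)) (Im (g i j - z q i j)).
  lra.
have -> : f @^-1` V = \bigcup_(qn in [set qn | box qn `<=` V]) f @^-1` box qn.
  apply/seteqP; split => [x Vx|x [qn sub bx]]; last exact: sub.
  have [e e0 he] := (nbhs_SU2P V (f x)).1 (open_nbhs_nbhs (conj oV Vx)).
  have [n hn] : exists n : nat, 2 * n.+1%:R^-1 <= e.
    exists (Num.truncn (2 / e)); rewrite mulrC ler_pdivrMl// -ler_pdivrMr//.
    exact/ltW/truncnS_gt.
  (* [dist] sums the errors of four real and four imaginary parts *)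
  pose eta : R := n.+1%:R^-1 / 8.
  have eta0 : 0 < eta by rewrite divr_gt0// invr_gt0.
  have ratclose (a : R) : exists q : rat, `|a - ratr q| < eta.
    have [q] := @rat_in_itvoo R (a - eta) (a + eta) (ltac:(lra)).
    rewrite in_itv/= => /andP[h1 h2]; exists q.
    by rewrite ltr_norml; apply/andP; split; lra.
  have ratclose2 (w : R[i]) : exists q : rat * rat,
      `|Re w - ratr q.1| + `|Im w - ratr q.2| < eta + eta.
    have [q1 h1] := ratclose (Re w); have [q2 h2] := ratclose (Im w).
    by exists (q1, q2); exact: ltrD.
  have [qq hqq] := choice (fun p : 'I_2 * 'I_2 => ratclose2 (f x p.1 p.2)).
  pose q : centre := [ffun p => qq p].
  have bq : dist q (f x) < n.+1%:R^-1.
    apply: (@lt_le_trans _ _ (\sum_(p : 'I_2 * 'I_2) (eta + eta))).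
      rewrite /dist; apply: ltr_sum => [|p _].
        by apply/hasP; exists (ord0, ord0); rewrite ?mem_index_enum.
      have := hqq p; rewrite !ReD !ReN !ImD !ImN /= ffunE; by case: p.
    rewrite sumr_const card_prod !card_ord -[(2 * 2)%N]/4%N -(mulr_natr (eta + eta)) /eta.
    by move: (n.+1%:R^-1) => z0; lra.
  exists (q, n) => //= h bh; apply: he => i j.
  apply: le_lt_trans (dist_tri q _ _ i j) _.
  have bh' : dist q h < n.+1%:R^-1 := bh.
  by apply: lt_le_trans hn; move: bh' bq; move: (n.+1%:R^-1) => z0; lra.
apply: bigcup_countable_measurable => //; exact: countableP.
Qed.

Lemma measurable_SU2_mul d (T : measurableType d) (a b : T -> SU2b) :
  measurable_fun [set: T] a -> measurable_fun [set: T] b ->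
  measurable_fun [set: T] (fun x => ((a x : SU2 R) * b x)%g : SU2b).
Proof.
move=> ma mb; apply: measurable_SU2 => i j; under eq_fun do rewrite su2_mul_entry.
apply: mcf_sum => k _; apply: mcfM.
  exact: (mcf_comp ma (mcf_SU2_entry i k)).
exact: (mcf_comp mb (mcf_SU2_entry k j)).
Qed.

Lemma measurable_SU2_inv d (T : measurableType d) (a : T -> SU2b) :
  measurable_fun [set: T] a ->
  measurable_fun [set: T] (fun x => ((a x : SU2 R)^-1)%g : SU2b).
Proof.
move=> ma; apply: measurable_SU2 => i j; under eq_fun do rewrite su2_invE.
exact: (mcf_conj (mcf_comp ma (mcf_SU2_entry j i))).
Qed.

Section Haar.
Variable haar : probability SU2b R.
Hypothesis haarP : haar_SU2 haar.

(** Both iterated measures of [{(x, y) | x^-1 y \in E}] are computed with left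
    invariance: one is [haar E], the other is the measure of the inverse of [E]. *)
Lemma haar_inv (E : set SU2b) : measurable E ->
  haar ((fun g : SU2 R => g^-1%g) @^-1` E) = haar E.
Proof.
move=> mE; pose Ei : set SU2b := (fun g : SU2 R => g^-1%g) @^-1` E.
have mEi : measurable Ei.
  rewrite -[Ei]setTI; exact: (measurable_SU2_inv (@measurable_id _ SU2b setT)).
pose A : set (SU2b * SU2b) := [set p | E ((p.1 : SU2 R)^-1 * p.2)%g].
have mA : measurable A.
  rewrite -[A]setTI; apply: (@measurable_SU2_mul _ _ (fun p : SU2b * SU2b => (p.1 : SU2 R)^-1%g) snd) => //.
  by apply: measurable_SU2_inv; exact: measurable_fst.
have := @indic_fubini_tonelli _ _ SU2b SU2b R haar haar A mA.
rewrite (indic_fubini_tonelli_FE _ mA) (indic_fubini_tonelli_GE _ mA).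
have -> : (haar \o xsection A) = fun=> haar E.
  apply/funext => x /=; rewrite -(haarP (x : SU2 R)^-1%g mE); congr (haar _).
  by apply/seteqP; split => y; rewrite /xsection/= inE.
have -> : (haar \o ysection A) = fun=> haar Ei.
  apply/funext => y /=; rewrite -(haarP (y : SU2 R)^-1%g mEi); congr (haar _).
  by apply/seteqP; split => x; rewrite /ysection/= inE /Ei/= invgM invgK.
have P1 : (haar : {measure set SU2b -> \bar R}) [set: SU2b] = 1%E by exact: probability_setT.
rewrite !integral_cst// => h; have := h.
by rewrite [in LHS]P1 [in RHS]P1 !mule1.
Qed.

Lemma haar_right (h : SU2 R) (E : set SU2b) : measurable E ->
  haar ((fun g : SU2 R => (g * h)%g) @^-1` E) = haar E.
Proof.
move=> mE; pose Ei : set SU2b := (fun g : SU2 R => g^-1%g) @^-1` E.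
have mid := @measurable_id _ SU2b setT.
have mEi : measurable Ei by rewrite -[Ei]setTI; exact: (measurable_SU2_inv mid).
have mEh : measurable ((fun g : SU2 R => (g * h)%g) @^-1` E : set SU2b).
  rewrite -[X in measurable X]setTI.
  by apply: (@measurable_SU2_mul _ _ (fun g : SU2b => g) (fun=> h)) => //; exact: measurable_cst.
rewrite -(haar_inv mEh) -(haar_inv mE) -(haarP h^-1%g mEi); congr (haar _).
by apply/seteqP; split => x /=; rewrite /Ei/= invgM invgK.
Qed.

(** Fibrewise, the skew product is a right translation; by [haar_right] the fibres keep
    their measure, and [f] preserves that of the base. *)
Lemma skew_mpres d (T : measurableType d) (m : probability T R) (f : T -> T)
    (delta : T -> SU2b) : mpres m f -> measurable_fun [set: T] delta ->
  mpres (m \x haar)%E (fun p : T * SU2b => (f p.1, ((p.2 : SU2 R) * delta p.1)%g : SU2b)).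
Proof.
move=> [mf pf] md.
set S := fun p => _.
have mS : measurable_fun setT S.
  apply: measurable_fun_pair; first by apply: measurableT_comp => //; exact: measurable_fst.
  apply: measurable_SU2_mul; first exact: measurable_snd.
  by apply: measurableT_comp => //; exact: measurable_fst.
split=> // E mE; rewrite /= /product_measure1.
rewrite -(@mpres_ge0_integral _ _ _ m f (conj mf pf) (fun x => haar (xsection E x)))//; last first.
  exact: measurable_fun_xsection.
apply: eq_integral => x _.
rewrite -(haar_right (delta x) (measurable_xsection (f x) mE)).
congr (haar _); apply/seteqP; split => y; rewrite /xsection/= !inE.
Qed.

End Haar.
End SU2_borel.

Section Representation.
Variable R : realType.
Local Notation normc := (@Normc.normc R).
Local Notation SU2b := (borel (SU2 R)).
Local Notation poly2 := {poly {poly R[i]}}.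
Implicit Types (g h : SU2 R) (l j k : nat).

Definition col_form g (i : 'I_2) : poly2 :=
  'X * ((su2val g ord0 i)%:P%:P) + 'Y * ((su2val g ord_max i)%:P%:P).

Lemma su2_rep_pbasis g l k :
  su2_rep g (pbasis R l k) = col_form g ord0 ^+ k * col_form g ord_max ^+ (l - k).
Proof.
rewrite /su2_rep /subst2 /pbasis rmorphM !rmorphXn /= map_polyX map_polyC /=.
by rewrite hornerM !horner_exp hornerX hornerC horner_evalE map_polyX hornerX.
Qed.

Lemma V_ipZl l (a : R[i]) (p q : poly2) : V_ip l (a%:P%:P * p) q = a * V_ip l p q.
Proof.
by rewrite /V_ip mulr_sumr; apply: eq_bigr => i _; rewrite !coefCM; ring.
Qed.

Definition su2_diag g := su2val g ord0 ord_max = 0 /\ su2val g ord_max ord0 = 0.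

Definition weight l k (t : R[i]) : R[i] := t ^+ k * t^* ^+ (l - k).

Lemma sum_ord2 (V : nmodType) (u : 'I_2 -> V) : \sum_i u i = u ord0 + u ord_max.
Proof. by rewrite big_ord_recl big_ord1; congr (_ + u _); apply: val_inj. Qed.

Lemma ord2P (i : 'I_2) : i = ord0 \/ i = ord_max.
Proof. by case: i => -[|[|//]] ?; [left|right]; apply: val_inj. Qed.

Lemma su2_diag_norm g : su2_diag g -> normc (g ord0 ord0) = 1.
Proof.
move=> [g01 _]; have := congr1 (fun M : 'M[R[i]]_2 => M ord0 ord0) (su2_adjr g).
rewrite !mxE sum_ord2 !mxE g01 mul0r addr0 mulcJ => /complexI/eqP.
by rewrite pexpr_eq1// ?normc_ge0// => /eqP.
Qed.

Lemma su2_diag_11 g : su2_diag g -> g ord_max ord_max = (g ord0 ord0)^*.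
Proof.
move=> dg; have n1 := su2_diag_norm dg; have [g01 g10] := dg.
have := su2_det g; rewrite (expand_det_row _ ord0) sum_ord2 g01 mul0r addr0.
rewrite /cofactor det_mx11 !mxE /= expr0 mul1r.
have -> : lift ord0 (0 : 'I_1) = ord_max :> 'I_2 by apply: val_inj.
move=> e; have := congr1 (fun z => (g ord0 ord0)^* * z) e.
by rewrite mulr1 mulrA (mulrC _^*) mulcJ n1 expr1n mul1r.
Qed.

(** Right translation by a diagonal matrix scales the two linear forms
    [(omega_1, omega_2) g] separately, hence each monomial by a character. *)
Lemma rep_coef_diag l j k g h : su2_diag h ->
  rep_coef l j k (g * h)%g = weight l k (h ord0 ord0) * rep_coef l j k g.
Proof.
move=> dh; rewrite /rep_coef !su2_rep_pbasis.
have e0 : col_form (g * h)%g ord0 = (h ord0 ord0)%:P%:P * col_form g ord0.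
  rewrite /col_form !su2_mul_entry !sum_ord2 dh.2 !mulr0 !addr0 !polyCM; ring.
have e1 : col_form (g * h)%g ord_max = ((h ord0 ord0)^*)%:P%:P * col_form g ord_max.
  rewrite /col_form !su2_mul_entry !sum_ord2 dh.1 !mulr0 !add0r su2_diag_11// !polyCM; ring.
rewrite e0 e1 !exprMn -V_ipZl; congr V_ip.
by rewrite /weight !polyCM !polyC_exp mulrACA.
Qed.

(** Maps into polynomials with bounded measurable coefficients. They form an algebra, in
    which matrix coefficients are built from the entries of [g]. *)
Definition tame (P : SU2b -> poly2) := forall a b,
  measurable_cfun (T := SU2b) (fun g => (P g)`_a`_b) /\ exists K : R, forall g, normc ((P g)`_a`_b) <= K.

Lemma bnd_sum (I : Type) (s : seq I) (F : I -> SU2b -> R[i]) :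
  (forall i, exists K : R, forall g, normc (F i g) <= K) ->
  exists K : R, forall g, normc (\sum_(i <- s) F i g) <= K.
Proof.
move=> FK; elim: s => [|i s [K IH]].
  by exists 0 => g; rewrite big_nil Normc.normc0.
have [K' FK'] := FK i; exists (K' + K) => g; rewrite big_cons.
by apply: le_trans (le_normcD _ _) _; exact: lerD.
Qed.

Lemma tame_cst p : tame (fun=> p).
Proof. by move=> a b; split; [exact: mcf_cst|exists (normc p`_a`_b)]. Qed.

Lemma tameD P Q : tame P -> tame Q -> tame (fun g => P g + Q g).
Proof.
move=> tP tQ a b; have [mP [K PK]] := tP a b; have [mQ [K' QK]] := tQ a b; split.
  by under eq_fun do rewrite !coefD; exact: mcfD.
exists (K + K') => g; rewrite !coefD; apply: le_trans (le_normcD _ _) _; exact: lerD.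
Qed.

Lemma tameM P Q : tame P -> tame Q -> tame (fun g => P g * Q g).
Proof.
move=> tP tQ a b.
have cE g : (P g * Q g)`_a`_b = \sum_(i < a.+1) \sum_(n < b.+1)
    (P g)`_i`_n * (Q g)`_(a - i)`_(b - n).
  by rewrite coefM coef_sum; apply: eq_bigr => i _; rewrite coefM.
split.
  under eq_fun do rewrite cE.
  apply: mcf_sum => i _; apply: mcf_sum => n _.
  by apply: mcfM; [exact: (tP _ _).1|exact: (tQ _ _).1].
have [K hK] : exists K : R, forall g, normc (\sum_(i < a.+1) \sum_(n < b.+1)
    (P g)`_i`_n * (Q g)`_(a - i)`_(b - n)) <= K; last by exists K => g; rewrite cE.
apply: bnd_sum => i; apply: bnd_sum => n.
have [_ [K PK]] := tP i n; have [_ [K' QK]] := tQ (a - i)%N (b - n)%N.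
exists (K * K') => g; rewrite Normc.normcM; apply: ler_pM; rewrite ?normc_ge0//.
Qed.

Lemma tameX P n : tame P -> tame (fun g => P g ^+ n).
Proof.
move=> tP; elim: n => [|n IH]; first exact: (tame_cst 1).
have -> : (fun g => P g ^+ n.+1) = (fun g => P g * P g ^+ n).
  by apply/funext => g; rewrite exprS.
exact: tameM.
Qed.

Lemma tame_entry (i i' : 'I_2) : tame (fun g => ((su2val g i i')%:P%:P)).
Proof.
move=> a b.
have cE (c : R[i]) : (c%:P%:P : poly2)`_a`_b = ((a == 0%N) && (b == 0%N))%:R * c.
  rewrite coefC; case: eqP => _ /=; last by rewrite coef0 mul0r.
  by rewrite coefC; case: eqP => _; rewrite ?mul1r ?mul0r.
split; first by under eq_fun do rewrite cE; apply: mcfZ; exact: mcf_SU2_entry.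
exists 1 => g; rewrite cE; case: (_ && _); rewrite ?mul1r ?mul0r ?Normc.normc0//.
exact: su2_entry_bound.
Qed.

Lemma tame_rep_coef l j k : measurable_cfun (fun g : SU2b => rep_coef l j k g) /\
  exists2 K : R, 0 <= K & forall g, normc (rep_coef l j k g) <= K.
Proof.
have tc i : tame (fun g => col_form g i).
  by apply: tameD; apply: tameM; [exact: tame_cst|exact: tame_entry|exact: tame_cst|exact: tame_entry].
have tP : tame (fun g => su2_rep g (pbasis R l k)).
  have -> : (fun g => su2_rep g (pbasis R l k)) =
      (fun g => col_form g ord0 ^+ k * col_form g ord_max ^+ (l - k)).
    by apply/funext => g; rewrite su2_rep_pbasis.
  by apply: tameM; exact: tameX.
split.
  apply: mcf_sum => i _; apply: mcfM; last exact: mcf_cst.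
  by apply: mcfZ; exact: (tP _ _).1.
have [K hK] : exists K : R, forall g, normc (rep_coef l j k g) <= K.
  apply: bnd_sum => i; have [_ [K PK]] := tP i (l - i)%N.
  set c := (_`! * _)%:R; set e := (_^*)%R.
  exists (normc c * K * normc e) => g; rewrite !Normc.normcM ler_wpM2r ?normc_ge0//.
  by rewrite ler_wpM2l ?normc_ge0.
by exists K => //; apply: le_trans (normc_ge0 _) (hK 1%g).
Qed.

(** At [diag(t, t^-1)] the quotient of the two weights is [t^(2 (k - k'))]; a root of -1 of
    order [2 |k - k'|] makes it -1. *)
Lemma weight_separation l (k k' : 'I_l.+1) : k != k' ->
  exists g, su2_diag g /\
    weight l k (g ord0 ord0) * (weight l k' (g ord0 ord0))^* != 1.
Proof.
move=> kk'.
pose n := (if k' < k then k - k' else k' - k)%N.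
have n0 : (0 < n.*2)%N.
  have kk2 : nat_of_ord k <> nat_of_ord k' by move: kk' => /eqP + h; apply; exact: val_inj.
  by rewrite double_gt0 /n; case: (ltngtP k' k) kk2 => [h _|h _|->//]; rewrite subn_gt0.
pose t : R[i] := n.*2.-root (-1).
have tn : t ^+ n.*2 = -1 by exact: rootCK.
have t1 : normc t = 1.
  have := congr1 normc tn; rewrite normcX normcN Normc.normc1 => /eqP.
  by rewrite pexpr_eq1// ?normc_ge0// => /eqP.
have tt : t * t^* = 1 by rewrite mulcJ t1 expr1n.
have dP : (mx22 t 0 0 t^* \is unitarymx) && (\det (mx22 t 0 0 t^*) == 1).
  apply/andP; split.
    apply/unitarymxP/matrixP => i j; rewrite !mxE sum_ord2 !mxE.
    have [->|->] := ord2P i; have [->|->] := ord2P j; rewrite /= ?mul0r ?mulr0 ?conjC0 ?mulr0 ?addr0 ?add0r ?eqxx//.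
    by rewrite -tt mulrC; congr (_ * _); exact: conjcK.
  rewrite (expand_det_row _ ord0) sum_ord2 !mxE /= mul0r addr0.
  by rewrite /cofactor det_mx11 !mxE /= expr0 mul1r tt.
exists (MkSU2 dP); split; first by rewrite /su2_diag /= !mxE.
have cX (a : nat) (w : R[i]) : (w ^+ a)^* = w^* ^+ a by exact: rmorphXn.
have wJ (a b : nat) : (t ^+ a * t^* ^+ b)^* = t^* ^+ a * t ^+ b.
  apply: etrans (conjcM _ _) _; congr (_ * _); first exact: cX.
  by apply: etrans (cX _ _) _; congr (_ ^+ _); exact: conjcK.
have -> : (MkSU2 dP) ord0 ord0 = t by rewrite /= !mxE.
have -> : ((weight l k' t)^*)%R = t^* ^+ k' * t ^+ (l - k') by exact: wJ.
rewrite /weight.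
have pw (a b : nat) : (b <= a)%N -> t ^+ a * t^* ^+ b = t ^+ (a - b).
  by move=> ba; rewrite -{1}(subnK ba) exprD -mulrA -exprMn tt expr1n mulr1.
have pw' (a b : nat) : (a <= b)%N -> t ^+ a * t^* ^+ b = t^* ^+ (b - a).
  by move=> ba; rewrite -{1}(subnK ba) exprD mulrCA -exprMn tt expr1n mulr1.
have kl := leq_ord k; have kl' := leq_ord k'.
have -> : t ^+ k * t^* ^+ (l - k) * (t^* ^+ k' * t ^+ (l - k')) =
    t ^+ (k + (l - k')) * t^* ^+ (k' + (l - k)) by rewrite !exprD; ring.
have m1 : (-1 : R[i]) != 1 by rewrite eq_sym -subr_eq0 opprK -mulr2n pnatr_eq0.
have [hk|hk] := ltnP k' k.
  rewrite pw; last by lia.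
  rewrite (_ : (_ - _)%N = n.*2) ?tn// /n hk -addnn; lia.
have hk2 : (k < k')%N by rewrite ltn_neqAle hk andbT.
rewrite pw'; last by lia.
rewrite (_ : (_ - _)%N = n.*2); last by rewrite /n ltnNge (ltnW hk2) /= -addnn; lia.
by rewrite -rmorphXn tn rmorphN rmorph1.
Qed.

End Representation.

(** * Differentiation along a flow of class C1 *)

Section Curves.
Variable R : realType.
Implicit Types (f : R -> R) (s d : R).

(** First order expansion, the form in which derivatives are combined below. *)
Lemma is_derive_epsP f s d : is_derive s 1 f d <-> forall e : R, 0 < e ->
  exists2 dl : R, 0 < dl & forall h : R, `|h| < dl -> `|f (s + h) - f s - h * d| <= e * `|h|.
Proof.
pose q (h : R) : R := h^-1 *: ((f \o shift s) (h *: (1 : R)) - f s).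
have qE (h : R) : h != 0 -> f (s + h) - f s - h * d = h * (q h - d).
  move=> h0; rewrite /q /= /GRing.scale /= mulr1 (addrC h).
  by rewrite mulrBr mulrA divff// mul1r.
split=> [[dv dvE] e e0|H].
  have qd : q @ 0^' --> (d : R) by rewrite -dvE; exact: dv.
  move/cvgrPdist_le : qd => /(_ e e0)[dl /= dl0 hd]; exists dl => // h hdl.
  have [->|h0] := eqVneq h 0; first by rewrite addr0 subrr mul0r subrr normr0 mulr0.
  rewrite qE// normrM mulrC ler_wpM2r// distrC; apply: hd => //.
  by rewrite /= sub0r normrN.
have qd : q @ 0^' --> (d : R).
  apply/cvgrPdist_le => e e0; have [dl dl0 hd] := H e e0; exists dl => //= h.
  rewrite /ball_ /= sub0r normrN => hdl h0; have := hd h hdl.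
  by rewrite qE// normrM mulrC ler_pM2r ?normr_gt0// distrC.
by split; [exact: (cvgP _ qd)|exact: (cvg_lim _ qd)].
Qed.

Lemma is_derive_shift f s d : is_derive (0 : R) 1 (fun t => f (s + t)) d -> is_derive s 1 f d.
Proof.
move=> /is_derive_epsP H; apply/is_derive_epsP => e /H[dl dl0 hd]; exists dl => // h /hd.
by rewrite add0r addr0.
Qed.

Lemma is_derive_near f g s d : (\forall t \near s, f t = g t) ->
  is_derive s 1 f d -> is_derive s 1 g d.
Proof.
move=> /nbhs_ballP[r /= r0 fg] /is_derive_epsP H; apply/is_derive_epsP => e /H[dl dl0 hd].
exists (Num.min dl r); first by rewrite lt_min dl0 r0.
move=> h; rewrite lt_min => /andP[h1 h2].
rewrite -!fg; [exact: hd| |]; rewrite /ball /=.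
  by rewrite subrr normr0.
by rewrite opprD addNKr normrN.
Qed.

Lemma is_derive_derive1 f s d : is_derive s 1 f d -> derive1 f s = d.
Proof. by move=> [_ <-]; rewrite derive1E. Qed.

Lemma derivable_is_derive f s : derivable f s 1 -> is_derive s 1 f (derive1 f s).
Proof. by move=> H; rewrite derive1E; exact: derivableP. Qed.

(** Mean value theorem between 0 and an increment of either sign. *)
Lemma mean_value f (df : R -> R) (h : R) :
  (forall s, `|s| <= `|h| -> is_derive s 1 f (df s)) ->
  exists2 s, `|s| <= `|h| & f h - f 0 = df s * h.
Proof.
move=> dfP.
have cf (a b : R) : (forall x, a <= x <= b -> `|x| <= `|h|) ->
    {within `[a, b], continuous f}.
  move=> ab; apply: derivable_within_continuous => x; rewrite in_itv/= => xab.
  by have [] := dfP x (ab x xab).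
have [h0|h0] := leP 0 h.
  have B x : 0 <= x <= h -> `|x| <= `|h|.
    by move=> /andP[x0 xh]; rewrite !ger0_norm.
  have dx (x : R) : x \in `]0, h[ -> is_derive x 1 f (df x).
    by rewrite in_itv/= => /andP[x0 xh]; apply/dfP/B; rewrite !ltW.
  have [s] := MVT_segment h0 dx (cf _ _ B).
  by rewrite in_itv/= subr0 => /B sh e; exists s.
have B x : h <= x <= 0 -> `|x| <= `|h|.
  by move=> /andP[x0 xh]; rewrite !ler0_norm ?lerN2// ltW.
have dx (x : R) : x \in `]h, 0[ -> is_derive x 1 f (df x).
  by rewrite in_itv/= => /andP[x0 xh]; apply/dfP/B; rewrite !ltW.
have [s] := MVT_segment (ltW h0) dx (cf _ _ B).
rewrite in_itv/= sub0r => /B sh e; exists s => //.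
by rewrite -opprB e mulrN opprK.
Qed.

End Curves.

Section Chain_rule.
Variables (R : realType) (n : nat).
Implicit Types (g : 'rV[R]_n -> R) (v h : 'rV[R]_n) (O : set 'rV[R]_n).
Local Notation unit_row i := (delta_mx ord0 i : 'rV[R]_n).

Lemma nbhs_rowP v O : nbhs v O <-> exists2 dl : R, 0 < dl &
  forall h, (forall j, `|h ord0 j| < dl) -> O (v + h).
Proof.
split=> [/nbhs_ballP[dl /= dl0 hd]|[dl dl0 hd]].
  exists dl => // h hh; apply: hd; split=> // i j; rewrite ord1 /ball /= !mxE.
  by rewrite opprD addNKr normrN.
apply/nbhs_ballP; exists dl => //= w [_ bw].
rewrite -(subrK v w) addrC; apply: hd => j; rewrite !mxE.
by have := bw ord0 j; rewrite /ball /= distrC.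
Qed.

(** The increment is split into increments along the coordinate axes, to which the mean
    value theorem applies; the partial derivatives at the intermediate points are close to
    those at [v] by continuity. *)
Lemma C1_taylor g O v : open O -> Ck 1 g O -> O v -> forall e : R, 0 < e ->
  exists2 dl : R, 0 < dl & forall h, (forall j, `|h ord0 j| < dl) ->
  `|g (v + h) - g v - \sum_j partial j g v * h ord0 j| <= e * \sum_j `|h ord0 j|.
Proof.
move=> oO [_ gC] Ov e e0.
have : \forall w \near v, O w /\ forall j : 'I_n, `|partial j g v - partial j g w| < e.
  near=> w; split; first by near: w; exact: open_nbhs_nbhs.
  near: w; apply: filter_forall => j.
  have [_ [cj _]] := gC j; by move/cvgrPdist_lt : (cj v Ov) => /(_ e e0).
move=> /nbhs_rowP[dl dl0 near_v]; exists dl => // h hdl.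
(* the first [k] coordinate steps from [v] towards [v + h] *)
pose hk (k : nat) : 'rV[R]_n := \row_j (if (j < k)%N then h ord0 j else 0).
have hn : hk n = h by apply/rowP => j; rewrite mxE ltn_ord.
suff H k : (k <= n)%N -> `|g (v + hk k) - g v - \sum_(j < n | (j < k)%N) partial j g v * h ord0 j|
    <= e * \sum_(j < n | (j < k)%N) `|h ord0 j|.
  have allj (G : 'I_n -> R) : \sum_(j < n | (j < n)%N) G j = \sum_j G j.
    by apply: eq_bigl => j; rewrite ltn_ord.
  by have := H n (leqnn n); rewrite hn !allj.
elim: k => [_|k IH kn].
  rewrite !big_pred0 //; have -> : hk 0%N = 0 by apply/rowP => j; rewrite !mxE.
  by rewrite addr0 subr0 subrr normr0 mulr0.
pose i := Ordinal kn.
have split_sum (G : 'I_n -> R) : \sum_(j < n | (j < k.+1)%N) G j =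
    G i + \sum_(j < n | (j < k)%N) G j.
  rewrite (bigD1 i)//=; congr (_ + _); apply: eq_bigl => j.
  by rewrite ltnS ltn_neqAle andbC.
have hkS : hk k.+1 = hk k + h ord0 i *: unit_row i.
  apply/rowP => j; rewrite !mxE eqxx /= ltnS leq_eqVlt.
  have [->|ji] := eqVneq j i; first by rewrite /= eqxx ltnn mulr1 add0r.
  rewrite mulr0 addr0 (_ : (j : nat) == k = false)//.
  by apply/negbTE; apply: contra ji => /eqP ji; apply/eqP/val_inj.
pose u (t : R) := g (v + hk k + t *: unit_row i).
have uin (t : R) : `|t| <= `|h ord0 i| -> O (v + hk k + t *: unit_row i) /\
    forall j : 'I_n, `|partial j g v - partial j g (v + hk k + t *: unit_row i)| < e.
  move=> th; rewrite -addrA; apply: near_v => j; rewrite !mxE eqxx /=.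
  have [->|ji] := eqVneq j i; first by rewrite /= ltnn mulr1 add0r; exact: le_lt_trans (hdl i).
  by rewrite mulr0 addr0; case: ifP => // _; rewrite normr0.
have du (t : R) : `|t| <= `|h ord0 i| ->
    is_derive t 1 u (partial i g (v + hk k + t *: unit_row i)).
  move=> /uin[Ot _]; apply: is_derive_shift.
  have [dg _] := gC i; have := derivable_is_derive (dg _ Ot).
  by apply: is_derive_near; near=> s; rewrite /u scalerDl addrA.
have [t /uin[_ /(_ i) tc]] := mean_value du.
rewrite /u scale0r addr0 -addrA -hkS => gE.
rewrite !split_sum mulrDr.
have := IH (ltnW kn); set S := \sum_(_ | _) _; set S' := \sum_(_ | _) _ => hS.
have -> : g (v + hk k.+1) - g v - (partial i g v * h ord0 i + S) =
    (partial i g (v + hk k + t *: unit_row i) - partial i g v) * h ord0 i +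
    (g (v + hk k) - g v - S) by rewrite mulrBl -gE; ring.
apply: le_trans (ler_normD _ _) _; apply: lerD hS.
by rewrite normrM ler_wpM2r// distrC ltW.
Unshelve. all: by end_near.
Qed.

Lemma C1_chain g O (gam : R -> 'rV[R]_n) (d : 'I_n -> R) : open O -> Ck 1 g O ->
  O (gam 0) -> (forall j, is_derive (0 : R) 1 (fun t => gam t ord0 j) (d j)) ->
  is_derive (0 : R) 1 (fun t => g (gam t)) (\sum_j partial j g (gam 0) * d j).
Proof.
move=> oO gC Og dg; apply/is_derive_epsP => e e0.
(* [K] bounds both the partial derivatives, which multiply the error of the coordinates,
   and the speed of [gam], which multiplies the error of the expansion of [g] *)
pose K := \sum_j (`|partial j g (gam 0)| + `|d j| + 1) + 1.
have K0 : 0 < K by rewrite ltr_wpDl// sumr_ge0// => j _; rewrite !addr_ge0.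
pose e1 := Num.min 1 (e / (2 * K)).
have e10 : 0 < e1 by rewrite lt_min ltr01 divr_gt0// mulr_gt0.
have [dl dl0 gT] := C1_taylor oO gC Og (divr_gt0 e0 (mulr_gt0 (ltr0Sn R 1) K0)).
pose good (j : 'I_n) : set R := [set t | `|gam t ord0 j - gam 0 ord0 j| < dl /\
    `|gam t ord0 j - gam 0 ord0 j - t * d j| <= e1 * `|t|].
have : nbhs (0 : R) [set t | forall j, good j t].
  apply: (@filter_forall _ _ good (nbhs (0 : R)) _) => j.
  have /is_derive_epsP/(_ e1 e10)[dj dj0 hj] := dg j.
  have k0 : 0 < `|d j| + 1 by rewrite ltr_wpDl.
  apply/nbhs_ballP; exists (Num.min dj (dl / (`|d j| + 1 + 1))) => /=.
    by rewrite lt_min dj0 divr_gt0// addr_gt0.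
  move=> t; rewrite /ball /= sub0r normrN lt_min => /andP[t1 t2].
  have := hj t t1; rewrite add0r => H; split=> //.
  have -> : gam t ord0 j - gam 0 ord0 j = gam t ord0 j - gam 0 ord0 j - t * d j + t * d j by ring.
  apply: le_lt_trans (ler_normD _ _) _.
  move: t2; rewrite ltr_pdivlMr ?(addr_gt0 k0 ltr01)// => t2.
  rewrite normrM; apply: le_lt_trans t2.
  have : e1 * `|t| <= `|t| by rewrite ler_piMl// ge_min lexx.
  have := normr_ge0 t; have := normr_ge0 (d j); lra.
move=> /nbhs_ballP[r /= r0 hr]; exists r => // t tr; rewrite add0r.
have {hr}hr : forall j : 'I_n, `|gam t ord0 j - gam 0 ord0 j| < dl /\
    `|gam t ord0 j - gam 0 ord0 j - t * d j| <= e1 * `|t|.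
  by apply: hr; rewrite /ball /= sub0r normrN.
pose h := gam t - gam 0.
have hE j : h ord0 j = gam t ord0 j - gam 0 ord0 j by rewrite !mxE.
have hj j : `|h ord0 j| <= (`|d j| + 1) * `|t|.
  rewrite hE (_ : _ - _ = (gam t ord0 j - gam 0 ord0 j - t * d j) + t * d j); last by ring.
  apply: le_trans (ler_normD _ _) _; rewrite normrM.
  have : e1 * `|t| <= `|t| by rewrite ler_piMl// ge_min lexx.
  have := (hr j).2; lra.
have gE : gam t = gam 0 + h by rewrite addrC subrK.
have := gT h (fun j => eq_ind_r (fun z => `|z| < dl) (hr j).1 (hE j)).
rewrite -gE => T1.
have -> : g (gam t) - g (gam 0) - t * (\sum_j partial j g (gam 0) * d j) =
  (g (gam t) - g (gam 0) - \sum_j partial j g (gam 0) * h ord0 j) +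
  \sum_j partial j g (gam 0) * (h ord0 j - t * d j).
  have -> : \sum_j partial j g (gam 0) * (h ord0 j - t * d j) =
      \sum_j partial j g (gam 0) * h ord0 j - t * \sum_j partial j g (gam 0) * d j.
    by rewrite mulr_sumr -sumrB; apply: eq_bigr => j _; ring.
  by rewrite addrA subrK.
apply: le_trans (ler_normD _ _) _.
have S1 : \sum_j `|h ord0 j| <= K * `|t|.
  apply: (@le_trans _ _ (\sum_j (`|partial j g (gam 0)| + `|d j| + 1) * `|t|)).
    apply: ler_sum => j _; apply: le_trans (hj j) _; rewrite ler_wpM2r//.
    by rewrite lerD2r lerDr.
  by rewrite -mulr_suml ler_wpM2r// /K lerDl.
have S2 : `|\sum_j partial j g (gam 0) * (h ord0 j - t * d j)| <= K * (e / (2 * K) * `|t|).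
  apply: le_trans (ler_norm_sum _ _ _) _.
  apply: (@le_trans _ _ (\sum_j (`|partial j g (gam 0)| + `|d j| + 1) * (e / (2 * K) * `|t|))).
    apply: ler_sum => j _; rewrite normrM; apply: ler_pM => //.
      by rewrite -addrA lerDl addr_ge0.
    rewrite hE; apply: le_trans (hr j).2 _; rewrite ler_wpM2r//.
    by rewrite ge_min lexx orbT.
  rewrite -mulr_suml ler_wpM2r//; last by rewrite /K lerDl.
  by rewrite mulr_ge0// divr_ge0 ?(ltW e0)// mulr_ge0// ltW.
have eK : e = e / (2 * K) * K + K * (e / (2 * K)) by field; exact: lt0r_neq0.
rewrite [in leRHS]eK mulrDl; apply: lerD.
  apply: le_trans T1 _; rewrite -mulrA ler_wpM2l//.
  by rewrite divr_ge0 ?(ltW e0)// mulr_ge0// ltW.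
by rewrite -mulrA.
Qed.

End Chain_rule.

Section Flow_derivative.
Variables (R : realType) (X : ptopologicalType) (n : nat) (A : set (chart R X n)).
Variable F : R -> X -> X.
Hypotheses (A_atlas : smooth_atlas A) (FC1 : C1_flow A F).

Lemma continuous_near_eq (f h : X -> R) (x : X) : (\forall y \near x, f y = h y) ->
  {for x, continuous h} -> {for x, continuous f}.
Proof.
move=> fh ch V; rewrite (nbhs_singleton fh) => /ch hV.
by apply: filterS2 fh hV => y /= ->.
Qed.

Lemma for_continuous_sum (I : Type) (s : seq I) (u : I -> X -> R) (x : X) :
  (forall i, {for x, continuous (u i)}) ->
  {for x, continuous (fun y => \sum_(i <- s) u i y)}.
Proof.
move=> cu; elim: s => [|i s IH].
  have -> : (fun y => \sum_(i <- [::]) u i y) = (fun=> 0).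
    by apply/funext => y; rewrite big_nil.
  exact: cvg_cst.
have -> : (fun y => \sum_(j <- i :: s) u j y) = (fun y => u i y + \sum_(j <- s) u j y).
  by apply/funext => y; rewrite big_cons.
exact: cvgD (cu i) IH.
Qed.

Lemma flow_stays x (D : set X) : open D -> D x -> \forall t \near (0 : R), D (F t x).
Proof.
have [F0 _ cF _] := FC1; move=> oD Dx.
have /(cF (0, x))[[A1 A2] /= [n1 n2] sub] : nbhs (F 0 x) D by rewrite F0; exact: open_nbhs_nbhs.
by apply: filterS n1 => s A1s; exact: (sub (s, x) (conj A1s (nbhs_singleton n2))).
Qed.

(** In a chart, [L] is the sum of the products of the partial derivatives of [f] with the
    components of the vector field. The latter are partial derivatives in time of the flow
    read in the chart, hence continuous. *)
Lemma C1_fun_chart f c : C1_fun A f -> A c -> exists L : X -> R, forall x, cdom c x ->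
  [/\ is_derive (0 : R) 1 (fun t => f (F t x)) (L x), {for x, continuous L} &
      {for x, continuous f}].
Proof.
move=> fC1 Ac; have [F0 FD cF FC] := FC1.
have [oD oI cK cC _] := let: And3 H _ _ := A_atlas in H c Ac.
pose g v := f (cinv c v); have gC : Ck 1 g (cimg c) by exact: fC1.
pose P (j : 'I_n) (v : 'rV[R]_(1 + n)) : R :=
  cmap c (F (lsubmx v ord0 ord0) (cinv c (rsubmx v))) ord0 j.
have PC j := FC c c Ac Ac j.
pose emb x : 'rV[R]_(1 + n) := row_mx (0 : 'rV_1) (cmap c x).
have lemb x : lsubmx (emb x) ord0 ord0 = 0 by rewrite row_mxKl mxE.
have remb x : rsubmx (emb x) = cmap c x by rewrite row_mxKr.
have imc x : cdom c x -> cimg c (cmap c x) by move=> Dx; exists x.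
have Oemb x : cdom c x -> cimg c (rsubmx (emb x)) /\
    cdom c (F (lsubmx (emb x) ord0 ord0) (cinv c (rsubmx (emb x)))).
  by move=> Dx; rewrite lemb remb cK// F0; split=> //; exact: imc.
have cemb x : cdom c x -> {for x, continuous emb}.
  move=> Dx V /nbhs_ballP[e /= e0 be].
  have nb : nbhs (cmap c x) (ball (cmap c x) e) by exact: nbhsx_ballx.
  apply: (@filterS _ (nbhs x) _ [set y | ball (cmap c x) e (cmap c y)]); last exact: cC nb.
  move=> y [_ /= by_]; apply: be; split=> // i j.
  by rewrite !mxE; case: (fintype.split j) => k; [exact: ballxx|exact: by_].
pose i0 : 'I_(1 + n) := ord0.
have lD (v w : 'rV[R]_(1 + n)) : lsubmx (v + w) ord0 ord0 = lsubmx v ord0 ord0 + lsubmx w ord0 ord0.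
  by rewrite !mxE.
have rD (v w : 'rV[R]_(1 + n)) (k : 'I_n) : rsubmx (v + w) ord0 k = rsubmx v ord0 k + w ord0 (rshift 1 k).
  by rewrite !mxE.
exists (fun x => \sum_j partial j g (cmap c x) * partial i0 (P j) (emb x)) => x Dx.
have gE : \forall y \near x, f y = g (cmap c y).
  have : nbhs x (cdom c) by exact: open_nbhs_nbhs.
  by apply: filterS => y Dy; rewrite /g cK.
split.
- apply: (@is_derive_near _ (fun t => g (cmap c (F t x)))).
    by apply: filterS (flow_stays oD Dx) => t Dt; rewrite /g cK.
  have := @C1_chain _ _ g (cimg c) (fun t => cmap c (F t x))
    (fun j => partial i0 (P j) (emb x)) oI gC; rewrite F0; apply; first exact: imc.
  move=> j; have [_ PCj] := PC j; have [dP _] := PCj i0.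
  have := derivable_is_derive (dP _ (Oemb x Dx)).
  apply: is_derive_near; near=> t; congr (cmap c (F _ _) ord0 j).
    by rewrite lD lemb add0r !mxE (_ : lshift n ord0 == i0 = true) ?mulr1.
  rewrite -[RHS](cK x Dx); congr (cinv c _).
  apply/rowP => k; rewrite rD remb.
  have -> : (t *: delta_mx ord0 i0 : 'rV[R]_(1 + n)) ord0 (rshift 1 k) = 0.
    by rewrite !mxE (_ : rshift 1 k == i0 = false) ?andbF ?mulr0//; apply/negbTE.
  exact: addr0.
- apply: for_continuous_sum => j; apply: cvgM.
    have [_ gC1] := gC; have [_ [cg _]] := gC1 j.
    exact: (continuous_comp (cC x Dx) (cg _ (imc x Dx))).
  have [_ PCj] := PC j; have [_ [cP _]] := PCj i0.
  exact: (continuous_comp (cemb x Dx) (cP _ (Oemb x Dx))).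
- apply: continuous_near_eq gE _.
  exact: (continuous_comp (cC x Dx) (gC.1 _ (imc x Dx))).
Unshelve. all: by end_near.
Qed.

Definition flow_deriv (f : X -> R) (x : X) : R := derive1 (fun t => f (F t x)) 0.

(** Charts cover the space, and the group law moves time 0 to any time. *)
Lemma C1_fun_flow f : C1_fun A f -> [/\ continuous f,
  forall x t, is_derive (t : R) 1 (fun s => f (F s x)) (flow_deriv f (F t x)) &
  continuous (flow_deriv f)].
Proof.
move=> fC1; have [F0 FD _ _] := FC1; have [charts cover _] := A_atlas.
have loc x : exists2 L : X -> R, is_derive (0 : R) 1 (fun t => f (F t x)) (L x) &
    [/\ {for x, continuous L}, {for x, continuous f} &
    \forall y \near x, flow_deriv f y = L y].
  have [c Ac cx] := cover x; have [L HL] := C1_fun_chart fC1 Ac.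
  have [dL cL cf] := HL x cx; exists L => //; split=> //.
  have [oD _ _ _ _] := charts c Ac.
  have : nbhs x (cdom c) by exact: open_nbhs_nbhs.
  by apply: filterS => y /HL[dy _ _]; exact: is_derive_derive1.
split.
- by move=> x; have [L _ [_ cf _]] := loc x; exact: cf.
- move=> x t; apply: is_derive_shift; have [L dL _] := loc (F t x).
  have E : (fun s => f (F s (F t x))) = (fun s => f (F (t + s) x)).
    by apply/funext => s; rewrite addrC FD.
  by rewrite -E; rewrite /flow_deriv (is_derive_derive1 dL).
- by move=> x; have [L _ [cL _ eL]] := loc x; exact: continuous_near_eq eL cL.
Qed.

Lemma compact_bounded_fun (f : X -> R) : compact [set: X] -> continuous f ->
  exists2 K : R, 0 <= K & forall x, `|f x| <= K.
Proof.
move=> cX cf; have := continuous_compact (continuous_subspaceT cf) cX.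
move=> /compact_bounded[M [_ HM]]; exists (Num.max 0 (M + 1)).
  by rewrite le_max lexx.
move=> x; apply: (@le_trans _ _ (M + 1)); last by rewrite le_max lexx orbT.
by apply: HM; [rewrite ltrDl|exists x].
Qed.

End Flow_derivative.

(** * Diagonalisation by the transfer matrix *)

Section Matrix_algebra.
Variable R : realType.
Local Notation Re := (@complex.Re R).
Local Notation Im := (@complex.Im R).
Local Notation normc := (@Normc.normc R).
Local Notation M2 := 'M[R[i]]_2.
Implicit Types (U V Z P : 'M[R[i]]_2) (g z : SU2 R) (rho : R).

Definition ReIm := (@ReD R, @ImD R, @ReM R, @ImM R, @ReN R, @ImN R, @Re_conj R, @Im_conj R).

Lemma mx2P U V : U ord0 ord0 = V ord0 ord0 -> U ord0 ord_max = V ord0 ord_max ->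
  U ord_max ord0 = V ord_max ord0 -> U ord_max ord_max = V ord_max ord_max -> U = V.
Proof.
move=> h1 h2 h3 h4; apply/matrixP => i j.
by have [->|->] := ord2P i; have [->|->] := ord2P j.
Qed.

Lemma mul2E U V i j : (U *m V) i j = U i ord0 * V ord0 j + U i ord_max * V ord_max j.
Proof. by rewrite mxE sum_ord2. Qed.

Lemma adjE Z i j : adjmx Z i j = conjc (Z j i).
Proof. by rewrite mxE mxE. Qed.

Lemma adjM U V : adjmx (U *m V) = adjmx V *m adjmx U.
Proof. by rewrite /adjmx trmx_mul map_mxM. Qed.

Lemma adjK Z : adjmx (adjmx Z) = Z.
Proof. by apply/matrixP => i j; rewrite !adjE conjcK. Qed.

Lemma det2E Z : \det Z = Z ord0 ord0 * Z ord_max ord_max - Z ord0 ord_max * Z ord_max ord0.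
Proof.
rewrite (expand_det_row _ ord0) sum_ord2 /cofactor !det_mx11 !mxE /=.
have -> : lift ord0 (0 : 'I_1) = ord_max :> 'I_2 by apply: val_inj.
have -> : lift ord_max (0 : 'I_1) = ord0 :> 'I_2 by apply: val_inj.
by rewrite expr0 mul1r addn1 expr1 mulN1r mulrN.
Qed.

(** The real span of SU(2): the second row is determined by the first one. *)
Definition quaternion Z :=
  Z ord_max ord_max = conjc (Z ord0 ord0) /\ Z ord_max ord0 = - conjc (Z ord0 ord_max).

Lemma quaternion_mul U V : quaternion U -> quaternion V -> quaternion (U *m V).
Proof.
move=> [U11 U10] [V11 V10]; split; rewrite !mul2E U11 U10 V11 V10;
  by apply: complex_eqP; rewrite !ReIm; ring.
Qed.

Lemma quaternionB U V : quaternion U -> quaternion V -> quaternion (U - V).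
Proof.
move=> [U11 U10] [V11 V10].
have BE i j : (U - V) i j = U i j - V i j by rewrite !mxE.
by split; rewrite !BE ?U11 ?U10 ?V11 ?V10; apply: complex_eqP; rewrite !ReIm; ring.
Qed.

Lemma quaternion_adj U : quaternion U -> quaternion (adjmx U).
Proof.
move=> [U11 U10]; split; rewrite !adjE ?U11 ?U10.
  by apply: complex_eqP; rewrite !ReIm.
by apply: complex_eqP; rewrite !ReIm; ring.
Qed.

Lemma quaternion_su2 Z : in_su2 Z -> quaternion Z /\ Re (Z ord0 ord0) = 0.
Proof.
move=> [aZ tZ].
have e i j : conjc (Z j i) = - Z i j by rewrite -adjE aZ mxE.
have r0 : Re (Z ord0 ord0) = 0.
  have := congr1 Re (e ord0 ord0); rewrite Re_conj ReN; lra.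
split=> //; split; last by rewrite e opprK.
move: tZ; rewrite /mxtrace sum_ord2 => /eqP; rewrite addrC addr_eq0 => /eqP ->.
by rewrite e.
Qed.

(** The three relations [h1], [h2], [h3] say that the matrix is unitary with determinant 1,
    and the second row is solved from them. *)
Lemma quaternion_SU2 g : quaternion (su2val g).
Proof.
set a := g ord0 ord0; set b := g ord0 ord_max; set c := g ord_max ord0; set d := g ord_max ord_max.
have h1 : a * conjc a + b * conjc b = 1.
  by have := congr1 (fun M : M2 => M ord0 ord0) (su2_adjr g); rewrite mul2E !adjE mxE.
have h2 : c * conjc a + d * conjc b = 0.
  by have := congr1 (fun M : M2 => M ord_max ord0) (su2_adjr g); rewrite mul2E !adjE mxE.
have h3 : a * d - b * c = 1 by rewrite -(su2_det g) det2E.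
rewrite /quaternion -/a -/b -/c -/d.
move: (conjc a) (conjc b) h1 h2 => a' b' h1 h2; split; apply/eqP.
  rewrite -subr_eq0; apply/eqP.
  have -> : d - a' = d * (1 - (a * a' + b * b')) + a' * ((a * d - b * c) - 1) + b * (c * a' + d * b').
    by ring.
  by rewrite h1 h2 h3 !subrr !mulr0 !addr0.
rewrite -subr_eq0 opprK; apply/eqP.
have -> : c + b' = c * (1 - (a * a' + b * b')) + a * (c * a' + d * b') - b' * ((a * d - b * c) - 1).
  by ring.
by rewrite h1 h2 h3 !subrr !mulr0 addr0 subr0.
Qed.

Definition imdiag rho : M2 := mx22 (0 +i* rho) 0 0 (0 +i* - rho).

Lemma su2_ip_quaternion U V : quaternion U -> quaternion V -> su2_ip U V =
  Re (U ord0 ord0 * conjc (V ord0 ord0)) + Re (U ord0 ord_max * conjc (V ord0 ord_max)).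
Proof.
move=> [U11 U10] [V11 V10]; rewrite /su2_ip.
have -> : (2%:R^-1 : R[i]) = (2^-1 : R)%:C by rewrite fmorphV rmorph_nat.
rewrite ReM ReC ImC mul0r subr0 /mxtrace sum_ord2 !mul2E !adjE U11 U10 V11 V10.
by rewrite !ReIm; field.
Qed.

(** The scalar product is invariant under conjugation, and for quaternions the pairing with
    [imdiag rho] only sees the first diagonal entry. *)
Lemma su2_ip_conj z U P rho : quaternion U ->
  su2val z *m P *m adjmx z = imdiag rho ->
  su2_ip U P = rho * Im ((su2val z *m U *m adjmx z) ord0 ord0).
Proof.
move=> qU zP; pose W := su2val z *m U *m adjmx z.
have qW : quaternion W.
  by apply: quaternion_mul; [apply: quaternion_mul => //|apply: quaternion_adj]; exact: quaternion_SU2.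
have trE : \tr (U *m adjmx P) = \tr (W *m adjmx (imdiag rho)).
  rewrite -zP !adjM adjK /W mulmxA -(mulmxA _ (adjmx z) (su2val z)) su2_adjl mulmx1.
  by rewrite mulmxA [RHS]mxtrace_mulC !mulmxA su2_adjl mul1mx.
rewrite -/W /su2_ip trE -/(su2_ip W (imdiag rho)) su2_ip_quaternion//; last first.
  by split; rewrite !mxE /=; apply: complex_eqP => /=; rewrite ?oppr0.
by rewrite !mxE /= !ReIm /=; ring.
Qed.

(** The two eigenvalues of [imdiag rho] differ. *)
Lemma diag_of_comm rho g : rho != 0 ->
  su2val g *m imdiag rho = imdiag rho *m su2val g -> su2_diag g.
Proof.
move=> r0 gD; split.
  have := congr1 (fun M : M2 => M ord0 ord_max) gD; rewrite !mul2E !mxE /= => e.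
  have /= e1 := congr1 Re e; have /= e2 := congr1 Im e.
  move: e1 e2; rewrite !ReIm /= => e1 e2.
  apply: complex_eqP => /=; apply: (mulfI r0); rewrite mulr0; lra.
have := congr1 (fun M : M2 => M ord_max ord0) gD; rewrite !mul2E !mxE /= => e.
have /= e1 := congr1 Re e; have /= e2 := congr1 Im e.
move: e1 e2; rewrite !ReIm /= => e1 e2.
apply: complex_eqP => /=; apply: (mulfI r0); rewrite mulr0; lra.
Qed.

(** With [N = |b + i c|], the norm condition reads [N^2 = (rho - a) (rho + a)]. It gives the
    identities [k1] and [k2] between [N] and the two square roots [sp], [sm], from which each
    entry of the matrix equation follows by linear arithmetic. If [a = rho] or [a = - rho],
    then [Z] is already diagonal. *)
Lemma transfer_diag rho Z : 0 < rho -> in_su2 Z -> su2_norm Z = rho ->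
  transfer rho Z *m Z = imdiag rho *m transfer rho Z.
Proof.
move=> rho0 sZ nZ; have [qZ Z00r] := quaternion_su2 sZ; have [Z11 Z10] := qZ.
set a := Im (Z ord0 ord0); set b := Re (Z ord0 ord_max); set c := Im (Z ord0 ord_max).
have r0 : rho != 0 by exact: lt0r_neq0.
have sum2 : a ^+ 2 + (b ^+ 2 + c ^+ 2) = rho ^+ 2.
  rewrite -nZ /su2_norm su2_ip_quaternion// !ReIm Z00r -/a -/b -/c sqr_sqrtr; first by ring.
  by rewrite (_ : _ + _ = a ^+ 2 + (b ^+ 2 + c ^+ 2)) ?addr_ge0 ?sqr_ge0//; ring.
have Z00 : Z ord0 ord0 = 0 +i* a by apply: complex_eqP.
have Z01 : Z ord0 ord_max = b +i* c by apply: complex_eqP.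
have Z10' : Z ord_max ord0 = (- b) +i* c.
  by rewrite Z10 Z01; apply: complex_eqP => /=; rewrite ?opprK.
have Z11' : Z ord_max ord_max = 0 +i* (- a) by rewrite Z11 Z00.
rewrite /transfer -/a -/b -/c; case: ifPn => [/eqP aN|aN].
  have b0 : b = 0 by apply/eqP; rewrite -sqrf_eq0; have := sqr_ge0 b; have := sqr_ge0 c; move: sum2; rewrite aN sqrrN => ? ? ?; apply/eqP; lra.
  have c0 : c = 0 by apply/eqP; rewrite -sqrf_eq0; have := sqr_ge0 b; have := sqr_ge0 c; move: sum2; rewrite aN sqrrN => ? ? ?; apply/eqP; lra.
  apply: mx2P; rewrite !mul2E ?Z00 ?Z01 ?Z10' ?Z11' !mxE /= ?b0 ?c0 ?aN;
  by apply: complex_eqP; rewrite !ReIm /=; ring.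
case: ifPn => [/eqP aP|aP].
  have b0 : b = 0 by apply/eqP; rewrite -sqrf_eq0; have := sqr_ge0 b; have := sqr_ge0 c; move: sum2; rewrite aP => ? ? ?; apply/eqP; lra.
  have c0 : c = 0 by apply/eqP; rewrite -sqrf_eq0; have := sqr_ge0 b; have := sqr_ge0 c; move: sum2; rewrite aP => ? ? ?; apply/eqP; lra.
  rewrite mul1mx mulmx1; apply: mx2P; rewrite ?Z00 ?Z01 ?Z10' ?Z11' ?mxE /= ?b0 ?c0 ?aP //.
  by apply: complex_eqP => /=; rewrite ?oppr0.
set sp : R := Num.sqrt _; set sm : R := Num.sqrt _.
pose N : R := Num.sqrt (b ^+ 2 + c ^+ 2).
have bc0 : 0 <= b ^+ 2 + c ^+ 2 by rewrite addr_ge0 ?sqr_ge0.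
have N2 : N ^+ 2 = b ^+ 2 + c ^+ 2 by rewrite sqr_sqrtr.
have N0 : 0 < N.
  rewrite sqrtr_gt0 lt_neqAle bc0 andbT eq_sym; apply/negP => /eqP bc.
  have /eqP : a ^+ 2 = rho ^+ 2 by rewrite -sum2 bc addr0.
  by rewrite eqf_sqr (negbTE aN) (negbTE aP).
have arho : a ^+ 2 <= rho ^+ 2 by rewrite -sum2 lerDl.
have [ap am] : 0 <= rho + a /\ 0 <= rho - a.
  have : `|a| <= rho by rewrite -(ger0_norm (ltW rho0)) -ler_sqr ?nnegrE// !real_normK ?num_real.
  by rewrite ler_norml => /andP[? ?]; split; lra.
have pa : 0 < 2 * rho by rewrite mulr_gt0.
have sp2 : sp ^+ 2 = (rho + a) / (2 * rho) by rewrite sqr_sqrtr// divr_ge0// ltW.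
have sm2 : sm ^+ 2 = (rho - a) / (2 * rho) by rewrite sqr_sqrtr// divr_ge0// ltW.
have sp0 : 0 <= sp by exact: sqrtr_ge0.
have sm0 : 0 <= sm by exact: sqrtr_ge0.
have N2' : N ^+ 2 = (rho - a) * (rho + a) by rewrite N2; move: sum2; lra.
have k1 : sm * N = sp * (rho - a).
  apply/eqP; rewrite -(@eqrXn2 R 2)// ?mulr_ge0 ?(ltW N0)// !exprMn sm2 sp2 N2'.
  by apply/eqP; field.
have k2 : sp * N = sm * (rho + a).
  apply/eqP; rewrite -(@eqrXn2 R 2)// ?mulr_ge0 ?(ltW N0)// !exprMn sm2 sp2 N2'.
  by apply/eqP; field.
pose p := b / N; pose q := c / N.
have nN : N != 0 by exact: lt0r_neq0.
have bE : b = N * p by rewrite /p mulrC divfK.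
have cE : c = N * q by rewrite /q mulrC divfK.
have pq : p ^+ 2 + q ^+ 2 = 1.
  by rewrite /p /q !expr_div_n -mulrDl -N2 divff// expf_neq0.
have absE : `|b +i* c : R[i]| = N%:C by [].
have e0 : ('i * sp%:C * ((b +i* c)^* / `|b +i* c|) : R[i]) = (sp * q) +i* (sp * p).
  rewrite absE -[N%:C^-1](fmorphV (real_complex R)) /=.
  rewrite /p /q; apply: complex_eqP => /=; ring.
have e1 : ('i * sp%:C * ((b +i* c) / `|b +i* c|) : R[i]) = (- (sp * q)) +i* (sp * p).
  rewrite absE -[N%:C^-1](fmorphV (real_complex R)) /=.
  rewrite /p /q; apply: complex_eqP => /=; ring.
rewrite e0 e1.
have k1p : sm * N * p = sp * (rho - a) * p by rewrite k1.
have k1q : sm * N * q = sp * (rho - a) * q by rewrite k1.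
have k2p : sp * N * (p ^+ 2 + q ^+ 2) = sm * (rho + a) by rewrite pq mulr1.
move: (sp) (sm) (N) (p) (q) bE cE k1p k1q k2p => sp' sm' N' p' q' bE cE k1p k1q k2p.
apply: mx2P; rewrite !mul2E ?Z00 ?Z01 ?Z10' ?Z11' !mxE /= ?bE ?cE;
  apply: complex_eqP; rewrite !ReIm /=; lra.
Qed.

End Matrix_algebra.

(** * Matrix functions along the flow *)

Section C1_along_flow.
Variables (R : realType) (X : ptopologicalType) (n : nat) (A : set (chart R X n)).
Variable F : R -> X -> X.
Hypotheses (A_atlas : smooth_atlas A) (FC1 : C1_flow A F).
Local Notation Re := (@complex.Re R).
Local Notation Im := (@complex.Im R).
Local Notation M2 := 'M[R[i]]_2.

Lemma continuous_flow s : continuous (F s).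
Proof.
have [_ _ cF _] := FC1.
exact: continuous_time_map.
Qed.

Lemma continuous_orbit x : continuous (F ^~ x).
Proof.
have [_ _ cF _] := FC1.
exact: continuous_orbit_map.
Qed.

(** Continuous differentiability along the flow only, which, unlike differentiability in
    charts, is directly seen to be stable under composition with the flow maps. *)
Definition rC1 (f df : X -> R) := [/\ continuous f, continuous df &
  forall x t, is_derive (t : R) 1 (fun s => f (F s x)) (df (F t x))].

Lemma rC1D f df g dg : rC1 f df -> rC1 g dg ->
  rC1 (fun x => f x + g x) (fun x => df x + dg x).
Proof.
move=> [cf cdf Df] [cg cdg Dg]; split.
- by move=> x; apply: cvgD; [exact: cf|exact: cg].
- by move=> x; apply: cvgD; [exact: cdf|exact: cdg].
- by move=> x t; exact: is_deriveD (Df x t) (Dg x t).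
Qed.

Lemma rC1N f df : rC1 f df -> rC1 (fun x => - f x) (fun x => - df x).
Proof.
move=> [cf cdf Df]; split.
- by move=> x; apply: cvgN; exact: cf.
- by move=> x; apply: cvgN; exact: cdf.
- by move=> x t; exact: is_deriveN (Df x t).
Qed.

Lemma rC1M f df g dg : rC1 f df -> rC1 g dg ->
  rC1 (fun x => f x * g x) (fun x => df x * g x + f x * dg x).
Proof.
move=> [cf cdf Df] [cg cdg Dg]; split.
- by move=> x; apply: cvgM; [exact: cf|exact: cg].
- by move=> x; apply: cvgD; apply: cvgM; [exact: cdf|exact: cg|exact: cf|exact: cdg].
- move=> x t; have H := is_deriveM (Df x t) (Dg x t).
  have e : f (F t x) *: dg (F t x) + g (F t x) *: df (F t x) =
      df (F t x) * g (F t x) + f (F t x) * dg (F t x) by rewrite /GRing.scale /=; ring.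
  by rewrite e in H; exact: H.
Qed.

Lemma rC1_comp s f df : rC1 f df -> rC1 (fun x => f (F s x)) (fun x => df (F s x)).
Proof.
have [_ FD _ _] := FC1.
have comm u x : F s (F u x) = F u (F s x).
  by rewrite -[LHS]/((F s \o F u) x) -FD addrC FD.
move=> [cf cdf Df]; split.
- move=> x; exact: continuous_comp (@continuous_flow s x) (cf (F s x)).
- move=> x; exact: continuous_comp (@continuous_flow s x) (cdf (F s x)).
- move=> x t; rewrite comm.
  have -> : (fun u => f (F s (F u x))) = (fun u => f (F u (F s x))).
    by apply/funext => u; rewrite comm.
  exact: Df.
Qed.

Lemma rC1_fun f : C1_fun A f -> rC1 f (flow_deriv F f).
Proof. by move=> /(C1_fun_flow A_atlas FC1)[]. Qed.

Lemma rC1_unique f df x : rC1 f df -> flow_deriv F f x = df x.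
Proof.
have [F0 _ _ _] := FC1; move=> [_ _ /(_ x 0)]; rewrite F0 /= => D.
exact: is_derive_derive1.
Qed.

Definition ccont (u : X -> R[i]) :=
  continuous (fun x => Re (u x)) /\ continuous (fun x => Im (u x)).

Lemma ccontD u v : ccont u -> ccont v -> ccont (fun x => u x + v x).
Proof.
move=> [ur ui] [vr vi]; split=> x.
  by under eq_fun do rewrite ReD; apply: cvgD; [exact: ur|exact: vr].
by under eq_fun do rewrite ImD; apply: cvgD; [exact: ui|exact: vi].
Qed.

Lemma ccontM u v : ccont u -> ccont v -> ccont (fun x => u x * v x).
Proof.
move=> [ur ui] [vr vi]; split=> x.
  under eq_fun do rewrite ReM; apply: cvgB; apply: cvgM; 
  by [exact: ur|exact: vr|exact: ui|exact: vi].
under eq_fun do rewrite ImM; apply: cvgD; apply: cvgM;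
by [exact: ur|exact: vi|exact: ui|exact: vr].
Qed.

Lemma ccont_conj u : ccont u -> ccont (fun x => conjc (u x)).
Proof.
move=> [ur ui]; split=> x; first by under eq_fun do rewrite Re_conj; exact: ur.
by under eq_fun do rewrite Im_conj; apply: cvgN; exact: ui.
Qed.

Definition mcont (U : X -> M2) := forall i j, ccont (fun x => U x i j).

Lemma mcont_mul U V : mcont U -> mcont V -> mcont (fun x => U x *m V x).
Proof.
move=> cU cV i j; under eq_fun do rewrite mul2E.
by apply: ccontD; apply: ccontM.
Qed.

Lemma mcont_adj U : mcont U -> mcont (fun x => adjmx (U x)).
Proof. by move=> cU i j; under eq_fun do rewrite adjE; exact: ccont_conj. Qed.

Definition cC1 (u du : X -> R[i]) :=
  rC1 (fun x => Re (u x)) (fun x => Re (du x)) /\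
  rC1 (fun x => Im (u x)) (fun x => Im (du x)).

Lemma rC1_ext f df g dg : (forall x, f x = g x) -> (forall x, df x = dg x) ->
  rC1 f df -> rC1 g dg.
Proof. by move=> /funext -> /funext ->. Qed.

Lemma cC1D u du v dv : cC1 u du -> cC1 v dv ->
  cC1 (fun x => u x + v x) (fun x => du x + dv x).
Proof.
move=> [ur ui] [vr vi]; split.
  by apply: rC1_ext (rC1D ur vr) => x; rewrite ReD.
by apply: rC1_ext (rC1D ui vi) => x; rewrite ImD.
Qed.

Lemma cC1M u du v dv : cC1 u du -> cC1 v dv ->
  cC1 (fun x => u x * v x) (fun x => du x * v x + u x * dv x).
Proof.
move=> [ur ui] [vr vi]; split.
  apply: rC1_ext (rC1D (rC1M ur vr) (rC1N (rC1M ui vi))) => x; rewrite !ReIm //; ring.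
apply: rC1_ext (rC1D (rC1M ur vi) (rC1M ui vr)) => x; rewrite !ReIm //; ring.
Qed.

Lemma cC1_conj u du : cC1 u du -> cC1 (fun x => conjc (u x)) (fun x => conjc (du x)).
Proof.
move=> [ur ui]; split.
  by apply: rC1_ext ur => x; rewrite Re_conj.
by apply: rC1_ext (rC1N ui) => x; rewrite Im_conj.
Qed.

Lemma cC1_comp s u du : cC1 u du -> cC1 (fun x => u (F s x)) (fun x => du (F s x)).
Proof. by move=> [ur ui]; split; [exact: rC1_comp ur|exact: rC1_comp ui]. Qed.

Definition mC1 (U dU : X -> M2) := forall i j, cC1 (fun x => U x i j) (fun x => dU x i j).

Lemma cC1_ext u du v dv : (forall x, u x = v x) -> (forall x, du x = dv x) ->
  cC1 u du -> cC1 v dv.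
Proof. by move=> /funext -> /funext ->. Qed.

Lemma mC1_mul U dU V dV : mC1 U dU -> mC1 V dV ->
  mC1 (fun x => U x *m V x) (fun x => dU x *m V x + U x *m dV x).
Proof.
move=> cU cV i j.
apply: cC1_ext (cC1D (cC1M (cU i ord0) (cV ord0 j)) (cC1M (cU i ord_max) (cV ord_max j))) => x.
  by rewrite mul2E.
by rewrite [RHS]mxE !mul2E; ring.
Qed.

Lemma mC1_adj U dU : mC1 U dU -> mC1 (fun x => adjmx (U x)) (fun x => adjmx (dU x)).
Proof.
by move=> cU i j; apply: cC1_ext (cC1_conj (cU j i)) => x; rewrite adjE.
Qed.

Lemma mC1_comp s U dU : mC1 U dU -> mC1 (fun x => U (F s x)) (fun x => dU (F s x)).
Proof. by move=> cU i j; exact: cC1_comp (cU i j). Qed.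

Lemma mC1_cont U dU : mC1 U dU -> mcont U /\ mcont dU.
Proof. by move=> cU; split=> i j; have [[? ? _] [? ? _]] := cU i j. Qed.

Lemma mC1_SU2 (phi : X -> SU2 R) : C1_SU2 A phi ->
  mC1 (fun x => su2val (phi x)) (lieD F (fun x => su2val (phi x))).
Proof.
move=> C i j; have [/rC1_fun cr /rC1_fun ci] := C i j; split.
  by apply: rC1_ext cr => x //; rewrite mxE.
by apply: rC1_ext ci => x //; rewrite mxE.
Qed.

(** The quaternion relations are linear over the reals, so differentiation preserves
    them. *)
Lemma quaternion_lieD (phi : X -> SU2 R) x : C1_SU2 A phi ->
  quaternion (lieD F (fun y => su2val (phi y)) x).
Proof.
move=> C; have q y := quaternion_SU2 (phi y).
have dN f : C1_fun A f -> flow_deriv F (fun y => - f y) x = - flow_deriv F f x.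
  by move=> /rC1_fun/rC1N/rC1_unique ->.
have [C00r C00i] := C ord0 ord0; have [C01r C01i] := C ord0 ord_max.
split; rewrite !mxE; apply: complex_eqP => /=.
- by congr (derive1 _ 0); apply/funext => t; rewrite (q _).1 Re_conj.
- rewrite -[RHS](dN _ C00i); congr (derive1 _ 0); apply/funext => t.
  by rewrite (q _).1 Im_conj.
- rewrite -[RHS](dN _ C01r); congr (derive1 _ 0); apply/funext => t.
  by rewrite (q _).2 ReN Re_conj.
- rewrite opprK; congr (derive1 _ 0); apply/funext => t.
  by rewrite (q _).2 ImN Im_conj opprK.
Qed.

End C1_along_flow.

Section Degree_identity.
Variable R : realType.
Local Notation M2 := 'M[R[i]]_2.
Local Notation Im := (@complex.Im R).
Implicit Types (z p q : SU2 R) (B dz dp dq P : 'M[R[i]]_2).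

Lemma mulKl B q : B *m adjmx q *m su2val q = B.
Proof. by rewrite -mulmxA su2_adjl mulmx1. Qed.
Lemma mulKr B q : B *m su2val q *m adjmx q = B.
Proof. by rewrite -mulmxA su2_adjr mulmx1. Qed.

(** The logarithmic derivative of a product [d = z p q^-1] is the sum of those of its factors,
    each conjugated by the factors on its left. With [q = z o F_1], the first and the last
    term form a coboundary once [d] is diagonal. *)
Lemma log_derivative_conj z p q dz dp dq (d := su2val z *m su2val p *m adjmx q) :
  ((dz *m su2val p + su2val z *m dp) *m adjmx q + su2val z *m su2val p *m adjmx dq) *m adjmx d =
  dz *m adjmx z + su2val z *m (dp *m adjmx p) *m adjmx z +
  d *m adjmx (dq *m adjmx q) *m adjmx d.
Proof. by rewrite /d !adjM !adjK !mulmxDl !mulmxA !(mulKl, mulKr). Qed.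

(** If [p] intertwines [P'] and [P], then [z p q^-1] commutes with [imdiag rho]. *)
Lemma conj_diag z p q P P' rho : rho != 0 ->
  su2val z *m P *m adjmx z = imdiag rho ->
  su2val q *m P' *m adjmx q = imdiag rho ->
  su2val p *m P' *m adjmx p = P -> su2_diag (z * p * q^-1)%g.
Proof.
move=> r0 zP qP pP; apply: (diag_of_comm r0).
have -> : su2val (z * p * q^-1)%g = su2val z *m su2val p *m adjmx q by [].
rewrite -{1}qP -{1}zP -pP !mulmxA.
by rewrite !(mulKl, mulKr).
Qed.

Lemma diag_conj_entry d (B : M2) : su2_diag d ->
  (su2val d *m adjmx B *m adjmx d) ord0 ord0 = conjc (B ord0 ord0).
Proof.
move=> dd; have n1 := su2_diag_norm dd.
rewrite !mul2E !adjE dd.1 !mul0r conjc0 !mulr0 !addr0.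
by rewrite mulrAC mulcJ n1 expr1n mul1r.
Qed.

End Degree_identity.

(** * The diagonal cocycle and its mean rotation rate *)

Lemma measurable_if_set d (T : measurableType d) (R : realType) (E : set T) (f g : T -> R) : measurable E ->
  measurable_fun [set: T] f -> measurable_fun [set: T] g ->
  measurable_fun [set: T] (fun x => if pselect (E x) then f x else g x).
Proof.
move=> mE mf mg.
have -> : (fun x => if pselect (E x) then f x else g x) =
    (fun x => f x * \1_E x + g x * (1 - \1_E x)).
  apply/funext => x; rewrite indicE; case: pselect => h.
    by rewrite mem_set// mulr1 subrr mulr0 addr0.
  by rewrite memNset// mulr0 add0r subr0 mulr1.
apply: measurable_funD; apply: measurable_funM => //.
by apply: measurable_funB => //; exact: measurable_indic.
Qed.

Section Diagonal_cocycle.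
Variables (R : realType) (X : ptopologicalType) (n : nat) (A : set (chart R X n)).
Variables (m : probability (borel X) R) (F : R -> X -> X).
Hypotheses (X_compact : compact [set: X]) (X2 : @second_countable X).
Hypotheses (A_atlas : smooth_atlas A) (FC1 : C1_flow A F).
Hypothesis F_preserves : forall t : R, preserves (F t) m.
Variables (phi zeta : X -> SU2 R).
Hypotheses (phi_C1 : C1_SU2 A phi) (zeta_C1 : C1_SU2 A zeta).
Local Notation Re := (@complex.Re R).
Local Notation Im := (@complex.Im R).
Local Notation normc := (@Normc.normc R).
Local Notation delta := (conj_cocycle F phi zeta).
Local Notation dphi := (lieD F (fun y => su2val (phi y))).
Local Notation dzeta := (lieD F (fun y => su2val (zeta y))).

Lemma flow_mflow : mflow (T := borel X) m F.
Proof. by have [F0 FD cF _] := FC1; exact: continuous_mflow. Qed.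

Lemma ccont_bounded (u : X -> R[i]) : ccont u ->
  exists2 K : R, 0 <= K & forall x, normc (u x) <= K.
Proof.
move=> [cr ci]; have [K K0 rK] := compact_bounded_fun X_compact cr.
have [K' K0' iK] := compact_bounded_fun X_compact ci.
exists (K + K'); first exact: addr_ge0.
by move=> x; apply: le_trans (normc_le _) _; exact: lerD.
Qed.

Lemma ccont_mcf (u : X -> R[i]) : ccont u -> measurable_cfun (T := borel X) u.
Proof. by move=> [cr ci]; split; exact: continuous_borel_real. Qed.

Lemma ccont_Im_rint (u : X -> R[i]) : ccont u ->
  m.-integrable [set: borel X] (fun x => (Im (u x))%:E).
Proof.
move=> cu; have [K K0 uK] := ccont_bounded cu.
apply: (@bounded_rint _ (borel X) R m _ K); first exact: (ccont_mcf cu).2.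
by move=> x; apply: le_trans (Im_le_normc _) _.
Qed.

Let ddelta x := (dzeta x *m su2val (phi x) + su2val (zeta x) *m dphi x) *m adjmx (zeta (F 1 x)) +
  su2val (zeta x) *m su2val (phi x) *m adjmx (dzeta (F 1 x)).

Lemma delta_C1 : mC1 F (fun x => su2val (delta x)) ddelta.
Proof.
have pC := mC1_SU2 A_atlas FC1 phi_C1; have zC := mC1_SU2 A_atlas FC1 zeta_C1.
exact: (mC1_mul (mC1_mul zC pC) (mC1_adj (mC1_comp FC1 1 zC))).
Qed.

Lemma measurable_delta :
  measurable_fun [set: borel X] (delta : borel X -> borel (SU2 R)).
Proof.
apply: measurable_SU2 => i j; apply: ccont_mcf.
exact: (mC1_cont delta_C1).1.
Qed.

(** The set of points at whose whole orbit [delta] is diagonal. Rational times suffice by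
    continuity; they make the set measurable, and of full measure when [delta] is diagonal
    almost everywhere. *)
Definition diag_set : set X :=
  [set x | forall k : nat, su2_diag (delta (F (ratr (odflt 0 (unpickle k : option rat))) x))].

Let offdiag x := normc (delta x ord0 ord_max) ^+ 2 + normc (delta x ord_max ord0) ^+ 2.

Lemma offdiagP x : offdiag x = 0 <-> su2_diag (delta x).
Proof.
split=> [/eqP|[h1 h2]]; last by rewrite /offdiag h1 h2 Normc.normc0 expr0n addr0.
rewrite paddr_eq0 ?sqr_ge0// !sqrf_eq0 => /andP[/eqP h1 /eqP h2].
by split; exact: Normc.eq0_normc.
Qed.

Lemma continuous_offdiag : continuous offdiag.
Proof.
have [cd _] := mC1_cont delta_C1; have [ar ai] := cd ord0 ord_max; have [br bi] := cd ord_max ord0.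
rewrite /offdiag; move=> x; under eq_fun do rewrite !normc2E !expr2.
apply: cvgD; apply: cvgD; apply: cvgM;
  by [exact: ar|exact: ai|exact: br|exact: bi].
Qed.

Lemma diag_setP x : diag_set x <-> forall t, su2_diag (delta (F t x)).
Proof.
split=> [H t|H k]; last exact: H.
apply/offdiagP; apply: contrapT => /eqP ne0.
have ct : {for t, continuous (fun s => offdiag (F s x))}.
  exact: (continuous_comp (continuous_orbit FC1 (x := x) (x0 := t)) (@continuous_offdiag (F t x))).
have pos : 0 < `|offdiag (F t x)| by rewrite normr_gt0.
move/cvgrPdist_lt : ct => /(_ _ pos)/nbhs_ballP[e /= e0 he].
have [q] := @rat_in_itvoo R (t - e) (t + e) (ltac:(lra)).
rewrite in_itv/= => /andP[q1 q2].
have := he (ratr q); rewrite /ball /= => /(_ _)/wrap[].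
  by rewrite ltr_norml; apply/andP; split; lra.
have := H (pickle q); rewrite pickleK /= => /offdiagP ->.
by rewrite subr0 ltxx.
Qed.

Lemma diag_set_flow t x : diag_set (F t x) <-> diag_set x.
Proof.
have [F0 FD _ _] := FC1.
have D s u : F s (F u x) = F (s + u) x by rewrite FD.
split=> /diag_setP H; apply/diag_setP => s; last by rewrite D.
by have := H (s - t); rewrite D subrK.
Qed.

Lemma measurable_diag_set : measurable (diag_set : set (borel X)).
Proof.
have -> : diag_set = \bigcap_(k in [set: nat])
    [set x | offdiag (F (ratr (odflt 0 (unpickle k : option rat))) x) = 0].
  by apply/seteqP; split=> x H k; [move=> _; apply/offdiagP; exact: H|apply/offdiagP; exact: H].
apply: bigcapT_measurable => k.
set s : R := ratr _.
have cs : continuous (fun x => offdiag (F s x)).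
  by move=> x; exact: (continuous_comp (@continuous_flow _ _ _ _ _ FC1 s x) (@continuous_offdiag (F s x))).
have H := continuous_borel_real cs measurableT (measurable_set1 (0 : R)).
by rewrite setTI in H; exact: H.
Qed.

Lemma diag_set_ae : {ae m, forall x, su2_diag (delta x)} -> {ae m, forall x, diag_set x}.
Proof.
move=> H; apply: ae_foralln => k.
exact: (mpres_ae (mflow_mpres flow_mflow _) H).
Qed.

(** The diagonal entry and its logarithmic derivative, set to trivial values off
    [diag_set] so that the required bounds hold everywhere. *)
Definition diag_phase (x : borel X) : R[i] :=
  if pselect (diag_set x) then delta x ord0 ord0 else 1.
Definition diag_rate (x : borel X) : R :=
  if pselect (diag_set x) then Im (ddelta x ord0 ord0 * conjc (delta x ord0 ord0)) else 0.

Lemma diag_phase_in x : diag_set x -> diag_phase x = delta x ord0 ord0.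
Proof. by move=> h; rewrite /diag_phase; case: (pselect (diag_set x)). Qed.
Lemma diag_phase_out x : ~ diag_set x -> diag_phase x = 1.
Proof. by move=> h; rewrite /diag_phase; case: (pselect (diag_set x)). Qed.
Lemma diag_rate_in x : diag_set x ->
  diag_rate x = Im (ddelta x ord0 ord0 * conjc (delta x ord0 ord0)).
Proof. by move=> h; rewrite /diag_rate; case: (pselect (diag_set x)). Qed.
Lemma diag_rate_out x : ~ diag_set x -> diag_rate x = 0.
Proof. by move=> h; rewrite /diag_rate; case: (pselect (diag_set x)). Qed.

(** As [delta_00] has modulus 1 along the orbits in [diag_set], its derivative is
    orthogonal to it, that is [i] times a real multiple of it. The set is invariant under the
    flow, so the trivial values off it cause no jump. *)
Lemma diag_log_deriv : log_deriv (T := borel X) F diag_phase diag_rate.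
Proof.
have [F0 FD _ _] := FC1.
have dC := delta_C1 ord0 ord0; have [dr di] := dC.
have [cd cdd] := mC1_cont delta_C1.
have [K K0 dK] := ccont_bounded (cdd ord0 ord0).
have bR x : `|Re (ddelta x ord0 ord0)| <= K by apply: le_trans (Re_le_normc _) _.
have bI x : `|Im (ddelta x ord0 ord0)| <= K by apply: le_trans (Im_le_normc _) _.
have lip f df : rC1 F f df -> (forall x, `|df x| <= K) -> forall x t, `|f (F t x) - f x| <= K * `|t|.
  move=> [_ _ Df] dfK x t; have [s _] := mean_value (h := t) (fun s _ => Df x s); rewrite F0 /= => ->.
  by rewrite normrM ler_wpM2r.
have inv t x : diag_set x -> diag_set (F t x) by move=> h; apply/diag_set_flow.
have inv' t x : ~ diag_set x -> ~ diag_set (F t x) by move=> h /diag_set_flow.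
have Ed x : diag_set x -> su2_diag (delta x) by move/diag_setP/(_ 0); rewrite F0.
split.
- have [mr mi] := ccont_mcf (cd ord0 ord0).
  split.
    have -> : (fun x => Re (diag_phase x)) = (fun x : borel X =>
        if pselect (diag_set x) then Re (delta x ord0 ord0) else 1).
      by apply/funext => x; rewrite /diag_phase; case: pselect.
    by apply: measurable_if_set => //; exact: measurable_diag_set.
  have -> : (fun x => Im (diag_phase x)) = (fun x : borel X =>
      if pselect (diag_set x) then Im (delta x ord0 ord0) else 0).
    by apply/funext => x; rewrite /diag_phase; case: pselect.
  by apply: measurable_if_set => //; exact: measurable_diag_set.
- apply: measurable_if_set => //; first exact: measurable_diag_set.
  exact: (ccont_mcf (ccontM (cdd ord0 ord0) (ccont_conj (cd ord0 ord0)))).2.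
- move=> x; have [h|h] := pselect (diag_set x).
    by rewrite diag_phase_in// su2_diag_norm//; exact: Ed.
  by rewrite diag_phase_out// Normc.normc1.
- exists (K + K); first exact: addr_ge0.
  split=> [x|x t].
    have [h|h] := pselect (diag_set x); last by rewrite diag_rate_out// normr0 addr_ge0.
    rewrite diag_rate_in//; have {}h := Ed x h.
    apply: le_trans (Im_le_normc _) _; rewrite Normc.normcM normc_conj su2_diag_norm// mulr1.
    by apply: le_trans (dK x) _; rewrite lerDl.
  have [h|h] := pselect (diag_set x).
  + rewrite !diag_phase_in//; last exact: inv.
    apply: le_trans (normc_le _) _; rewrite mulrDl.
    rewrite ReD ReN ImD ImN; apply: lerD.
      exact: (lip _ _ dr bR x t).
    exact: (lip _ _ di bI x t).
  + by rewrite !diag_phase_out//; [rewrite subrr Normc.normc0 mulr_ge0// addr_ge0|exact: inv'].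
- move=> x; apply/cvg0_dnbhsP => e e0.
  have [h|h] := pselect (diag_set x); last first.
    exists 1 => // t _ _; rewrite !diag_phase_out// ?diag_rate_out//; last exact: inv'.
    have z0 : 'i * (0 : R)%:C * 1 = 0 :> R[i] by apply: complex_eqP => /=; ring.
    have -> : (t^-1)%:C * (1 - 1) - 'i * (0 : R)%:C * 1 = 0 :> R[i].
      by rewrite subrr mulr0 z0 subrr.
    by rewrite Normc.normc0 normr0.
  have rc : 'i * (diag_rate x)%:C * diag_phase x = ddelta x ord0 ord0.
    rewrite diag_rate_in// diag_phase_in//.
    have n1 y : diag_set y -> Re (delta y ord0 ord0) ^+ 2 + Im (delta y ord0 ord0) ^+ 2 = 1.
      by move=> hy; rewrite -normc2E su2_diag_norm ?expr1n//; exact: Ed.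
    (* derivative of the constant [|delta_00|^2] *)
    have d0 : Re (ddelta x ord0 ord0) * Re (delta x ord0 ord0) +
        Im (ddelta x ord0 ord0) * Im (delta x ord0 ord0) = 0.
      have := rC1_unique FC1 x (rC1D (rC1M dr dr) (rC1M di di)).
      have -> : flow_deriv F (fun x => Re (delta x ord0 ord0) * Re (delta x ord0 ord0) +
          Im (delta x ord0 ord0) * Im (delta x ord0 ord0)) x = 0.
        rewrite /flow_deriv (_ : (fun t => _) = (fun=> 1)); last first.
          by apply/funext => t; rewrite -(n1 (F t x)) ?expr2//; exact: inv.
        exact: is_derive_derive1.
      lra.
    have := n1 x h; move: d0; case: (ddelta x ord0 ord0) => a b; case: (delta x ord0 ord0) => c d /=.
    move=> d0 n0.
    have e1 : a = a * (c ^+ 2 + d ^+ 2) - c * (a * c + b * d) by rewrite n0 d0 mulr1 mulr0 subr0.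
    have e2 : b = b * (c ^+ 2 + d ^+ 2) - d * (a * c + b * d) by rewrite n0 d0 mulr1 mulr0 subr0.
    apply: complex_eqP; rewrite !ReIm /=; [rewrite [RHS]e1|rewrite [RHS]e2]; ring.
  have e4 : 0 < e / 4 by rewrite divr_gt0.
  have [_ _ /(_ x 0)] := dr; rewrite F0 /= => /is_derive_epsP/(_ _ e4)[d1 d10 hd1].
  have [_ _ /(_ x 0)] := di; rewrite F0 /= => /is_derive_epsP/(_ _ e4)[d2 d20 hd2].
  exists (Num.min d1 d2); first by rewrite lt_min d10 d20.
  move=> t t0; rewrite lt_min => /andP[t1 t2]; rewrite rc.
  have -> : diag_phase (F t x) = delta (F t x) ord0 ord0.
    by rewrite diag_phase_in//; exact: inv.
  have -> : diag_phase x = delta x ord0 ord0 by rewrite diag_phase_in.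
  have := hd1 t t1; have := hd2 t t2; rewrite add0r F0 /= => H2 H1.
  have nt : 0 < `|t| by rewrite normr_gt0.
  have close (f0 f1 df : R) : `|f1 - f0 - t * df| <= e / 4 * `|t| ->
      `|t^-1 * (f1 - f0) - df| <= e / 4.
    have -> : t^-1 * (f1 - f0) - df = t^-1 * (f1 - f0 - t * df) by field.
    by rewrite normrM normfV [`|t|^-1 * _]mulrC ler_pdivrMr.
  rewrite ger0_norm ?normc_ge0//; apply: le_lt_trans (normc_le _) _.
  have := close _ _ _ H1; have := close _ _ _ H2.
  move: (ddelta x ord0 ord0) => z; move: (_ ord0 ord0) (_ ord0 ord0) => z1 z0.
  rewrite !ReIm ReC ImC !mul0r subr0 addr0; lra.
Qed.

Section Degree.
Variables (PM : X -> 'M[R[i]]_2) (rho : R).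
Hypotheses (PMP : is_PM F m phi PM) (rhoP : {ae m, forall x, su2_norm (PM x) = rho}).
Hypotheses (rho_gt0 : 0 < rho) (zetaP : is_transfer m rho PM zeta).

Lemma zeta_PM : {ae m, forall x, su2val (zeta x) *m PM x *m adjmx (zeta x) = imdiag rho}.
Proof.
have [[[sPM _ _] _] _] := PMP.
apply: (ae2 rhoP zetaP) => x nx zx.
by rewrite {1}zx transfer_diag// -zx -mulmxA su2_adjr mulmx1.
Qed.

(** [phi] intertwines [PM] and [PM o F_1] because [W_phi] fixes [PM], and [zeta] turns both
    into [imdiag rho]. *)
Lemma delta_diag_ae : {ae m, forall x, su2_diag (delta x)}.
Proof.
have [[_ WP] _] := PMP.
have zP1 := mpres_ae (mflow_mpres flow_mflow 1) zeta_PM.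
apply: (ae3 zeta_PM zP1 WP) => x z0 z1 w.
exact: (conj_diag (lt0r_neq0 rho_gt0) z0 z1 w).
Qed.

Let mm x := (su2val (zeta x) *m Mcocycle F phi x *m adjmx (zeta x)) ord0 ord0.
Let nn x := (dzeta x *m adjmx (zeta x)) ord0 ord0.

Lemma ccont_mm : ccont mm.
Proof.
have [cp cdp] := mC1_cont (mC1_SU2 A_atlas FC1 phi_C1).
have [cz cdz] := mC1_cont (mC1_SU2 A_atlas FC1 zeta_C1).
exact: (mcont_mul (mcont_mul cz (mcont_mul cdp (mcont_adj cp))) (mcont_adj cz)).
Qed.

Lemma ccont_nn : ccont nn.
Proof.
have [cz cdz] := mC1_cont (mC1_SU2 A_atlas FC1 zeta_C1).
exact: (mcont_mul cdz (mcont_adj cz)).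
Qed.

(** Testing the projection against [PM] itself, which [zeta] conjugates to [imdiag rho]:
    pointwise the pairing of [M_phi] with [PM] is [rho] times the diagonal entry of
    [zeta M_phi zeta^-1], and [PM] has square norm [rho^2]. *)
Lemma integral_mm : \int[m]_x Im (mm x) = rho.
Proof.
have [[[sPM mPM iPM] WP] orthPM] := PMP.
have qM x : quaternion (Mcocycle F phi x).
  apply: quaternion_mul; first exact: quaternion_lieD A_atlas FC1 _ _ phi_C1.
  exact/quaternion_adj/quaternion_SU2.
have qP x : quaternion (PM x) by have [] := quaternion_su2 (sPM x).
have cM : mcont (Mcocycle F phi).
  have [cp cdp] := mC1_cont (mC1_SU2 A_atlas FC1 phi_C1).
  exact: (mcont_mul cdp (mcont_adj cp)).
have BE (U V : 'M[R[i]]_2) i j : (U - V) i j = U i j - V i j by rewrite !mxE.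
have := orthPM PM PMP.1.
have imm := ccont_Im_rint ccont_mm.
have mmm : measurable_fun [set: borel X] (fun x : borel X => Im (mm x)).
  exact: (ccont_mcf ccont_mm).2.
rewrite (@Rintegral_ae _ (borel X) R m _ (fun x => rho * Im (mm x) - rho ^+ 2)); first last.
- apply: (ae2 zeta_PM rhoP) => x zx nx.
  have e0 : su2_ip (PM x) (PM x) = rho ^+ 2.
    rewrite -nx /su2_norm sqr_sqrtr// su2_ip_quaternion// !mulcJ !ReC.
    by rewrite addr_ge0// sqr_ge0.
  rewrite -e0 /mm -(su2_ip_conj (qM x) zx).
  rewrite !su2_ip_quaternion//; last exact: quaternionB.
  by rewrite !BE !ReIm; ring.
- apply: measurable_funB; last exact: measurable_cst.
  by apply: measurable_funM => //; exact: measurable_cst.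
- have -> : (fun x => su2_ip (Mcocycle F phi x - PM x) (PM x)) = (fun x =>
      Re ((Mcocycle F phi x ord0 ord0 - PM x ord0 ord0) * conjc (PM x ord0 ord0)) +
      Re ((Mcocycle F phi x ord0 ord_max - PM x ord0 ord_max) * conjc (PM x ord0 ord_max))).
    apply/funext => x; rewrite su2_ip_quaternion//; last exact: quaternionB.
    by rewrite !BE.
  have mcM i j := ccont_mcf (cM i j).
  apply: measurable_funD.
    exact: (mcfM (mcfB (mcM ord0 ord0) (mPM ord0 ord0)) (mcf_conj (mPM ord0 ord0))).1.
  exact: (mcfM (mcfB (mcM ord0 ord_max) (mPM ord0 ord_max)) (mcf_conj (mPM ord0 ord_max))).1.
have m1 : fine (m [set: borel X]) = 1.
  by rewrite (_ : m [set: borel X] = 1%E)//; exact: probability_setT.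
rewrite RintegralB//; [|exact: rintZ|exact: finite_measure_integrable_cst].
rewrite RintegralZl// Rintegral_cst// m1 mulr1 => /eqP.
by rewrite subr_eq0 expr2 => /eqP/(mulfI (lt0r_neq0 rho_gt0)).
Qed.

Lemma diag_phase_ae : {ae m, forall x, su2_diag (delta x) /\ delta x ord0 ord0 = diag_phase x}.
Proof.
have H := diag_set_ae delta_diag_ae; apply: (ae2 delta_diag_ae H) => x dx h.
by split=> //; rewrite diag_phase_in.
Qed.

(** The mean rotation rate of the diagonal cocycle is the degree: the coboundary terms
    coming from [zeta] integrate to zero. *)
Lemma integral_diag_rate : \int[m]_x diag_rate x = rho.
Proof.
have Fm1 := mflow_mpres flow_mflow 1.
have inn := ccont_Im_rint ccont_nn; have imm := ccont_Im_rint ccont_mm.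
have inn1 := mpres_rint Fm1 inn.
have mn := (ccont_mcf ccont_nn).2; have mmm := (ccont_mcf ccont_mm).2.
rewrite (@Rintegral_ae _ (borel X) R m _
  (fun x => (Im (nn x) + Im (mm x)) - Im (nn (F 1 x)))); first last.
- have H := diag_set_ae delta_diag_ae; apply: (ae2 delta_diag_ae H) => x dx h.
  rewrite diag_rate_in//.
  have := congr1 (fun M : 'M[R[i]]_2 => M ord0 ord0)
    (log_derivative_conj (zeta x) (phi x) (zeta (F 1 x)) (dzeta x) (dphi x) (dzeta (F 1 x))).
  have -> : su2val (zeta x) *m su2val (phi x) *m adjmx (zeta (F 1 x)) = su2val (delta x) by [].
  rewrite -/(ddelta x) [LHS]mul2E !adjE dx.1 conjc0 mulr0 addr0 => ->.
  have AE (U V : 'M[R[i]]_2) : (U + V) ord0 ord0 = U ord0 ord0 + V ord0 ord0 by rewrite mxE.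
  by rewrite !AE diag_conj_entry// !ImD Im_conj.
- apply: measurable_funB; first exact: measurable_funD.
  exact: (measurableT_comp mn Fm1.1).
- exact: ld_mrho diag_log_deriv.
rewrite RintegralB//; [|exact: rintD].
rewrite RintegralD// (mpres_Rintegral Fm1 inn) addrAC subrr add0r.
exact: integral_mm.
Qed.

End Degree.
End Diagonal_cocycle.

(** * The skew product on one matrix coefficient *)

Section First_factor.
Context {d1 d2 : measure_display} {T1 : measurableType d1} {T2 : measurableType d2}.
Context {R : realType}.
Variables (m1 : probability T1 R) (m2 : probability T2 R).
Local Notation normc := (@Normc.normc R).
Local Notation mu := (m1 \x m2)%E.

Lemma prod_fst (E : set T1) : measurable E -> mu (fst @^-1` E) = m1 E.
Proof.
move=> mE; have -> : (fst @^-1` E : set (T1 * T2)) = E `*` setT.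
  by apply/seteqP; split=> p //= [].
rewrite product_measure1E// -[RHS]mule1; congr (_ * _)%E; exact: probability_setT.
Qed.

Lemma ae_fst (P : T1 -> Prop) : {ae m1, forall x, P x} -> {ae mu, forall p, P p.1}.
Proof.
move=> [N [mN N0 PN]]; exists (fst @^-1` N); split.
- by rewrite -[X in measurable X]setTI; exact: measurable_fst.
- by rewrite -[RHS]N0; exact: prod_fst.
- by move=> p /= h; exact: PN.
Qed.

Lemma ge0_integral_fst (f : T1 -> \bar R) : measurable_fun [set: T1] f ->
  (forall x, 0 <= f x)%E -> (\int[mu]_p f p.1 = \int[m1]_x f x)%E.
Proof.
move=> mf f0.
have := @ge0_integral_pushforward _ _ _ _ _ _ (@measurable_fst _ _ T1 T2) mu setT f measurableT.
rewrite preimage_setT => <-//.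
by apply: eq_measure_integral => A mA _; rewrite /= /pushforward; exact: prod_fst.
Qed.

Lemma L2_fst (u : T1 -> R[i]) : L2 m1 u ->
  L2 mu (fun p => u p.1) /\ L2norm mu (fun p => u p.1) = L2norm m1 u.
Proof.
move=> [mu_ /integrableP[mi iu]].
have mG : measurable_fun [set: T1] (fun x => (normc (u x) ^+ 2)%:E).
  by apply/measurable_EFinP; exact: mcf_normc2.
have m0 x : (0 <= (normc (u x) ^+ 2)%:E)%E by rewrite lee_fin sqr_ge0.
have mfu : measurable_cfun (fun p : T1 * T2 => u p.1).
  by apply: (mcf_comp _ mu_); exact: measurable_fst.
have e : (\int[mu]_p (normc (u p.1) ^+ 2)%:E = \int[m1]_x (normc (u x) ^+ 2)%:E)%E.
  exact: (@ge0_integral_fst (fun x => (normc (u x) ^+ 2)%:E)).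
split; last by rewrite /L2norm /Rintegral e.
split=> //; apply/integrableP; split.
  by apply/measurable_EFinP; exact: mcf_normc2.
under eq_integral do rewrite gee0_abs ?lee_fin ?sqr_ge0//.
rewrite e; move: iu; apply: le_lt_trans.
by apply: ge0_le_integral => //; [exact: measurableT_comp|move=> x _; exact: lee_abs].
Qed.

Lemma ld_fst (F : R -> T1 -> T1) C r : log_deriv F C r ->
  log_deriv (fun t (p : T1 * T2) => (F t p.1, p.2)) (fun p => C p.1) (fun p => r p.1).
Proof.
move=> [mC mr C1 [K K0 [rK CK]] dC]; split.
- by apply: (mcf_comp _ mC); exact: measurable_fst.
- by apply: measurableT_comp => //; exact: measurable_fst.
- by move=> p; exact: C1.
- by exists K => //; split=> [p|p t]; [exact: rK|exact: CK].
- by move=> p; exact: dC.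
Qed.

End First_factor.

Lemma iter_koopman (R : realType) (T : Type) (S : T -> T) (f : T -> R[i]) N x :
  iter N (fun h => h \o S) f x = f (iter N S x).
Proof. by elim: N x => [|N IH] x //; rewrite iterS /= IH -iterSr. Qed.

Lemma mpres_iter d (T : measurableType d) (R : realType) (mu : {measure set T -> \bar R})
  (S : T -> T) N : mpres mu S -> mpres mu (iter N S).
Proof.
move=> SP; elim: N => [|N [mI pI]]; first by split=> //; exact: measurable_id.
split; first exact: (measurableT_comp SP.1 mI).
move=> E mE; rewrite -[RHS](SP.2 E mE) -[RHS]pI//.
by rewrite -[X in measurable X]setTI; exact: SP.1.
Qed.

Section Skew_product.
Variables (R : realType) (X : ptopologicalType).
Variables (m : probability (borel X) R) (F : R -> X -> X).
Variables (haar : probability (borel (SU2 R)) R) (delta : X -> SU2 R).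
Variables (c : borel X -> R[i]) (r : borel X -> R) (rho : R).
Hypotheses (FP : mflow (T := borel X) m F) (haarP : haar_SU2 haar).
Hypothesis (mdelta : measurable_fun [set: borel X] (delta : borel X -> borel (SU2 R))).
Hypothesis (cP : log_deriv (T := borel X) F c r).
Hypothesis (delta_c : {ae m, forall x, su2_diag (delta x) /\ delta x ord0 ord0 = c x}).
Hypothesis (r_avg : {ae m, forall x, (fun N => birkhoff (T := borel X) F r N x / N%:R) @ \oo --> rho}).
Hypothesis (rho0 : rho != 0).
Local Notation normc := (@Normc.normc R).
Local Notation XG := (borel X * borel (SU2 R))%type.
Local Notation mu := (muXG m haar).
Local Notation S := (Defs.skew F delta).
Local Notation Si := (skew_inv F delta).
Local Notation U := (U_skew F delta).
Local Notation Ui := (U_skew_inv F delta).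
Local Notation tens := (tens m haar).
Implicit Types (l j k N : nat) (f g : XG -> R[i]) (u : borel X -> R[i]).

Definition gflow (t : R) (p : XG) : XG := (F t p.1, p.2).
Local Notation Phi := gflow.

Lemma gflowP : mflow mu Phi.
Proof. exact: (@prod_mflow _ _ _ _ _ m haar F FP). Qed.

(** The character of [pi_jk] is the product of [t^k] and of the conjugate of [t^(l - k)], so
    it rotates at [k - (l - k)] times the rate of the phase [t]. *)
Definition wphase l k (p : XG) : R[i] := weight l k (c p.1).
Definition wrate l k (p : XG) : R := (k%:R - (l - k)%:R) * r p.1.
Definition wmean l k : R := (k%:R - (l - k)%:R) * rho.

Lemma weight_ld l k : log_deriv (T := borel X) F (fun x => weight l k (c x))
  (fun x => (k%:R - (l - k)%:R) * r x).
Proof.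
have -> : (fun x => (k%:R - (l - k)%:R) * r x) = (fun x => k%:R * r x + (l - k)%:R * - r x).
  by apply/funext => x; ring.
exact: (ld_mul (ld_exp k cP) (ld_exp (l - k) (ld_conj cP))).
Qed.

Lemma wphase_ld l k : log_deriv Phi (wphase l k) (wrate l k).
Proof. exact: (ld_fst (weight_ld l k)). Qed.

Lemma wmean_neq0 l k : (k <= l)%N -> (2 * k != l)%N -> wmean l k != 0.
Proof.
move=> kl kl2; rewrite mulf_neq0// subr_eq0 eqr_nat.
by apply: contra kl2 => /eqP h; apply/eqP; lia.
Qed.

Lemma wmean_eq0 l k : (2 * k = l)%N -> wmean l k = 0.
Proof.
by move=> h; rewrite /wmean (_ : (l - k)%N = k) ?subrr ?mul0r//; clear -h; lia.
Qed.

Lemma wrate_avg l k : {ae mu, forall p, (fun N => birkhoff Phi (wrate l k) N p / N%:R) @ \oo --> wmean l k}.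
Proof.
have := @ae_fst _ _ _ (borel (SU2 R)) _ m haar _ r_avg.
apply: filterS => p h; apply: (@cvg_ext _ _ (fun N => (k%:R - (l - k)%:R) * (birkhoff (T := borel X) F r N p.1 / N%:R))).
  by move=> N; rewrite mulrA; congr (_ / _); rewrite /birkhoff mulr_sumr.
by apply: cvgM; [exact: cvg_cst|exact: h].
Qed.

Definition pure l j k u (p : XG) : R[i] := u p.1 * rep_coef l j k p.2.

Lemma pure_bound l j k : exists2 K : R, 0 <= K & forall u, L2 m u ->
  L2 mu (pure l j k u) /\ L2norm mu (pure l j k u) <= K * L2norm m u.
Proof.
have [mr [K K0 rK]] := tame_rep_coef R l j k; exists K => // u Lu.
have [Lf nf] := @L2_fst _ _ _ (borel (SU2 R)) _ m haar u Lu.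
have mrs : measurable_cfun (fun p : XG => rep_coef l j k p.2).
  by apply: (mcf_comp _ mr); exact: measurable_snd.
have Lp : L2 mu (pure l j k u).
  have := @L2M _ _ _ mu (fun p : XG => rep_coef l j k p.2) _ K mrs (fun p => rK p.2) Lf.
  by congr L2; apply/funext => p; rewrite mulrC.
split=> //; rewrite -nf -[X in X * _](ger0_norm K0) -normc_real -L2normZ//.
apply: L2norm_le; [exact: Lp.1|exact: L2Z|move=> p].
by rewrite /pure !Normc.normcM normc_real ger0_norm// mulrC ler_wpM2r ?normc_ge0.
Qed.

Lemma L2_pure l j k u : L2 m u -> L2 mu (pure l j k u).
Proof. by have [K _ H] := pure_bound l j k; move=> /H[]. Qed.

Lemma tens_L2 l j k f : tens l j k f -> L2 mu f.
Proof. by case. Qed.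

Lemma tens_pure l j k u : L2 m u -> tens l j k (pure l j k u).
Proof.
by move=> Lu; split; [exact: L2_pure|exists u => //; exact: ae_same_refl].
Qed.

Lemma tens_lin l j k (a : R[i]) f g : tens l j k f -> tens l j k g ->
  tens l j k (fun p => a * f p + g p).
Proof.
move=> [Lf [u Lu fu]] [Lg [v Lv gv]]; split; first by apply: L2D => //; exact: L2Z.
exists (fun x => a * u x + v x); first by apply: L2D => //; exact: L2Z.
apply: ae_same_trans (ae_same_lin a fu gv) _.
by apply: aeW => p; rewrite mulrDl mulrA.
Qed.

Lemma tens0 l j k : tens l j k (fun=> 0).
Proof.
split; first exact: L2_0; exists (fun=> 0); first exact: L2_0.
by apply: aeW => p; rewrite mul0r.
Qed.

Lemma tensZ l j k (a : R[i]) f : tens l j k f -> tens l j k (fun p => a * f p).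
Proof.
move=> tf; have := tens_lin a tf (tens0 l j k).
by congr (tens l j k); apply/funext => p; rewrite addr0.
Qed.

Lemma tensB l j k f g : tens l j k f -> tens l j k g -> tens l j k (fun p => f p - g p).
Proof.
move=> tf tg; have := tens_lin (-1) tg tf.
by congr (tens l j k); apply/funext => p; rewrite mulN1r addrC.
Qed.

Lemma tens_mul l j k (b : borel X -> R[i]) (K : R) f : measurable_cfun b ->
  (forall x, normc (b x) <= K) -> tens l j k f -> tens l j k (fun p => b p.1 * f p).
Proof.
move=> mb bK [Lf [u Lu fu]]; split.
  apply: (@L2M _ _ _ mu _ _ K _ _ Lf); last by move=> p; exact: bK.
  by apply: (mcf_comp _ mb); exact: measurable_fst.
exists (fun x => b x * u x); first exact: (@L2M _ _ _ m _ _ K).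
apply: ae_same_trans (ae_same_mul (fun p : XG => b p.1) fu) _.
by apply: aeW => p; rewrite mulrA.
Qed.

Lemma tens_flow l j k t f : tens l j k f -> tens l j k (fun p => f (Phi t p)).
Proof.
move=> [Lf [u Lu fu]]; split; first exact: (L2_flow gflowP).
exists (fun x => u (F t x)); first exact: (L2_flow FP).
exact: (mpres_ae_same (mflow_mpres gflowP t) fu).
Qed.

Definition wtrans l k N f (p : XG) : R[i] :=
  cocycle Phi (wphase l k) N p * f (Phi N%:R p).
Definition wtrans_inv l k N f (p : XG) : R[i] :=
  conjc (cocycle Phi (wphase l k) N (Phi (- N%:R) p)) * f (Phi (- N%:R) p).

Lemma cocycle_ld l k N : log_deriv (T := borel X) F
  (fun x => cocycle (T := borel X) F (fun x => weight l k (c x)) N x)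
  (birkhoff (T := borel X) F (fun x => (k%:R - (l - k)%:R) * r x) N).
Proof. exact: (ld_cocycle FP N (weight_ld l k)). Qed.

Lemma tens_wtrans l j k N f : tens l j k f -> tens l j k (wtrans l k N f).
Proof.
move=> tf; have ld := cocycle_ld l k N.
apply: (@tens_mul _ _ _ (fun x => cocycle (T := borel X) F (fun x => weight l k (c x)) N x) 1).
- exact: ld_mC ld.
- by move=> x; rewrite (ld_normC ld).
- exact: tens_flow.
Qed.

Lemma tens_wtrans_inv l j k N f : tens l j k f -> tens l j k (wtrans_inv l k N f).
Proof.
move=> tf; have ld := ld_comp FP (- N%:R) (cocycle_ld l k N).
apply: (@tens_mul _ _ _ (fun x => conjc (cocycle (T := borel X) F (fun x => weight l k (c x)) N (F (- N%:R) x))) 1).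
- exact: (mcf_conj (ld_mC ld)).
- by move=> x; rewrite normc_conj (ld_normC ld).
- exact: tens_flow.
Qed.

Lemma wtransK l k N f : wtrans l k N (wtrans_inv l k N f) = f.
Proof.
apply/funext => p; rewrite /wtrans /wtrans_inv (flowNK gflowP) mulrA mulcJ.
by rewrite (normc_cocycle gflowP _ _ (wphase_ld l k)) expr1n mul1r.
Qed.

Lemma skew_preserves : mpres mu S.
Proof. exact: (skew_mpres haarP (mflow_mpres FP 1) mdelta). Qed.

Lemma skew_inv_cancel : cancel S Si /\ cancel Si S.
Proof.
apply: skewK; first by apply/funext => x; exact: (mflow0 FP).
by move=> s t; apply/funext => x; exact: (mflowD FP).
Qed.

Lemma skew_inv_preserves : mpres mu Si.
Proof.
have mSi : measurable_fun setT Si.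
  have mF := (mflow_mpres FP (-1)).1.
  apply: measurable_fun_pair; first by apply: (measurableT_comp mF); exact: measurable_fst.
  apply: measurable_SU2_mul; first exact: measurable_snd.
  apply: measurable_SU2_inv; apply: (measurableT_comp mdelta).
  by apply: (measurableT_comp mF); exact: measurable_fst.
split=> // E mE; rewrite -[LHS](skew_preserves.2 (Si @^-1` E)); last first.
  by rewrite -[X in measurable X]setTI; exact: mSi.
by congr (mu _); apply/seteqP; split=> p /=; rewrite skew_inv_cancel.1.
Qed.

(** [delta] is diagonal almost everywhere, so it acts on [pi_jk] by a character; what remains
    of the Koopman operator is a weighted translation on the base. *)
Lemma skew_tens l j k f : tens l j k f ->
  ae_same mu (fun p => f (S p)) (wtrans l k 1 f).
Proof.
move=> [Lf [u Lu fu]].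
have h1 := mpres_ae_same skew_preserves fu.
have h2 := mpres_ae_same (mflow_mpres gflowP 1) fu.
have h3 := @ae_fst _ _ _ (borel (SU2 R)) _ m haar _ delta_c.
apply: (ae3 h1 h2 h3) => p e1 e2 [dd e3].
rewrite e1 /wtrans /cocycle big_ord_recl big_ord0 mulr1 [f _]e2 (mflow0 gflowP) /=.
by rewrite rep_coef_diag// e3 /wphase; ring.
Qed.

Lemma iter_skew_tens l j k N f : tens l j k f -> ae_same mu (iter N U f) (wtrans l k N f).
Proof.
move=> tf; elim: N => [|N IH].
  by apply: aeW => p; rewrite /wtrans /cocycle big_ord0 mul1r (mflow0 gflowP).
have e : wtrans l k N.+1 f = wtrans l k 1 (wtrans l k N f).
  rewrite /wtrans -(cocycle_iter gflowP (wphase l k) f N.+1) iterS (cocycle_iter gflowP).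
  apply/funext => p; congr (_ * _).
  by rewrite /cocycle big_ord_recl big_ord0 mulr1 (mflow0 gflowP).
rewrite e iterS; apply: ae_same_trans (skew_tens (tens_wtrans N tf)).
exact: (mpres_ae_same skew_preserves IH).
Qed.

Lemma iter_skewE N f p : iter N U f p = f (iter N S p).
Proof. exact: iter_koopman. Qed.
Lemma iter_skew_invE N f p : iter N Ui f p = f (iter N Si p).
Proof. exact: iter_koopman. Qed.

Lemma iter_skewK N : cancel (iter N S) (iter N Si) /\ cancel (iter N Si) (iter N S).
Proof.
have [SK SiK] := skew_inv_cancel; split; elim: N => [|N IH] p //.
  by rewrite iterSr iterS SK IH.
by rewrite iterSr iterS SiK IH.
Qed.

Lemma iter_skew_inv_tens l j k N f : tens l j k f ->
  ae_same mu (iter N Ui f) (wtrans_inv l k N f).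
Proof.
move=> tf; have := iter_skew_tens N (tens_wtrans_inv N tf); rewrite wtransK.
move=> /(mpres_ae_same (mpres_iter N skew_inv_preserves)); apply: filterS => p.
by rewrite iter_skewE (iter_skewK N).2 iter_skew_invE => ->.
Qed.

Lemma L2_iter N f : L2 mu f -> L2 mu (iter N U f).
Proof.
move=> Lf; have := L2_comp (mpres_iter N skew_preserves) Lf.
by congr L2; apply/funext => p; rewrite iter_skewE.
Qed.

Lemma L2_iter_inv N f : L2 mu f -> L2 mu (iter N Ui f).
Proof.
move=> Lf; have := L2_comp (mpres_iter N skew_inv_preserves) Lf.
by congr L2; apply/funext => p; rewrite iter_skew_invE.
Qed.

Lemma ip_iter N f g : L2 mu f -> L2 mu g -> ip mu (iter N U f) (iter N U g) = ip mu f g.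
Proof.
move=> Lf Lg; rewrite -[RHS](ip_comp (mpres_iter N skew_preserves) Lf Lg).
by congr (ip mu _ _); apply/funext => p; rewrite iter_skewE.
Qed.

Lemma ip_wtrans l k N f g : L2 mu f -> L2 mu g ->
  ip mu (wtrans l k N f) (wtrans l k N g) = ip mu f g.
Proof.
move=> Lf Lg; rewrite -[RHS](ip_comp (mflow_mpres gflowP N%:R) Lf Lg).
rewrite /ip; congr cintegral; apply/funext => p; rewrite /wtrans.
have n1 : cocycle Phi (wphase l k) N p * conjc (cocycle Phi (wphase l k) N p) = 1.
  by rewrite mulcJ (normc_cocycle gflowP _ _ (wphase_ld l k)) expr1n.
rewrite [X in _ * X](conjcM _ _).
rewrite -[RHS]mul1r -n1; ring.
Qed.

(** Right translation by a diagonal matrix is unitary and acts on the two subspaces by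
    characters, which differ for some diagonal matrix. *)
Lemma tens_orth l j (k k' : 'I_l.+1) f g : k != k' -> tens l j k f -> tens l j k' g ->
  ip mu f g = 0.
Proof.
move=> kk' [Lf [u Lu fu]] [Lg [v Lv gv]].
have [h [dh wh]] := weight_separation R kk'.
rewrite (ip_ae Lf (L2_pure l j k Lu) Lg (L2_pure l j k' Lv) fu gv).
have idP : mpres m (fun x : borel X => x) by split=> //; exact: measurable_id.
have hP := skew_mpres haarP idP (@measurable_cst _ _ (borel X) (borel (SU2 R)) setT h).
have := ip_comp hP (L2_pure l j k Lu) (L2_pure l j k' Lv).
have e k0 w : (fun p : XG => pure l j k0 w (p.1, ((p.2 : SU2 R) * h)%g)) =
    (fun p => weight l k0 (h ord0 ord0) * pure l j k0 w p).
  by apply/funext => p; rewrite /pure /= rep_coef_diag//; ring.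
rewrite !e ipZl; [|exact: L2_pure|by apply: L2Z; exact: L2_pure].
rewrite ipZr; [|exact: L2_pure|exact: L2_pure].
rewrite mulrA => /eqP; rewrite -[X in _ == X]mul1r -subr_eq0 -mulrBl mulf_eq0.
by rewrite subr_eq0 (negbTE wh) => /eqP.
Qed.

Definition mixes f := L2 mu f /\
  forall g, L2 mu g -> (fun N => normc (ip mu f (iter N U g))) @ \oo --> (0 : R).

(** On the side of [f] the power [U^N] is a weighted translation, and both operators are
    invertible isometries, so that [U^N g] may be replaced by the weighted translate of [g]
    even if [g] has components on other coefficients. *)
Lemma mixes_tens l j k f : (k <= l)%N -> (2 * k != l)%N -> tens l j k f -> mixes f.
Proof.
move=> kl k2 tf; have Lf := tens_L2 tf; split=> // g Lg.
have := @mixing_weighted _ _ _ (m \x haar)%E Phi gflowP _ _ _ (wphase_ld l k)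
  (wmean_neq0 kl k2) (wrate_avg l k) f g Lf Lg.
apply: cvg_ext => N; congr normc.
have tw := tens_wtrans_inv N tf; have Lw := tens_L2 tw.
have e1 : ip mu f (wtrans l k N g) = ip mu (wtrans_inv l k N f) g.
  by rewrite -[in LHS](wtransK l k N f) ip_wtrans.
have e2 : ip mu f (iter N U g) = ip mu (wtrans_inv l k N f) g.
  rewrite -(ip_iter N Lw Lg).
  have h := iter_skew_tens N tw; rewrite wtransK in h.
  by apply: (ip_ae Lf (L2_iter N Lw) (L2_iter N Lg) (L2_iter N Lg) (ae_same_sym h)); exact: ae_same_refl.
by rewrite e2 -e1.
Qed.

End Skew_product.

(** * Sums of the coefficient subspaces *)

Section Limits.
Variable R : realType.

Lemma cvg0_le (a b : nat -> R) : (forall N, 0 <= a N) -> (forall N, a N <= b N) ->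
  b @ \oo --> (0 : R) -> a @ \oo --> (0 : R).
Proof.
move=> a0 ab cb; apply: (@squeeze_cvgr _ _ _ _ (fun=> 0) b) => //; last exact: cvg_cst.
by near=> N; rewrite a0 ab.
Unshelve. all: by end_near.
Qed.

Lemma cvg0_sum (I : Type) (s : seq I) (P : pred I) (a : I -> nat -> R) :
  (forall i, P i -> a i @ \oo --> (0 : R)) ->
  (fun N => \sum_(i <- s | P i) a i N) @ \oo --> (0 : R).
Proof.
move=> ca; elim: s => [|i s IH].
  by apply: (@cvg_ext _ _ (fun=> 0)) => [N|]; [rewrite big_nil|exact: cvg_cst].
case Pi : (P i); last by apply: cvg_ext IH => N; rewrite big_cons Pi.
apply: (@cvg_ext _ _ (fun N => a i N + \sum_(i <- s | P i) a i N)) => [N|].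
  by rewrite big_cons Pi.
by rewrite -[X in _ --> X]addr0; apply: cvgD => //; exact: ca.
Qed.

End Limits.

Section L2_sums.
Context {d : measure_display} {T : measurableType d} {R : realType}.
Variable mu : {measure set T -> \bar R}.

Lemma L2norm_sum (I : Type) (s : seq I) (P : pred I) (u : I -> T -> R[i]) :
  (forall i, P i -> L2 mu (u i)) ->
  L2norm mu (fun x => \sum_(i <- s | P i) u i x) <= \sum_(i <- s | P i) L2norm mu (u i).
Proof.
move=> Lu; elim: s => [|i s IH].
  by under [X in L2norm mu X]eq_fun do rewrite big_nil; rewrite big_nil L2norm0.
under [X in L2norm mu X]eq_fun do rewrite big_cons; rewrite big_cons.
case Pi : (P i) => //; apply: le_trans (L2normD (Lu i Pi) (L2_sum s Lu)) _.
exact: lerD.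
Qed.

Lemma L2cvg_unique (u v : nat -> T -> R[i]) f g :
  (forall N, L2 mu (u N)) -> (forall N, L2 mu (v N)) -> L2 mu f -> L2 mu g ->
  (forall N, ae_same mu (u N) (v N)) -> L2cvg mu u f -> L2cvg mu v g -> ae_same mu f g.
Proof.
move=> Lu Lv Lf Lg uv cu cv.
have L0 : L2norm mu (fun x => f x - g x) = 0.
  have c0 : (fun N => L2norm mu (fun x => u N x - f x) + L2norm mu (fun x => v N x - g x))
      @ \oo --> (0 : R).
    by rewrite -[X in _ --> X]addr0; exact: cvgD.
  have cst : (fun=> L2norm mu (fun x => f x - g x)) @ \oo --> (0 : R).
    apply: cvg0_le c0 => N; first exact: L2norm_ge0.
    apply: le_trans (L2normB_le Lf (Lu N) Lg) _; rewrite L2normBC lerD2l.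
    rewrite le_eqVlt; apply/orP; left; apply/eqP.
    apply: L2norm_ae; [exact: L2B|exact: L2B|].
    by apply: filterS (uv N) => x ->.
  apply: cvg_unique cst; first exact: Rhausdorff.
  exact: cvg_cst.
apply: filterS (L2norm_eq0 (L2B Lf Lg) L0) => x /eqP.
by rewrite subr_eq0 => /eqP.
Qed.

End L2_sums.

Section Generator_sums.
Context {d : measure_display} {T : measurableType d} {R : realType}.
Variables (mu : {measure set T -> \bar R}) (Phi : R -> T -> T).
Hypothesis PhiP : mflow mu Phi.

Lemma gen0 : gen mu Phi (fun=> 0) (fun=> 0).
Proof.
apply/genP; split; [exact: L2_0|exact: L2_0|move=> e e0].
exists 1 => // t _ _; rewrite (_ : (fun x => _) = (fun=> 0)) ?L2norm0//.
by apply/funext => x; rewrite /diffq !subrr mulr0 subrr.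
Qed.

Lemma gen_sum (I : Type) (s : seq I) (f h : I -> T -> R[i]) :
  (forall i, gen mu Phi (f i) (h i)) ->
  gen mu Phi (fun x => \sum_(i <- s) f i x) (fun x => \sum_(i <- s) h i x).
Proof.
move=> G; elim: s => [|i s IH].
  have -> : (fun x => \sum_(i <- [::]) f i x) = (fun=> 0) by apply/funext => x; rewrite big_nil.
  have -> : (fun x => \sum_(i <- [::]) h i x) = (fun=> 0) by apply/funext => x; rewrite big_nil.
  exact: gen0.
have e (u : I -> T -> R[i]) : (fun x => \sum_(j <- i :: s) u j x) =
    (fun x => 1 * u i x + \sum_(j <- s) u j x).
  by apply/funext => x; rewrite big_cons mul1r.
by rewrite !e; exact: gen_lin.
Qed.

End Generator_sums.

Section Components.
Local Opaque rep_coef.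
Variables (R : realType) (X : ptopologicalType).
Variables (m : probability (borel X) R) (F : R -> X -> X).
Variables (haar : probability (borel (SU2 R)) R) (l j : nat).
Hypotheses (FP : mflow (T := borel X) m F) (haarP : haar_SU2 haar).
Local Notation normc := (@Normc.normc R).
Local Notation XG := (borel X * borel (SU2 R))%type.
Local Notation mu := (muXG m haar).
Local Notation tens := (tens m haar l j).
Local Notation K := (Hspace m haar l j).
Local Notation Phi := (gflow F).
Implicit Types (f g h : XG -> R[i]) (u v : 'I_l.+1 -> XG -> R[i]).

Lemma L2_tens_sum u : (forall k : 'I_l.+1, tens k (u k)) -> L2 mu (fun p => \sum_k u k p).
Proof. by move=> tu; apply: L2_sum => k _; exact: tens_L2 (tu k). Qed.

Lemma hspace_ae f u : L2 mu f -> (forall k : 'I_l.+1, tens k (u k)) ->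
  ae_same mu f (fun p => \sum_k u k p) -> K f.
Proof. by move=> Lf tu fu; split=> //; exists u. Qed.

Lemma hspace_sum u : (forall k : 'I_l.+1, tens k (u k)) -> K (fun p => \sum_k u k p).
Proof.
by move=> tu; apply: (hspace_ae (L2_tens_sum tu) tu); exact: ae_same_refl.
Qed.

Lemma hspace_L2 f : K f -> L2 mu f. Proof. by case. Qed.

Lemma hspace_lin (a : R[i]) f g : K f -> K g -> K (fun p => a * f p + g p).
Proof.
move=> [Lf [u [tu fu]]] [Lg [v [tv gv]]].
apply: (@hspace_ae _ (fun k p => a * u k p + v k p)).
- by apply: L2D => //; exact: L2Z.
- by move=> k; apply: tens_lin; [exact: tu|exact: tv].
- apply: ae_same_trans (ae_same_lin a fu gv) _.
  by apply: aeW => p; rewrite mulr_sumr -big_split.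
Qed.

Lemma tens_single (k : 'I_l.+1) f : tens k f ->
  (forall k' : 'I_l.+1, tens k' (if k' == k then f else fun=> 0)) /\
  ae_same mu f (fun p => \sum_(k' < l.+1) (if k' == k then f else fun=> 0) p).
Proof.
move=> tf; split; first by move=> k'; case: eqP => [->|_]; [exact: tf|exact: tens0].
apply: aeW => p; rewrite (bigD1 k)//= eqxx big1 ?addr0// => k' /negbTE ->.
by [].
Qed.

Lemma tens_hspace (k : 'I_l.+1) f : tens k f -> K f.
Proof.
by move=> tf; have [ts es] := tens_single tf; exact: (hspace_ae (tens_L2 tf) ts es).
Qed.

Lemma tens_pair u v (k : 'I_l.+1) : (forall k : 'I_l.+1, tens k (u k)) -> tens k (v k) ->
  ip mu (fun p => \sum_i u i p) (v k) = ip mu (u k) (v k).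
Proof.
move=> tu tv; have tL i : L2 mu (u i) := tens_L2 (tu i).
rewrite (ip_suml _ (tens_L2 tv) (fun i _ => tL i)) (bigD1 k isT) /= big1 ?addr0//.
by move=> i ik; exact: (tens_orth haarP ik (tu i) tv).
Qed.

(** The differences of the components are mutually orthogonal and have sum zero, so each of
    them is orthogonal to itself. *)
Lemma component_unique u v : (forall k : 'I_l.+1, tens k (u k)) -> (forall k : 'I_l.+1, tens k (v k)) ->
  ae_same mu (fun p => \sum_k u k p) (fun p => \sum_k v k p) ->
  forall k, ae_same mu (u k) (v k).
Proof.
move=> tu tv uv k; pose w k p := u k p - v k p.
have tw (k' : 'I_l.+1) : tens k' (w k') by apply: tensB; [exact: tu|exact: tv].
have w0 : ae_same mu (fun p => \sum_i w i p) (fun=> 0).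
  by apply: filterS uv => p e; rewrite /w sumrB e subrr.
have Lk := tens_L2 (tw k).
have : ip mu (w k) (w k) = 0.
  rewrite -(tens_pair tw (tw k)) -[RHS](@ip0l _ _ _ mu (w k)).
  apply: ip_ae => //; [exact: L2_tens_sum|exact: L2_0|exact: ae_same_refl].
move=> /(ip_self_eq0 Lk); apply: filterS => p /eqP.
by rewrite /w subr_eq0 => /eqP.
Qed.

Lemma component_norm f u k : L2 mu f -> (forall k : 'I_l.+1, tens k (u k)) ->
  ae_same mu f (fun p => \sum_k u k p) -> L2norm mu (u k) <= L2norm mu f.
Proof.
move=> Lf tu fu; have Lk := tens_L2 (tu k).
have e : ip mu f (u k) = (L2norm mu (u k) ^+ 2)%:C.
  rewrite -(ip_self Lk) -(tens_pair tu (tu k)).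
  by apply: ip_ae => //; [exact: L2_tens_sum|exact: ae_same_refl].
have := cauchy_schwarz Lf Lk; rewrite e normc_real ger0_norm ?sqr_ge0// expr2.
have [->|n0] := eqVneq (L2norm mu (u k)) 0; first by move=> _; exact: L2norm_ge0.
by rewrite ler_pM2r// lt_neqAle eq_sym n0 L2norm_ge0.
Qed.

Lemma component_exists f : exists u, (forall k : 'I_l.+1, tens k (u k)) /\
  (K f -> ae_same mu f (fun p => \sum_k u k p)).
Proof.
have [[_ [u [tu fu]]]|nK] := pselect (K f).
  by exists u; split=> // k; exact: tu.
by exists (fun=> fun=> 0); split=> // k; exact: tens0.
Qed.

(** A choice of components, made for all functions so that operators can be defined
    componentwise; functions outside the sum get zero components. *)
Definition component f : 'I_l.+1 -> XG -> R[i] := projT1 (cid (component_exists f)).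

Lemma component_tens f (k : 'I_l.+1) : tens k (component f k).
Proof. by rewrite /component; case: cid => u [tu _] /=. Qed.

Lemma component_sum f : K f -> ae_same mu f (fun p => \sum_k component f k p).
Proof. by rewrite /component; case: cid => u [_ fu] /=. Qed.

Lemma component_ae f u : K f -> (forall k : 'I_l.+1, tens k (u k)) ->
  ae_same mu f (fun p => \sum_k u k p) -> forall k, ae_same mu (component f k) (u k).
Proof.
move=> Kf tu fu; apply: component_unique => //; first exact: component_tens.
exact: ae_same_trans (ae_same_sym (component_sum Kf)) fu.
Qed.

Section Weighted_sum.
Variables (b : 'I_l.+1 -> borel X -> R[i]) (t M : R).
Hypotheses (mb : forall k, measurable_cfun (b k)) (bM : forall k x, normc (b k x) <= M).

(** The form shared by the commutators and by their limit. *)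
Definition wsum f (p : XG) : R[i] := \sum_k b k p.1 * component f k (Phi t p).

Lemma wsum_tens (k : 'I_l.+1) f : tens k f -> tens k (fun p => b k p.1 * f (Phi t p)).
Proof. by move=> tf; apply: (tens_mul (mb k) (bM k)); exact: (tens_flow FP). Qed.

Lemma wsum_hspace f : K (wsum f).
Proof. by apply: hspace_sum => k; apply: wsum_tens; exact: component_tens. Qed.

Lemma wsum_ae f u : K f -> (forall k : 'I_l.+1, tens k (u k)) ->
  ae_same mu f (fun p => \sum_k u k p) ->
  ae_same mu (wsum f) (fun p => \sum_k b k p.1 * u k (Phi t p)).
Proof.
move=> Kf tu fu.
apply: (@ae_same_sum _ _ _ mu _ _ xpredT (fun k p => b k p.1 * component f k (Phi t p))) => k _.
apply: (ae_same_mul (fun p : XG => b k p.1)).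
exact: (mpres_ae_same (mflow_mpres (gflowP haar FP) t) (component_ae Kf tu fu k)).
Qed.

Lemma wsum_bounded : bounded_op mu K wsum.
Proof.
split; first by move=> f _; exact: wsum_hspace.
  move=> a f g Kf Kg.
  have tl (k : 'I_l.+1) : tens k (fun p => a * component f k p + component g k p).
    by apply: tens_lin; exact: component_tens.
  have e : ae_same mu (fun p => a * f p + g p)
      (fun p => \sum_k (a * component f k p + component g k p)).
    apply: ae_same_trans (ae_same_lin a (component_sum Kf) (component_sum Kg)) _.
    by apply: aeW => p; rewrite mulr_sumr -big_split.
  apply: ae_same_trans (wsum_ae (hspace_lin a Kf Kg) tl e) _.
  apply: aeW => p; rewrite /wsum mulr_sumr -big_split; apply: eq_bigr => k _ /=; ring.
have M0 : 0 <= M by exact: le_trans (normc_ge0 _) (bM ord0 point).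
exists (\sum_(k < l.+1) M) => f Kf; rewrite mulr_suml.
apply: le_trans (@L2norm_sum _ _ _ mu _ _ xpredT (fun k p => b k p.1 * component f k (Phi t p)) _) _.
  by move=> k _; apply: tens_L2 (wsum_tens (component_tens f k)).
apply: ler_sum => k _.
have Lc := tens_L2 (component_tens f k).
have Lcf := tens_L2 (tens_flow FP t (component_tens f k)).
apply: (@le_trans _ _ (M * L2norm mu (component f k))).
  rewrite -(L2norm_comp (mflow_mpres (gflowP haar FP) t) Lc).
  rewrite -[X in X * _](ger0_norm M0) -normc_real -L2normZ//.
  apply: L2norm_le; [exact: (tens_L2 (wsum_tens (component_tens f k))).1|exact: L2Z|move=> p].
  by rewrite !Normc.normcM normc_real ger0_norm// ler_wpM2r ?normc_ge0.
rewrite ler_wpM2l//; apply: component_norm (component_sum Kf); first exact: hspace_L2.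
exact: component_tens.
Qed.

End Weighted_sum.

Lemma gen_pure k (u v : borel X -> R[i]) : gen (T := borel X) m F u v ->
  gen mu Phi (pure l j k u) (pure l j k v).
Proof.
have [C C0 HC] := pure_bound m haar l j k.
move=> /genP[Lu Lv H]; apply/genP; split.
- exact: (HC u Lu).1.
- exact: (HC v Lv).1.
- move=> e e0; have C1 : 0 < C + 1 by rewrite ltr_wpDl.
  have [dl dl0 hd] := H _ (divr_gt0 e0 C1); exists dl => // t t0 td.
  have Lq : L2 m (fun x => diffq (T := borel X) F t u x - v x) by apply: L2B => //; exact: (L2_diffq FP).
  have -> : (fun p => diffq Phi t (pure l j k u) p - pure l j k v p) =
      pure l j k (fun x => diffq (T := borel X) F t u x - v x).
    by apply/funext => p; rewrite /diffq /pure /=; ring.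
  apply: le_lt_trans (HC _ Lq).2 _.
  have := hd t t0 td; rewrite ltr_pdivlMr// mulrC; apply: le_lt_trans.
  by rewrite mulrDl mul1r lerDl L2norm_ge0.
Qed.

Lemma A_graph_hspace f h : A_graph F m haar l j f h -> K f /\ K h.
Proof.
move=> [Lf Lh [u [v [G fu hv]]]]; split.
  apply: (@hspace_ae _ (fun k => pure l j k (u k))) => // k; apply: tens_pure.
  by have [] := G k.
apply: (@hspace_ae _ (fun k => pure l j k (v k))) => // k; apply: tens_pure.
by have [] := G k.
Qed.

Lemma A_graph_lin (a : R[i]) f h f' h' : A_graph F m haar l j f h ->
  A_graph F m haar l j f' h' ->
  A_graph F m haar l j (fun p => a * f p + f' p) (fun p => a * h p + h' p).
Proof.
move=> [Lf Lh [u [v [G fu hv]]]] [Lf' Lh' [u' [v' [G' fu' hv']]]]; split.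
- by apply: L2D => //; exact: L2Z.
- by apply: L2D => //; exact: L2Z.
exists (fun k x => a * u k x + u' k x), (fun k x => a * v k x + v' k x); split.
- by move=> k; exact: (gen_lin FP a (G k) (G' k)).
- apply: ae_same_trans (ae_same_lin a fu fu') _; apply: aeW => p.
  by rewrite mulr_sumr -big_split; apply: eq_bigr => k _ /=; ring.
- apply: ae_same_trans (ae_same_lin a hv hv') _; apply: aeW => p.
  by rewrite mulr_sumr -big_split; apply: eq_bigr => k _ /=; ring.
Qed.

(** Componentwise, by [gen_dense]. The tolerance [e1] allows for the norm of the map
    [u |-> u (x) pi_jk] and for the number [l.+1] of components. *)
Lemma A_graph_dense f (e : R) : K f -> 0 < e -> exists g h, A_graph F m haar l j g h /\
  L2norm mu (fun p => f p - g p) < e.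
Proof.
move=> Kf e0; have [Lf [w [tw fw]]] := Kf.
have HV (k : 'I_l.+1) : exists v : borel X -> R[i], L2 m v /\ ae_same mu (w k) (pure l j k v).
  by have [_ [v Lv wv]] := tw k isT; exists v.
have [v vP] := choice HV.
pose C (k : 'I_l.+1) : R := projT1 (cid2 (pure_bound m haar l j k)).
have C0 k : 0 <= C k by rewrite /C; case: cid2.
have CP (k : 'I_l.+1) (u : borel X -> R[i]) : L2 m u -> L2norm mu (pure l j k u) <= C k * L2norm m u.
  by rewrite /C; case: cid2 => C' _ H /= /H[].
pose e1 (k : 'I_l.+1) : R := e / (l.+1%:R * (C k + 1)).
have e10 k : 0 < e1 k by rewrite divr_gt0// mulr_gt0// ltr_wpDl.
have HG (k : 'I_l.+1) : exists gh : (borel X -> R[i]) * (borel X -> R[i]),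
    gen (T := borel X) m F gh.1 gh.2 /\
    L2norm m (fun x => v k x - gh.1 x) < e1 k.
  have [g [h [G n]]] := gen_dense FP (vP k).1 (e10 k).
  by exists (g, h).
have [gh ghP] := choice HG.
pose g p := \sum_(k < l.+1) pure l j k (gh k).1 p.
pose h p := \sum_(k < l.+1) pure l j k (gh k).2 p.
have Lg1 k : L2 m (gh k).1 by have [[]] := ghP k.
have Lg2 k : L2 m (gh k).2 by have [[]] := ghP k.
have Lg : L2 mu g by apply: L2_sum => k _; exact: L2_pure.
have Lh : L2 mu h by apply: L2_sum => k _; exact: L2_pure.
exists g, h; split.
  split=> //; exists (fun k => (gh k).1), (fun k => (gh k).2); split.
  - by move=> k; have [] := ghP k.
  - exact: ae_same_refl.
  - exact: ae_same_refl.
have Ld k : L2 m (fun x => v k x - (gh k).1 x) by apply: L2B => //; exact: (vP k).1.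
have -> : L2norm mu (fun p => f p - g p) =
    L2norm mu (fun p => \sum_(k < l.+1) pure l j k (fun x => v k x - (gh k).1 x) p).
  apply: L2norm_ae; [exact: L2B|by apply: L2_sum => k _; exact: L2_pure|].
  have h1 : ae_same mu (fun p => \sum_(k < l.+1) w k p) (fun p => \sum_(k < l.+1) pure l j k (v k) p).
    by apply: ae_same_sum => k _; exact: (vP k).2.
  apply: (ae2 fw h1) => p -> ->; rewrite /g -sumrB; apply: eq_bigr => k _.
  by rewrite /pure mulrBl.
apply: le_lt_trans (L2norm_sum _ _) _; first by move=> k _; exact: L2_pure.
have -> : e = \sum_(k < l.+1) e / l.+1%:R.
  by rewrite sumr_const card_ord -[RHS]mulr_natr divfK// pnatr_eq0.
apply: ltr_sum => [|k _]; first by apply/hasP; exists ord0; rewrite ?mem_index_enum.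
apply: le_lt_trans (CP k _ (Ld k)) _.
have c1 : 0 < C k + 1 by rewrite ltr_wpDl.
apply: (@le_lt_trans _ _ ((C k + 1) * L2norm m (fun x => v k x - (gh k).1 x))).
  by rewrite ler_wpM2r ?L2norm_ge0// lerDl.
rewrite mulrC -ltr_pdivlMr// -mulrA -invfM; exact: (ghP k).2.
Qed.

(** Complex polarisation turns the vanishing of the quadratic form into that of the
    sesquilinear form on the dense domain; boundedness gives the rest. *)
Lemma operator_eq0 (E : (XG -> R[i]) -> (XG -> R[i])) : bounded_op mu K E ->
  (forall f h, A_graph F m haar l j f h -> ip mu f (E f) = 0) ->
  forall f, K f -> ae_same mu (E f) (fun=> 0).
Proof.
move=> [KE linE [M EM]] q0.
have LE f : K f -> L2 mu (E f) by move=> /KE/hspace_L2.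
have polar f h f' h' : A_graph F m haar l j f h -> A_graph F m haar l j f' h' ->
    ip mu f (E f') = 0.
  move=> Af Af'; have [Kf _] := A_graph_hspace Af; have [Kf' _] := A_graph_hspace Af'.
  have Lf := hspace_L2 Kf; have Lf' := hspace_L2 Kf'.
  have form a : a * ip mu f (E f') + conjc a * ip mu f' (E f) = 0.
    have := q0 _ _ (A_graph_lin a Af Af').
    have Ls := L2D (L2Z a Lf) Lf'.
    have LEs := L2D (L2Z a (LE f Kf)) (LE f' Kf').
    rewrite (ip_ae Ls Ls (LE _ (hspace_lin a Kf Kf')) LEs (ae_same_refl _ _) (linE a f f' Kf Kf')).
    rewrite ipDl//; [|exact: L2Z]; rewrite ipZl//.
    rewrite (ipDr Lf (L2Z a (LE f Kf)) (LE f' Kf')) (ipDr Lf' (L2Z a (LE f Kf)) (LE f' Kf')).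
    rewrite (ipZr a Lf (LE f Kf)) (ipZr a Lf' (LE f Kf)) (q0 _ _ Af) (q0 _ _ Af').
    by rewrite mulr0 add0r addr0.
  have := form 1; have := form (0 +i* 1).
  move: (ip mu f (E f')) (ip mu f' (E f)) => [x1 x2] [y1 y2].
  move=> /eqP; rewrite eq_complex /= => /andP[/eqP e1 /eqP e2].
  move=> /eqP; rewrite eq_complex /= => /andP[/eqP e3 /eqP e4].
  by apply: complex_eqP => /=; lra.
have dom0 f h : A_graph F m haar l j f h -> L2norm mu (E f) = 0.
  move=> Af; have [Kf _] := A_graph_hspace Af; have LEf := LE f Kf.
  apply/eqP; rewrite eq_le L2norm_ge0 andbT; apply/ler_addgt0Pr => e e0; rewrite add0r.
  have [g [h' [Ag ng]]] := A_graph_dense (KE f Kf) e0.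
  have [Kg _] := A_graph_hspace Ag; have Lg := hspace_L2 Kg.
  have e1 : (L2norm mu (E f) ^+ 2)%:C = ip mu (fun p => E f p - g p) (E f).
    by rewrite ipBl// (polar _ _ _ _ Ag Af) subr0 ip_self.
  have [->|n0] := eqVneq (L2norm mu (E f)) 0; first exact: ltW.
  have := cauchy_schwarz (L2B LEf Lg) LEf.
  rewrite -e1 normc_real ger0_norm ?sqr_ge0// expr2 ler_pM2r.
    by move/le_trans; apply; exact: ltW.
  by rewrite lt_neqAle eq_sym n0 L2norm_ge0.
move=> f Kf; apply: L2norm_eq0; first exact: LE.
apply/eqP; rewrite eq_le L2norm_ge0 andbT; apply/ler_addgt0Pr => e e0; rewrite add0r.
have M1 : 0 < `|M| + 1 by rewrite ltr_wpDl.
have [g [h [Ag ng]]] := A_graph_dense Kf (divr_gt0 e0 M1).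
have [Kg _] := A_graph_hspace Ag.
have Kd := hspace_lin (-1) Kg Kf.
have -> : L2norm mu (E f) = L2norm mu (E (fun p => -1 * g p + f p)).
  apply: L2norm_ae; [exact: LE|exact: LE|].
  have h1 := linE (-1) g f Kg Kf.
  have h2 := L2norm_eq0 (LE g Kg) (dom0 g h Ag).
  by apply: (ae2 h1 h2) => p -> ->; rewrite mulr0 add0r.
apply: le_trans (EM _ Kd) _.
have -> : (fun p => -1 * g p + f p) = (fun p => f p - g p).
  by apply/funext => p; rewrite mulN1r addrC.
apply: (@le_trans _ _ ((`|M| + 1) * L2norm mu (fun p => f p - g p))).
  rewrite ler_wpM2r ?L2norm_ge0//; have := ler_norm M; lra.
by rewrite mulrC -ler_pdivlMr// ltW.
Qed.

End Components.

(** * The limit of the commutators and its kernel *)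

Lemma uniform_bound (R : realType) (I : finType) (T : Type) (b : I -> T -> R[i]) :
  (forall i, exists2 M : R, 0 <= M & forall x, Normc.normc (b i x) <= M) ->
  exists M : R, forall i x, Normc.normc (b i x) <= M.
Proof.
move=> bM; have HM i : exists M : R, 0 <= M /\ forall x, Normc.normc (b i x) <= M.
  by have [M] := bM i; exists M.
have [M MP] := choice HM; exists (\sum_i M i) => i x; rewrite (bigD1 i)//=.
apply: le_trans ((MP i).2 x) _; rewrite lerDl sumr_ge0// => k _.
by have [] := MP k.
Qed.

Section Commutator_limit.
Local Opaque rep_coef.
Variables (R : realType) (X : ptopologicalType).
Variables (m : probability (borel X) R) (F : R -> X -> X).
Variables (haar : probability (borel (SU2 R)) R) (delta : X -> SU2 R).
Variables (c : borel X -> R[i]) (r : borel X -> R) (rho : R).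
Hypotheses (FP : mflow (T := borel X) m F) (haarP : haar_SU2 haar).
Hypothesis (mdelta : measurable_fun [set: borel X] (delta : borel X -> borel (SU2 R))).
Hypothesis (cP : log_deriv (T := borel X) F c r).
Hypothesis (delta_c : {ae m, forall x, su2_diag (delta x) /\ delta x ord0 ord0 = c x}).
Hypothesis (r_avg : {ae m, forall x, (fun N => birkhoff (T := borel X) F r N x / N%:R) @ \oo --> rho}).
Hypothesis (rho0 : rho != 0).
Variables (l : nat) (j : nat).
Local Notation normc := (@Normc.normc R).
Local Notation XG := (borel X * borel (SU2 R))%type.
Local Notation mu := (muXG m haar).
Local Notation U := (U_skew F delta).
Local Notation Ui := (U_skew_inv F delta).
Local Notation tens := (tens m haar l j).
Local Notation K := (Hspace m haar l j).
Local Notation Phi := (gflow F).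
Local Notation A_graph := (A_graph F m haar l j).
Local Notation component := (@component R X m haar l j).
Local Notation wtrans := (wtrans F c l).
Local Notation wtrans_inv := (wtrans_inv F c l).
Implicit Types (f g h : XG -> R[i]) (N : nat).

Lemma iter_components N f (u : 'I_l.+1 -> XG -> R[i]) : (forall k : 'I_l.+1, tens k (u k)) ->
  ae_same mu f (fun p => \sum_k u k p) ->
  ae_same mu (iter N U f) (fun p => \sum_(k < l.+1) wtrans k N (u k) p).
Proof.
move=> tu fu.
have h1 := mpres_ae_same (mpres_iter N (skew_preserves FP haarP mdelta)) fu.
have h2 : ae_same mu (fun p => \sum_k u k (iter N (Defs.skew F delta) p))
    (fun p => \sum_(k < l.+1) wtrans k N (u k) p).
  apply: ae_same_sum => k _.
  have := iter_skew_tens FP haarP mdelta cP delta_c N (tu k).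
  by apply: filterS => p <-; rewrite iter_skewE.
by apply: (ae2 h1 h2) => p e1 <-; rewrite iter_skewE.
Qed.

Lemma iter_inv_components N f (u : 'I_l.+1 -> XG -> R[i]) : (forall k : 'I_l.+1, tens k (u k)) ->
  ae_same mu f (fun p => \sum_k u k p) ->
  ae_same mu (iter N Ui f) (fun p => \sum_(k < l.+1) wtrans_inv k N (u k) p).
Proof.
move=> tu fu.
have h1 := mpres_ae_same (mpres_iter N (skew_inv_preserves FP haarP mdelta)) fu.
have h2 : ae_same mu (fun p => \sum_k u k (iter N (skew_inv F delta) p))
    (fun p => \sum_(k < l.+1) wtrans_inv k N (u k) p).
  apply: ae_same_sum => k _.
  have := iter_skew_inv_tens FP haarP mdelta cP delta_c N (tu k).
  by apply: filterS => p <-; rewrite iter_skew_invE.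
by apply: (ae2 h1 h2) => p e1 <-; rewrite iter_skew_invE.
Qed.

Lemma iter_inv_hspace N f : K f -> K (iter N Ui f).
Proof.
move=> Kf; have tc (k : 'I_l.+1) : tens k (component f k) := component_tens m haar j f k.
apply: (hspace_ae (L2_iter_inv FP haarP mdelta N (hspace_L2 Kf)) _
  (iter_inv_components N tc (component_sum Kf))).
by move=> k; exact: (tens_wtrans_inv FP cP N (tc k)).
Qed.

Definition rate_sum (k : nat) N : borel X -> R :=
  birkhoff (T := borel X) F (fun x => (k%:R - (l - k)%:R) * r x) N.
Definition commutator_weight N (k : 'I_l.+1) (x : borel X) : R[i] :=
  - ((rate_sum k N x)%:C * cocycle (T := borel X) F (fun x => weight l k (c x)) N x).
Definition commutator_op N := wsum m F haar j (commutator_weight N) N%:R.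

Lemma commutator_weight_mcf N k : measurable_cfun (commutator_weight N k).
Proof.
have ld := cocycle_ld FP cP l k N.
exact: (mcfN (mcfM (mcf_real (ld_mrho ld)) (ld_mC ld))).
Qed.

Lemma commutator_weight_bound N : exists M : R, forall k x, normc (commutator_weight N k x) <= M.
Proof.
apply: uniform_bound => k; have ld := cocycle_ld FP cP l k N.
have [M M0 [rM _]] := ld_bound ld; exists M => // x.
rewrite /commutator_weight normcN Normc.normcM (ld_normC ld) mulr1 normc_real.
exact: rM.
Qed.

(** Symmetry moves the generator onto [U^N f], which is a sum of weighted translates. The
    Leibniz rule then produces [U^N] of the generator, which cancels, and the Birkhoff sums
    of the rotation rates. *)
Lemma commutator_opP N : is_commutator mu K A_graph (iter N U) (commutator_op N).
Proof.
have [M bM] := commutator_weight_bound N; have bm := commutator_weight_mcf N.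
split; first exact: (wsum_bounded j FP haarP N%:R bm bM).
move=> f h Afh; have [Kf Kh] := A_graph_hspace Afh.
have [Lf Lh [u [v [G fu hv]]]] := Afh.
have Lu k : L2 m (u k) by have [] := G k.
have Lv k : L2 m (v k) by have [] := G k.
have tu (k : 'I_l.+1) : tens k (pure l j k (u k)) by exact: tens_pure.
have tv (k : 'I_l.+1) : tens k (pure l j k (v k)) by exact: tens_pure.
have twu (k : 'I_l.+1) : tens k (wtrans k N (pure l j k (u k))) := tens_wtrans FP cP N (tu k).
have twv (k : 'I_l.+1) : tens k (wtrans k N (pure l j k (v k))) := tens_wtrans FP cP N (tv k).
have tB (k : 'I_l.+1) : tens k (fun p => commutator_weight N k p.1 * pure l j k (u k) (Phi N%:R p)).
  exact: (wsum_tens FP N%:R bm bM (tu k)).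
have GP (k : 'I_l.+1) := gen_pure haar l j FP k (G k).
have GW (k : 'I_l.+1) := gen_weighted (gflowP haar FP) N%:R
  (ld_cocycle (gflowP haar FP) N (wphase_ld cP l k)) (GP k).
have sym := gen_sym (gflowP haar FP) (gen_sum (gflowP haar FP) (index_enum 'I_l.+1) GP)
  (gen_sum (gflowP haar FP) (index_enum 'I_l.+1) GW).
have Lf' := L2_tens_sum tu; have Lh' := L2_tens_sum tv.
have LWu := L2_tens_sum twu; have LWv := L2_tens_sum twv; have LB := L2_tens_sum tB.
have LUf := L2_iter FP haarP mdelta N Lf; have LUh := L2_iter FP haarP mdelta N Lh.
have LBf : L2 mu (commutator_op N f) := hspace_L2 (wsum_hspace haar j FP N%:R bm bM f).
rewrite (ip_ae Lf Lf' LBf LB fu (wsum_ae FP haarP (commutator_weight N) N%:R Kf tu fu)).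
rewrite (ip_ae Lh Lh' LUf LWu hv (iter_components N tu fu)).
rewrite (ip_ae Lf Lf' LUh LWv fu (iter_components N tv hv)).
rewrite [X in _ = X - _]sym.
rewrite [X in _ = ip _ _ X - _](_ : _ = fun p => (\sum_(k < l.+1) wtrans k N (pure l j k (v k)) p) +
  \sum_(k < l.+1) commutator_weight N k p.1 * pure l j k (u k) (Phi N%:R p)); last first.
  apply/funext => p; rewrite -big_split; apply: eq_bigr => k _ /=.
  by rewrite /commutator_weight mulNr mulrA.
by rewrite ipDr// addrAC subrr add0r.
Qed.

Definition limit_op := wsum m F haar j (fun (k : 'I_l.+1) (_ : borel X) => - (wmean rho l k)%:C) 0.

Lemma limit_weight_bound : exists M : R, forall (k : 'I_l.+1) (x : borel X),
  normc (- (wmean rho l k)%:C) <= M.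
Proof.
apply: (@uniform_bound _ _ (borel X) (fun (k : 'I_l.+1) _ => - (wmean rho l k)%:C)) => k.
by exists `|wmean rho l k| => // _; rewrite normcN normc_real.
Qed.

Lemma limit_hspace f : K (limit_op f).
Proof.
have [M bM] := limit_weight_bound.
exact: (@wsum_hspace _ _ _ _ haar _ j FP (fun k _ => - (wmean rho l k)%:C) 0 M (fun k => mcf_cst _) bM).
Qed.

Lemma limit_ae f (u : 'I_l.+1 -> XG -> R[i]) : K f -> (forall k : 'I_l.+1, tens k (u k)) ->
  ae_same mu f (fun p => \sum_k u k p) ->
  ae_same mu (limit_op f) (fun p => \sum_(k < l.+1) - (wmean rho l k)%:C * u k p).
Proof.
move=> Kf tu fu; apply: ae_same_trans (wsum_ae FP haarP _ 0 Kf tu fu) _.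
by apply: aeW => p; apply: eq_bigr => k _; rewrite (mflow0 (gflowP haar FP)).
Qed.

(** On a component, [N^-1] times the commutator after [U^-N] is multiplication by minus the
    Birkhoff average of the rotation rate. *)
Lemma limit_opP : is_slim mu K
  (fun N f p => N%:R^-1 * commutator_op N (iter N Ui f) p) limit_op.
Proof.
move=> f Kf; split; first exact: limit_hspace.
have tc (k : 'I_l.+1) : tens k (component f k) := component_tens m haar j f k; have Lc (k : 'I_l.+1) := tens_L2 (tc k).
pose a (k : 'I_l.+1) N := L2norm mu (fun p =>
  (birkhoff Phi (wrate r l k) N p / N%:R)%:C * component f k p - (wmean rho l k)%:C * component f k p).
have ca k : a k @ \oo --> (0 : R).
  exact: (@birkhoff_L2cvg _ _ _ (m \x haar)%E Phi (gflowP haar FP) _ _ _ (wphase_ld cP l k)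
    (wrate_avg haar r_avg l k) _ (Lc k)).
apply: (@cvg0_le _ _ (fun N => \sum_(k < l.+1) a k N)) => [N|N|].
- exact: L2norm_ge0.
- have [M bM] := commutator_weight_bound N; have bm := commutator_weight_mcf N.
  have KUf := iter_inv_hspace N Kf.
  have tw (k : 'I_l.+1) : tens k (wtrans_inv k N (component f k)) := tens_wtrans_inv FP cP N (tc k).
  have h1 := wsum_ae FP haarP (commutator_weight N) N%:R KUf tw
    (iter_inv_components N tc (component_sum Kf)).
  have h2 := limit_ae Kf tc (component_sum Kf).
  have LB : L2 mu (commutator_op N (iter N Ui f)) := hspace_L2 (wsum_hspace haar j FP N%:R bm bM _).
  have LD := hspace_L2 (limit_hspace f).
  have Ld (k : 'I_l.+1) : L2 mu (fun p =>
      - ((birkhoff Phi (wrate r l k) N p / N%:R)%:C * component f k p - (wmean rho l k)%:C * component f k p)).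
    apply: L2N; apply: L2B; last exact: L2Z.
    have ld := cocycle_ld FP cP l k N; have [M' M'0 [rM _]] := ld_bound ld.
    apply: (tens_L2 (l := l) (j := j) (k := k)).
    apply: (@tens_mul _ _ _ _ _ _ _ (fun x => (rate_sum k N x / N%:R)%:C) (M' * `|N%:R^-1|)) => //.
      by apply: mcf_real; apply: measurable_funM; [exact: ld_mrho ld|exact: measurable_cst].
    by move=> x; rewrite normc_real normrM ler_wpM2r//; exact: rM.
  rewrite (@L2norm_ae _ _ _ mu _ (fun p => \sum_(k < l.+1)
      - ((birkhoff Phi (wrate r l k) N p / N%:R)%:C * component f k p - (wmean rho l k)%:C * component f k p))).
  + apply: le_trans (L2norm_sum _ (fun k _ => Ld k)) _.
    by apply: ler_sum => k _; rewrite L2normN.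
  + by apply: L2B => //; exact: L2Z.
  + by apply: L2_sum => k _; exact: Ld.
  + apply: (ae2 h1 h2) => p e1 e2; rewrite [commutator_op _ _ _]e1 e2.
    rewrite mulr_sumr -sumrB; apply: eq_bigr => k _.
    have e : component f k p = wtrans k N (wtrans_inv k N (component f k)) p.
      by rewrite (wtransK haar FP cP).
    rewrite [in RHS]e /wtrans -[(_ / _)%:C](_ : N%:R^-1 * (birkhoff Phi (wrate r l k) N p)%:C = _); last first.
      by rewrite mulrC rmorphM fmorphV rmorph_nat.
    have e3 : commutator_weight N k p.1 = - ((birkhoff Phi (wrate r l k) N p)%:C *
      cocycle Phi (wphase c l k) N p) by [].
    rewrite e3 e /wtrans; ring.
- by apply: cvg0_sum => k _; exact: ca.
Qed.

Lemma limit_is_D : is_D F m haar delta l j limit_op.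
Proof. by exists commutator_op; [exact: commutator_opP|exact: limit_opP]. Qed.

(** Each commutator is determined by its quadratic form on the domain of the generator, and
    strong limits are unique. *)
Lemma is_D_unique D : is_D F m haar delta l j D -> forall f, K f -> ae_same mu (D f) (limit_op f).
Proof.
move=> [B BP slimD] f Kf.
have sameB N g : K g -> ae_same mu (B N g) (commutator_op N g).
  move=> Kg; have [[KB linB [M BM]] BN] := BP N.
  have [[KC linC [M' CM]] CN] := commutator_opP N.
  pose E h p := -1 * commutator_op N h p + B N h p.
  have Eb : bounded_op mu K E.
    split.
    - by move=> h Kh; apply: hspace_lin; [exact: KC|exact: KB].
    - move=> a h h' Kh Kh'; apply: (ae2 (linC a h h' Kh Kh') (linB a h h' Kh Kh')) => p e1 e2.
      by rewrite /E e1 e2; ring.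
    - exists (M' + M) => h Kh; have LC := hspace_L2 (KC h Kh); have LB := hspace_L2 (KB h Kh).
      apply: le_trans (L2normD (L2Z (-1) LC) LB) _; rewrite mulrDl; apply: lerD; last exact: BM.
      by rewrite L2normZ// normcN Normc.normc1 mul1r; exact: CM.
  have E0 : forall h h', A_graph h h' -> ip mu h (E h) = 0.
    move=> h h' Ah; have [Kh _] := A_graph_hspace Ah; have Lh := hspace_L2 Kh.
    have LC := hspace_L2 (KC h Kh); have LB := hspace_L2 (KB h Kh).
    rewrite ipDr//; last exact: L2Z.
    rewrite ipZr// (CN h h' Ah) (BN h h' Ah) rmorphN rmorph1; ring.
  have := operator_eq0 FP Eb E0 Kg; apply: filterS => p /eqP.
  by rewrite /E mulN1r addrC subr_eq0 => /eqP.
have [KDf cD] := slimD f Kf; have [KLf cL] := limit_opP Kf.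
apply: (@L2cvg_unique _ _ _ mu (fun N p => N%:R^-1 * B N (iter N Ui f) p)
  (fun N p => N%:R^-1 * commutator_op N (iter N Ui f) p)) => //.
- move=> N; have [[KB _ _] _] := BP N.
  exact: (L2Z _ (hspace_L2 (KB _ (iter_inv_hspace N Kf)))).
- move=> N; have [[KC _ _] _] := commutator_opP N.
  exact: (L2Z _ (hspace_L2 (KC _ (iter_inv_hspace N Kf)))).
- exact: (hspace_L2 KDf).
- exact: (hspace_L2 KLf).
- by move=> N; apply: ae_same_mul; exact: (sameB N _ (iter_inv_hspace N Kf)).
Qed.

Local Notation moving := (fun k : 'I_l.+1 => (2 * k != l)%N).

(** The limit acts on the component [k] as the scalar [- wmean l k], which vanishes exactly
    when [2 k = l]. *)
Lemma kernel_orth D : (forall f, K f -> ae_same mu (D f) (limit_op f)) ->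
  orth mu K (ker_op mu K D) = fin_sum mu moving (fun k => tens k).
Proof.
move=> DL; apply/seteqP; split=> f.
  move=> [Kf orthf]; have Lf := hspace_L2 Kf; have fc := component_sum Kf.
  have tc (k : 'I_l.+1) : tens k (component f k) := component_tens m haar j f k.
  have still (k : 'I_l.+1) : (2 * k = l)%N -> ae_same mu (component f k) (fun=> 0).
    move=> k2; have Lk := tens_L2 (tc k); have Kk := tens_hspace (tc k).
    have [ts es] := tens_single (tc k).
    apply: (ip_self_eq0 Lk); rewrite -(tens_pair haarP tc (tc k)).
    rewrite -(ip_ae Lf (L2_tens_sum tc) Lk Lk fc (ae_same_refl _ _)).
    apply: orthf; split=> //; apply: ae_same_trans (DL _ Kk) _.
    apply: ae_same_trans (limit_ae Kk ts es) _; apply: aeW => p.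
    rewrite big1// => k' _; have [->|_] := eqVneq k' k; last by rewrite mulr0.
    by rewrite (wmean_eq0 rho k2) oppr0 mul0r.
  split=> //; exists (component f); split; first by move=> k _; exact: tc.
  apply: ae_same_trans fc _.
  have h : ae_same mu (fun p => \sum_(k < l.+1) component f k p)
      (fun p => \sum_(k < l.+1) (if moving k then component f k else fun=> 0) p).
    apply: ae_same_sum => k _; case: ifPn => [_|]; first exact: ae_same_refl.
    by rewrite negbK => /eqP; exact: still.
  apply: filterS h => p ->; rewrite [RHS]big_mkcond; apply: eq_bigr => k _.
  by case: ifP.
move=> [Lf [u [tu fu]]].
pose u' (k : 'I_l.+1) := if moving k then u k else fun=> 0.
have tu' (k : 'I_l.+1) : tens k (u' k).
  by rewrite /u'; case: ifPn => [/tu|_]; [apply|exact: tens0].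
have fu' : ae_same mu f (fun p => \sum_(k < l.+1) u' k p).
  apply: filterS fu => p ->; rewrite big_mkcond; apply: eq_bigr => k _.
  by rewrite /u'; case: ifP.
split; first exact: (hspace_ae Lf tu' fu').
move=> g [Kg Dg]; have Lg := hspace_L2 Kg; have gc := component_sum Kg.
have tc (k : 'I_l.+1) : tens k (component g k) := component_tens m haar j g k.
have d0 : ae_same mu (fun p => \sum_(k < l.+1) - (wmean rho l k)%:C * component g k p) (fun p => \sum_(k < l.+1) 0).
  apply: ae_same_trans (ae_same_sym (limit_ae Kg tc gc)) _.
  apply: ae_same_trans (ae_same_sym (DL g Kg)) _.
  by apply: filterS Dg => p ->; rewrite big1.
have comp0 (k : 'I_l.+1) : moving k -> ae_same mu (component g k) (fun=> 0).
  move=> k2; have kk : (k <= l)%N by rewrite -ltnS ltn_ord.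
  have := component_unique haarP (fun k => tensZ (- (wmean rho l k)%:C) (tc k))
    (fun k => tens0 m haar l j k) d0 k.
  apply: filterS => p /eqP; rewrite mulf_eq0 oppr_eq0 => /orP[|/eqP//].
  move=> /eqP/complexI/eqP; rewrite (negbTE (wmean_neq0 rho0 kk k2)) //.
pose v (k : 'I_l.+1) := if moving k then fun=> 0 else component g k.
have tv (k : 'I_l.+1) : tens k (v k) by rewrite /v; case: ifP => _; [exact: tens0|exact: tc].
have gv : ae_same mu g (fun p => \sum_(k < l.+1) v k p).
  apply: ae_same_trans gc _; apply: ae_same_sum => k _; rewrite /v.
  by case: ifPn => [/comp0//|_]; exact: ae_same_refl.
rewrite (ip_ae Lf (L2_tens_sum tu') Lg (L2_tens_sum tv) fu' gv).
rewrite ip_suml; [|exact: L2_tens_sum|by move=> k _; exact: tens_L2 (tu' k)].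
apply: big1 => k _; rewrite ip_sumr; [|exact: tens_L2 (tu' k)|by move=> k' _; exact: tens_L2 (tv k')].
apply: big1 => k' _; have [->|kk'] := eqVneq k k'; last exact: (tens_orth haarP kk' (tu' k) (tv k')).
have Lk := tens_L2 (tu' k'); move: Lk; rewrite /u' /v; case: ifP => _ Lk; first exact: ip0r.
exact: ip0l.
Qed.

End Commutator_limit.

(** * Mixing passes to orthogonal sums *)

Section Mixing_closure.
Variables (R : realType) (X : ptopologicalType).
Variables (m : probability (borel X) R) (F : R -> X -> X).
Variables (haar : probability (borel (SU2 R)) R) (delta : X -> SU2 R).
Hypotheses (FP : mflow (T := borel X) m F) (haarP : haar_SU2 haar).
Hypothesis (mdelta : measurable_fun [set: borel X] (delta : borel X -> borel (SU2 R))).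
Local Notation normc := (@Normc.normc R).
Local Notation XG := (borel X * borel (SU2 R))%type.
Local Notation mu := (muXG m haar).
Local Notation U := (U_skew F delta).
Local Notation mixes := (mixes m F haar delta).
Implicit Types (f g : XG -> R[i]).

Lemma mixes_ae f f' : L2 mu f' -> ae_same mu f f' -> mixes f -> mixes f'.
Proof.
move=> Lf' ff' [Lf mf]; split=> // g Lg; apply: cvg_ext (mf g Lg) => N; congr normc.
have LU := L2_iter FP haarP mdelta N Lg.
by apply: ip_ae => //; [exact: ae_same_sym|exact: ae_same_refl].
Qed.

Lemma mixes_sum (I : Type) (s : seq I) (P : pred I) (u : I -> XG -> R[i]) :
  (forall i, P i -> mixes (u i)) -> mixes (fun p => \sum_(i <- s | P i) u i p).
Proof.
move=> mu_; have Lu i : P i -> L2 mu (u i) by move=> /mu_[].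
split; first exact: L2_sum.
move=> g Lg; apply: (@cvg0_le _ _ (fun N => \sum_(i <- s | P i) normc (ip mu (u i) (iter N U g)))).
- by move=> N; exact: normc_ge0.
- move=> N; rewrite (ip_suml s (L2_iter FP haarP mdelta N Lg) Lu).
  elim: s => [|i s IH]; first by rewrite !big_nil Normc.normc0.
  rewrite !big_cons; case: ifP => // _; apply: le_trans (le_normcD _ _) _.
  by rewrite lerD2l.
- by apply: cvg0_sum => i /mu_[_]; exact.
Qed.

(** The powers of [U] are isometries, so matrix coefficients depend uniformly in [N] on
    [f]. *)
Lemma mixes_lim (u : nat -> XG -> R[i]) f : (forall n, mixes (u n)) -> L2 mu f ->
  L2cvg mu u f -> mixes f.
Proof.
move=> mu_ Lf uf; split=> // g Lg; apply/cvgrPdist_lt => e e0.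
have M0 : 0 < L2norm mu g + 1 by rewrite ltr_wpDl ?L2norm_ge0.
have e2 : 0 < e / 2 by rewrite divr_gt0.
move/cvgrPdist_lt : uf => /(_ _ (divr_gt0 e2 M0))[n _ /(_ n (leqnn n))].
rewrite sub0r normrN ger0_norm ?L2norm_ge0// => un.
have [Lu cu] := mu_ n.
move/cvgrPdist_lt : (cu g Lg) => /(_ _ e2)[N0 _ hN]; exists N0 => // N /hN.
rewrite !sub0r !normrN !ger0_norm ?normc_ge0// => sN.
have LU := L2_iter FP haarP mdelta N Lg.
have -> : ip mu f (iter N U g) = ip mu (fun p => f p - u n p) (iter N U g) + ip mu (u n) (iter N U g).
  by rewrite ipBl// subrK.
apply: le_lt_trans (le_normcD _ _) _.
have := cauchy_schwarz (L2B Lf Lu) LU.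
have -> : L2norm mu (iter N U g) = L2norm mu g.
  rewrite -[RHS](L2norm_comp (mpres_iter N (skew_preserves FP haarP mdelta)) Lg).
  by congr (L2norm mu _); apply/funext => p; rewrite iter_skewE.
rewrite L2normBC => cs.
have : L2norm mu (fun p => u n p - f p) * L2norm mu g <= e / 2.
  move: un; rewrite ltr_pdivlMr// => un; apply: le_trans (ltW un).
  by rewrite ler_wpM2l ?L2norm_ge0// lerDl.
lra.
Qed.

Lemma mixes_fin_sum (I : finType) (P : pred I) (H : I -> set (XG -> R[i])) f :
  (forall i g, P i -> H i g -> mixes g) -> fin_sum mu P H f -> mixes f.
Proof.
move=> HM [Lf [u [Hu fu]]]; apply: (mixes_ae Lf (ae_same_sym fu)).
by apply: mixes_sum => i Pi; exact: HM Pi (Hu i Pi).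
Qed.

Lemma mixes_hilbert_sum (P : pred nat) (H : nat -> set (XG -> R[i])) f :
  (forall i g, P i -> H i g -> mixes g) -> hilbert_sum mu P H f -> mixes f.
Proof.
move=> HM [Lf [u [Hu fu]]]; apply: (mixes_lim _ Lf fu) => n.
by apply: mixes_sum => i Pi; exact: HM Pi (Hu i Pi).
Qed.

Lemma mixes_sum2 H1 H2 f : (forall g, H1 g -> mixes g) -> (forall g, H2 g -> mixes g) ->
  sum2 mu H1 H2 f -> mixes f.
Proof.
move=> M1 M2 [Lf [f1 [f2 [H1f H2f e]]]]; apply: (mixes_ae Lf (ae_same_sym e)).
have [L1 m1] := M1 f1 H1f; have [L2' m2] := M2 f2 H2f.
have -> : (fun p => f1 p + f2 p) = (fun p => \sum_(b <- [:: true; false]) (if b then f1 else f2) p).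
  by apply/funext => p; rewrite big_cons big_seq1.
by apply: mixes_sum => -[] _.
Qed.

Lemma mixes_cvg f g : mixes f -> L2 mu g ->
  (fun N => ip mu f (iter N U g)) @ \oo --> (0 : R[i]).
Proof. by move=> [_ mf] Lg; apply: cvg_normc0; exact: mf. Qed.

End Mixing_closure.

(** * Decay of the correlations *)

Theorem theorem4p3 (R : realType)
  (X : ptopologicalType) (n : nat) (A : set (chart R X n))
  (m : probability (borel X) R) (F : R -> X -> X)
  (X_compact : compact [set: X]) (X_hausdorff : hausdorff_space X)
  (X_second_countable : @second_countable X) (X_smooth : smooth_atlas A)
  (F_C1 : C1_flow A F) (F_preserves : forall t : R, preserves (F t) m)
  (haar : probability (borel (SU2 R)) R) (haarP : haar_SU2 haar)
  (phi : X -> SU2 R) (phi_C1 : C1_SU2 A phi)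
  (F1_uniquely_ergodic : uniquely_ergodic (F 1) m)
  (PM : X -> 'M[R[i]]_2) (PMP : is_PM F m phi PM)
  (rho : R) (rhoP : {ae m, forall x, su2_norm (PM x) = rho})
  (rho_gt0 : 0 < rho)
  (zeta : X -> SU2 R) (zetaP : is_transfer m rho PM zeta)
  (zeta_C1 : C1_SU2 A zeta) :
  let delta := conj_cocycle F phi zeta in
  let mu := muXG m haar in
  let U := U_skew F delta in
  (forall (l : nat) (j : 'I_l.+1),
    let Hlj := Hspace m haar l j in
    (exists D, is_D F m haar delta l j D) /\
    forall D, is_D F m haar delta l j D ->
      let kerD_perp := orth mu Hlj (ker_op mu Hlj D) in
      [/\ forall f g, kerD_perp f -> Hlj g ->
            (fun N => ip mu f (iter N U g)) @ \oo --> (0 : R[i]),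
          kerD_perp =
            fin_sum mu (fun k : 'I_l.+1 => (2 * k != l)%N)
              (fun k => tens m haar l j k) &
          odd l -> kerD_perp = Hlj]) /\
  mixing_in mu U (H_mix m haar).
Proof.
move=> delta mu U.
have FP : mflow (T := borel X) m F := flow_mflow X_second_countable F_C1 F_preserves.
have rho0 : rho != 0 := lt0r_neq0 rho_gt0.
have mdelta := measurable_delta X_smooth F_C1 phi_C1 zeta_C1.
have cP := diag_log_deriv X_compact X_smooth F_C1 phi_C1 zeta_C1.
have delta_c := diag_phase_ae X_second_countable F_C1 F_preserves PMP rhoP rho_gt0 zetaP.
have r_int := integral_diag_rate X_compact X_second_countable X_smooth F_C1 F_preserves
  phi_C1 zeta_C1 PMP rhoP rho_gt0 zetaP.
have FP1 := mflow_mpres FP 1.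
have r_avg : {ae m, forall x, (fun N => birkhoff (T := borel X) F
    (diag_rate F phi zeta) N x / N%:R) @ \oo --> rho}.
  have [K K0 [rK _]] := ld_bound cP.
  have := birkhoff_ergodic FP1 (uniquely_ergodic_ergodic FP1.1 F1_uniquely_ergodic)
    (ld_mrho cP) rK.
  rewrite r_int; apply: filterS => x; apply: cvg_ext => N; congr (_ / _).
  rewrite /birkhoff /esum; apply: eq_bigr => i _; congr (diag_rate _ _ _ _).
  elim: (i : nat) => [|k IH]; first by rewrite (mflow0 FP).
  by rewrite -natr1 addrC (mflowD FP) IH.
have mixes_comp l j (k : 'I_l.+1) f : (2 * k != l)%N -> tens m haar l j k f ->
    mixes m F haar delta f.
  move=> k2 tf; apply: (mixes_tens FP haarP mdelta cP delta_c r_avg rho0 _ k2 tf).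
  by rewrite -ltnS ltn_ord.
have odd_moving l : odd l -> (fun k : 'I_l.+1 => (2 * k != l)%N) = (fun=> true).
  move=> ol; apply/funext => k; apply/negP => /eqP e; move: ol.
  by rewrite -e mul2n odd_double.
split.
  move=> l j Hlj; split.
    by exists (limit_op m F haar rho l j); exact: (limit_is_D FP haarP mdelta cP delta_c r_avg).
  move=> D DP kerD_perp.
  have kerE : kerD_perp = fin_sum mu (fun k : 'I_l.+1 => (2 * k != l)%N)
      (fun k => tens m haar l j k).
    apply: (kernel_orth FP haarP rho0).
    exact: (is_D_unique FP haarP mdelta cP delta_c r_avg DP).
  split=> //.
  - move=> f g; rewrite kerE => fK Hg; apply: mixes_cvg (hspace_L2 Hg).
    by apply: (mixes_fin_sum FP haarP mdelta _ fK) => k h; exact: mixes_comp.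
  - by move=> ol; rewrite kerE (odd_moving l ol).
move=> f g Hf Lg; apply: mixes_cvg Lg.
apply: (mixes_sum2 FP haarP mdelta _ _ Hf) => h.
  apply: (mixes_hilbert_sum FP haarP mdelta) => l {}h el.
  apply: (mixes_fin_sum FP haarP mdelta) => j {}h _.
  apply: (mixes_fin_sum FP haarP mdelta) => k {}h kl; apply: mixes_comp.
  apply: contra kl => /eqP e; apply/eqP; move: el; lia.
apply: (mixes_hilbert_sum FP haarP mdelta) => l {}h ol.
apply: (mixes_fin_sum FP haarP mdelta) => j {}h _.
apply: (mixes_fin_sum FP haarP mdelta) => k {}h _; apply: mixes_comp.
by have := congr1 (fun P => P k) (odd_moving l ol).
Qed.
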